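(* Let $n\geq 1$ and let $\xi_k$ ($1\le k\le n$) denote an odd variable of degree $q^{-2k}a$, where $a$ denotes Hochschild degree. Let $C$ be a complex of finitely generated graded $(R,R)$-bimodules whose chain bimodules are direct sums of copies of $R\otimes_{R^W}R$ with grading shifts. Then $$\mathrm{HHH}(C)\cong\Lambda[\xi_1,\dots,\xi_n]\otimes_{\mathbb{Q}}\mathrm{HHH}^0(C)$$ as triply graded vector spaces, and, up to a regrading (overall shift of the grading), $\mathrm{HHH}^0$ is the functor which identifies the left and right $R$-actions and then takes homology; that is, $$\mathrm{HHH}^0(C)\cong H\big(R\otimes_{R\otimes_{R^W}R}C\big)$$ up to this regrading.
   Context: $R=\mathbb{Q}[x_1,\dots,x_n]$ is graded with $\deg x_i=2$; $W=S_n$ permutes the variables; $R^W$ is the ring of symmetric polynomials; $R$ is an $R\otimes_{R^W}R$-module via $f\otimes g\mapsto fg$. $M(k)$ is the upward shift, $(M(k))_i=M_{i-k}$; complexes have differential of degree $+1$. $\Lambda[\xi_1,\dots,\xi_n]$ is the exterior algebra. Put $R^e=R\otimes_{\mathbb{Q}}R$. For a graded $(R,R)$-bimodule $M$, $\mathrm{HH}(M)=\bigoplus_{i,j}\mathrm{Ext}^j_{R^e}(R(i),M)$ (Ext in graded modules), bigraded by $q^ia^j$ ($j$ is the Hochschild degree). For a complex $C$ of graded bimodules, $\mathrm{HH}(C)$ is obtained by applying $\mathrm{HH}$ termwise, and $\mathrm{HHH}(C)=H(\mathrm{HH}(C))$, triply graded by $q$-degree, Hochschild degree and homological degree. $\mathrm{HHH}^0(C)$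 is the part of Hochschild degree $0$. *)

(* Defs.v *)
From HB Require Import structures.
From mathcomp Require Import all_boot all_order all_algebra.
From mathcomp Require Import boolp.
From mathcomp Require Import freeg mpoly.

Set Implicit Arguments.
Unset Strict Implicit.
Unset Printing Implicit Defensive.

Import GRing.Theory.
Local Open Scope ring_scope.
Local Open Scope quotient_scope.

Definition subspace (V : lmodType rat) (P : V -> Prop) : Prop :=
  P 0 /\ forall c u v, P u -> P v -> P (c *: u + v).

Definition subspace_pred (V : lmodType rat) (P : V -> Prop)
  (hP : subspace P) : {pred V} := fun x => `[< P x >].

Section SubQuot.
Variables (V : lmodType rat) (P : V -> Prop) (hP : subspace P).

Lemma subspace_predP x : reflect (P x) (x \in subspace_pred hP).
Proof. exact: asboolP. Qed.

Fact subspace_submod_closed : submod_closed (subspace_pred hP).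
Proof.
split; first by apply/subspace_predP; case: hP.
move=> c u v /subspace_predP Pu /subspace_predP Pv; apply/subspace_predP.
by case: hP => _; apply.
Qed.

HB.instance Definition _ :=
  GRing.isSubmodClosed.Build rat V (subspace_pred hP) subspace_submod_closed.

Definition subsp : Type := {x : V | x \in subspace_pred hP}.
HB.instance Definition _ := SubType.on subsp.
HB.instance Definition _ := [Choice of subsp by <:].
HB.instance Definition _ := [SubChoice_isSubLmodule of subsp by <:].

Definition quotsp : Type := Quotient.quot (subspace_pred hP).
HB.instance Definition _ := GRing.Zmodule.on quotsp.

Definition qpi (x : V) : quotsp := \pi_(Quotient.quot (subspace_pred hP)) x.
Definition qrepr (q : quotsp) : V := repr (q : Quotient.quot (subspace_pred hP)).

Lemma qreprK q : qpi (qrepr q) = q. Proof. exact: reprK. Qed.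

Lemma qpiP x y : qpi x = qpi y <-> P (x - y).
Proof.
split=> [/eqP|h]; last apply/eqP; rewrite /qpi -Quotient.idealrBE.
  by move/subspace_predP.
exact/subspace_predP.
Qed.

Lemma qpi_repr x : P (qrepr (qpi x) - x).
Proof. by apply/qpiP; rewrite qreprK. Qed.

Definition qscale (c : rat) (q : quotsp) : quotsp := qpi (c *: qrepr q).

Lemma qpi_additive : {morph qpi : x y / x + y}.
Proof. by move=> x y; rewrite /qpi raddfD. Qed.

Lemma qpiZ c x : qpi (c *: x) = qscale c (qpi x).
Proof.
apply/qpiP; rewrite -scalerBr -[_ *: _]addr0; apply: hP.2; last exact: hP.1.
by apply/qpiP; rewrite qreprK.
Qed.

Fact qscaleA a b q : qscale a (qscale b q) = qscale (a * b) q.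
Proof. by rewrite -{1}(qreprK q) -!qpiZ scalerA qpiZ qreprK. Qed.
Fact qscale1 : left_id 1 qscale.
Proof. by move=> q; rewrite /qscale scale1r qreprK. Qed.
Fact qscaleDr : right_distributive qscale +%R.
Proof.
move=> c p q; rewrite -(qreprK p) -(qreprK q) -qpi_additive -!qpiZ.
by rewrite scalerDr qpi_additive.
Qed.
Fact qscaleDl q : {morph qscale^~ q : a b / a + b}.
Proof.
by move=> a b; rewrite -(qreprK q) -!qpiZ scalerDl qpi_additive.
Qed.

HB.instance Definition _ :=
  GRing.Zmodule_isLmodule.Build rat quotsp qscaleA qscale1 qscaleDr qscaleDl.

Fact qpi_linear : linear qpi.
Proof. by move=> c x y; rewrite qpi_additive qpiZ. Qed.
HB.instance Definition _ := GRing.isLinear.Build rat V quotsp _ qpi qpi_linear.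

End SubQuot.

Section Product.
Variables (I : Type) (V : I -> lmodType rat).

Definition dprod : Type := forall i, V i.
HB.instance Definition _ := gen_eqMixin dprod.
HB.instance Definition _ := gen_choiceMixin dprod.

Implicit Types f g h : dprod.
Definition dprod_zero : dprod := fun=> 0.
Definition dprod_opp f : dprod := fun i => - f i.
Definition dprod_add f g : dprod := fun i => f i + g i.
Definition dprod_scale c f : dprod := fun i => c *: f i.

Local Ltac pw := repeat move=> ?; apply: functional_extensionality_dep => i.
Fact dprod_addA : associative dprod_add. Proof. by pw; apply: addrA. Qed.
Fact dprod_addC : commutative dprod_add. Proof. by pw; apply: addrC. Qed.
Fact dprod_add0 : left_id dprod_zero dprod_add.
Proof. by pw; apply: add0r. Qed.
Fact dprod_addN : left_inverse dprod_zero dprod_opp dprod_add.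
Proof. by pw; apply: addNr. Qed.
HB.instance Definition _ := GRing.isZmodule.Build dprod
  dprod_addA dprod_addC dprod_add0 dprod_addN.

Fact dprod_scaleA a b f : dprod_scale a (dprod_scale b f) = dprod_scale (a * b) f.
Proof. by pw; apply: scalerA. Qed.
Fact dprod_scale1 : left_id 1 dprod_scale. Proof. by pw; apply: scale1r. Qed.
Fact dprod_scaleDr : right_distributive dprod_scale +%R.
Proof. by pw; apply: scalerDr. Qed.
Fact dprod_scaleDl f : {morph dprod_scale^~ f : a b / a + b}.
Proof. by pw; apply: scalerDl. Qed.
HB.instance Definition _ := GRing.Zmodule_isLmodule.Build rat dprod
  dprod_scaleA dprod_scale1 dprod_scaleDr dprod_scaleDl.

End Product.

Section DirectSum.
Variables (I : eqType) (V : I -> lmodType rat).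

Definition finsupport (f : dprod V) : Prop :=
  exists s : seq I, forall i, i \notin s -> f i = 0.

Lemma finsupport_subspace : subspace finsupport.
Proof.
split; first by exists [::].
move=> c f g [s hs] [t ht]; exists (s ++ t) => i.
rewrite mem_cat negb_or => /andP[/hs fi /ht gi].
by rewrite [LHS](_ : _ = c *: f i + g i) // fi gi scaler0 addr0.
Qed.

Definition dsum : Type := subsp finsupport_subspace.
HB.instance Definition _ := GRing.Lmodule.on dsum.
End DirectSum.

Definition zerosp : lmodType rat := 'rV[rat]_0.

Definition linear_iso (V W : lmodType rat) : Prop :=
  exists phi : {linear V -> W}, bijective phi.

(** Homology at [V] of [U -f-> V -g-> W]. *)
Section Homology.
Variables (U V W : lmodType rat) (f : {linear U -> V}) (g : {linear V -> W}).

Lemma ker_subspace : subspace (fun v => g v = 0).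
Proof.
by split=> [|c u v gu gv]; [exact: linear0 | rewrite linearP gu gv scaler0 addr0].
Qed.

Definition cycles : Type := subsp ker_subspace.
HB.instance Definition _ := GRing.Lmodule.on cycles.

Definition boundary (z : cycles) : Prop := exists u, f u = val z.

Lemma boundary_subspace : subspace boundary.
Proof.
split=> [|c u v [x fx] [y fy]]; first by exists 0; rewrite linear0.
by exists (c *: x + y); rewrite linearP fx fy.
Qed.

Definition homology : Type := quotsp boundary_subspace.
HB.instance Definition _ := GRing.Lmodule.on homology.

Lemma cycleP (z : cycles) : g (val z) = 0.
Proof. exact/(subspace_predP ker_subspace)/(valP z). Qed.
Definition mkcycle v (gv : g v = 0) : cycles :=
  exist _ v (introT (subspace_predP ker_subspace v) gv).
End Homology.

(** The map induced on homology by a linear map that preserves cycles and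
    boundaries. *)
Section HomologyMap.
Variables (U V W : lmodType rat) (f : {linear U -> V}) (g : {linear V -> W}).
Variables (U' V' W' : lmodType rat).
Variables (f' : {linear U' -> V'}) (g' : {linear V' -> W'}).
Variable a : {linear V -> V'}.
Hypothesis aZ : forall v, g v = 0 -> g' (a v) = 0.
Hypothesis aB : forall u, exists u', f' u' = a (f u).

Definition cmap (z : cycles g) : cycles g' := mkcycle (aZ (cycleP z)).

Definition hmap_fun (x : homology f g) : homology f' g' :=
  qpi (boundary_subspace f' g') (cmap (qrepr x)).

Lemma hmap_funE z : hmap_fun (qpi (boundary_subspace f g) z) =
  qpi (boundary_subspace f' g') (cmap z).
Proof.
apply/qpiP; have [u fu] := qpi_repr (boundary_subspace f g) z.
have [u' fu'] := aB u; exists u'; rewrite fu' fu.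
by rewrite /cmap /= !raddfB.
Qed.

Fact hmap_linear : linear hmap_fun.
Proof.
move=> c x y; rewrite -(qreprK x) -(qreprK y) -linearP !hmap_funE -linearP.
by congr qpi; apply: val_inj; rewrite /= !linearP.
Qed.

Definition hmap (_ : forall u, exists u', f' u' = a (f u)) :
  homology f g -> homology f' g' := hmap_fun.
HB.instance Definition _ :=
  GRing.isLinear.Build rat _ _ _ (hmap aB) hmap_linear.
End HomologyMap.
Arguments hmap {U V W f g U' V' W' f' g'} a aZ aB.

Lemma hmapE (U V W : lmodType rat) (f : {linear U -> V}) (g : {linear V -> W})
    (U' V' W' : lmodType rat) (f' : {linear U' -> V'}) (g' : {linear V' -> W'})
    (a : {linear V -> V'}) aZ aB (z : cycles g) :
  @hmap U V W f g U' V' W' f' g' a aZ aB (qpi (boundary_subspace f g) z) =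
  qpi (boundary_subspace f' g') (cmap aZ z).
Proof. exact: hmap_funE. Qed.

(** [X ⊗_A Y] for a right action [xa] of [A] on [X] and a left action [ay] of
    [A] on [Y]: the vector space freely spanned by [X * Y], modulo the
    bilinearity and balancing relations. *)
Section Tensor.
Variables (X Y : lmodType rat) (A : Type) (xa : X -> A -> X) (ay : A -> Y -> Y).

Local Notation F := {freeg (X * Y)%type / rat}.
Definition fgen (x : X) (y : Y) : F := << (x, y) >>.

Inductive tensor_rel : F -> Prop :=
| trel_0 : tensor_rel 0
| trel_lin c u v : tensor_rel u -> tensor_rel v -> tensor_rel (c *: u + v)
| trel_l c x x' y :
    tensor_rel (fgen (c *: x + x') y - (c *: fgen x y + fgen x' y))
| trel_r c x y y' :
    tensor_rel (fgen x (c *: y + y') - (c *: fgen x y + fgen x y'))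
| trel_bal x a y : tensor_rel (fgen (xa x a) y - fgen x (ay a y)).

Lemma tensor_rel_subspace : subspace tensor_rel.
Proof. by split; [exact: trel_0 | exact: trel_lin]. Qed.

Definition tensor : Type := quotsp tensor_rel_subspace.
HB.instance Definition _ := GRing.Lmodule.on tensor.

Definition tens (x : X) (y : Y) : tensor := qpi tensor_rel_subspace (fgen x y).

Lemma tensP c x x' y : tens (c *: x + x') y = c *: tens x y + tens x' y.
Proof. by rewrite /tens -linearP; apply/qpiP; apply: trel_l. Qed.
Lemma tensPr c x y y' : tens x (c *: y + y') = c *: tens x y + tens x y'.
Proof. by rewrite /tens -linearP; apply/qpiP; apply: trel_r. Qed.
Lemma tens_bal x a y : tens (xa x a) y = tens x (ay a y).
Proof. by apply/qpiP; apply: trel_bal. Qed.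

Lemma tensor_ind (P : tensor -> Prop) : P 0 ->
  (forall c x y t, P t -> P (c *: tens x y + t)) -> forall t, P t.
Proof.
move=> P0 PS t; rewrite -(qreprK t) -[qrepr t]freeg_sumE.
elim: (dom _) => [|[x y] s IH]; first by rewrite big_nil linear0.
rewrite big_cons; set c := coeff _ _.
have -> : << c *g (x, y) >> = c *: fgen x y :> F.
  apply/eqP/freeg_eqP => z.
  by rewrite coeff_fgscale /fgen !coeffU mul1r.
by rewrite linearP; apply: PS.
Qed.

Lemma tensor_eq (Z : lmodType rat) (phi psi : tensor -> Z) :
  linear phi -> linear psi -> (forall x y, phi (tens x y) = psi (tens x y)) ->
  phi =1 psi.
Proof.
have L0 (k : tensor -> Z) : linear k -> k 0 = 0.
  by move=> /(_ (-1) 0 0); rewrite scaler0 addr0 scaleN1r addNr.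
move=> h1 h2 h; elim/tensor_ind => [|c x y t IH]; first by rewrite !L0.
by rewrite h1 h2 h IH.
Qed.

(** The linear map out of [X ⊗_A Y] given by [x ⊗ y |-> b x y]; it does what it
    says when [b] is bilinear and balanced. *)
Definition tlift (Z : lmodType rat) (b : X -> Y -> Z) (t : tensor) : Z :=
  fglift (fun p => b p.1 p.2) (qrepr t).

Definition balanced (Z : lmodType rat) (b : X -> Y -> Z) : Prop :=
  [/\ forall y, linear (b^~ y), forall x, linear (b x) &
      forall x a y, b (xa x a) y = b x (ay a y)].

Section Lift.
Variables (Z : lmodType rat) (b : X -> Y -> Z).
Local Notation phi := (fglift (fun p => b p.1 p.2)).

Fact fglift_linear : linear (phi : F -> Z).
Proof.
have phiB (u v : F) : phi (u - v) = phi u - phi v by exact: lift_is_additive.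
have phi0 : phi 0 = 0 by rewrite -(subrr 0) phiB subrr.
have phiD (u v : F) : phi (u + v) = phi u + phi v.
  by rewrite -[v in LHS]opprK phiB -[- v]sub0r phiB phi0 sub0r opprK.
have phiS (s : seq (X * Y)) (k : X * Y -> rat) :
    phi (\sum_(p <- s) << k p *g p >>) = \sum_(p <- s) k p *: b p.1 p.2.
  by elim: s => [|p s IH]; rewrite ?(big_nil, big_cons) // phiD IH liftU.
move=> c u v; rewrite phiD; congr (_ + _).
have -> : phi u = \sum_(p <- dom u) coeff p u *: b p.1 p.2.
  by rewrite -[u in LHS]freeg_sumE phiS.
rewrite scaler_sumr [c *: u](_ : _ = \sum_(x <- dom u) << c * coeff x u *g x >>) // phiS.
by apply: eq_bigr => p _; rewrite scalerA.
Qed.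

Hypothesis b_bal : balanced b.

Lemma fglift_rel u : tensor_rel u -> phi u = 0.
Proof.
have [bl br bb] := b_bal.
have phiP c v w : phi (c *: v + w : F) = c *: phi v + phi w.
  exact: fglift_linear.
have phiB (v w : F) : phi (v - w) = phi v - phi w by exact: lift_is_additive.
have phi0 : phi 0 = 0 by rewrite -(subrr 0) phiB subrr.
have phig x y : phi (fgen x y) = b x y by rewrite /fgen liftU scale1r.
elim=> {u} [|c u v _ hu _ hv|c x x' y|c x y y'|x a y] //.
- by rewrite phiP hu hv scaler0 addr0.
- by rewrite phiB phiP !phig bl subrr.
- by rewrite phiB phiP !phig br subrr.
- by rewrite phiB !phig bb subrr.
Qed.

Lemma tlift_qpi u : tlift b (qpi tensor_rel_subspace u) = phi u.
Proof.
apply/eqP; rewrite -subr_eq0 /tlift -lift_is_additive; apply/eqP.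
by apply: fglift_rel; apply: qpi_repr.
Qed.

Lemma tliftE x y : tlift b (tens x y) = b x y.
Proof. by rewrite tlift_qpi /fgen liftU scale1r. Qed.

Fact tlift_linear : linear (tlift b).
Proof.
move=> c t u; rewrite -(qreprK t) -(qreprK u) -linearP !tlift_qpi.
exact: fglift_linear.
Qed.

Definition tensor_lift (_ : balanced b) : tensor -> Z := tlift b.
HB.instance Definition _ := GRing.isLinear.Build rat tensor Z _
  (tensor_lift b_bal) tlift_linear.
End Lift.

(** The span of the [x ⊗ y] with [x], [y] homogeneous of total degree [i]. *)
Inductive tens_deg (dX : int -> X -> Prop) (dY : int -> Y -> Prop) (i : int) :
    tensor -> Prop :=
| tens_deg_0 : tens_deg dX dY i 0
| tens_deg_S c a b x y t : a + b = i -> dX a x -> dY b y ->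
    tens_deg dX dY i t -> tens_deg dX dY i (c *: tens x y + t).

Lemma tens_deg_subspace dX dY i : subspace (tens_deg dX dY i).
Proof.
have tD t u : tens_deg dX dY i t -> tens_deg dX dY i u ->
    tens_deg dX dY i (t + u).
  move=> ht hu; elim: ht => {t} [|c a b x y t ab ha hb _ IH].
    by rewrite add0r.
  by rewrite -addrA; apply: (tens_deg_S c ab ha hb IH).
split; first exact: tens_deg_0.
move=> c t u ht hu; apply: tD => //.
elim: ht => {t hu} [|d a b x y t ab ha hb _ IH].
  by rewrite scaler0; apply: tens_deg_0.
by rewrite scalerDr scalerA; apply: (tens_deg_S _ ab ha hb IH).
Qed.

Lemma tens_degP dX dY i (P : tensor -> Prop) : subspace P ->
  (forall a b x y, a + b = i -> dX a x -> dY b y -> P (tens x y)) ->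
  forall t, tens_deg dX dY i t -> P t.
Proof.
move=> [P0 PS] h t; elim=> {t} [//|c a b x y t ab ha hb _ IH].
by apply: PS IH; apply: h ab ha hb.
Qed.

Lemma tens_deg_tens dX dY a b x y :
  dX a x -> dY b y -> tens_deg dX dY (a + b) (tens x y).
Proof.
move=> ha hb; rewrite -[tens x y]scale1r -[_ *: _]addr0.
exact: (tens_deg_S _ (erefl _) ha hb (tens_deg_0 _ _ _)).
Qed.
End Tensor.

Lemma linear_fglift (T : choiceType) (Z Z' : lmodType rat)
    (phi : {linear Z -> Z'}) (h : T -> Z) (u : {freeg T / rat}) :
  phi (fglift h u) = fglift (phi \o h) u.
Proof.
have liftE (M : lmodType rat) (k : T -> M) :
    fglift k u = \sum_(x <- dom u) coeff x u *: k x.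
  have phiB (v w : {freeg T / rat}) :
    fglift k (v - w) = fglift k v - fglift k w by exact: lift_is_additive.
  have phi0 : fglift k 0 = 0 by rewrite -(subrr 0) phiB subrr.
  have phiD (v w : {freeg T / rat}) :
      fglift k (v + w) = fglift k v + fglift k w.
    by rewrite -[w in LHS]opprK phiB -[- w]sub0r phiB phi0 sub0r opprK.
  rewrite -[u in LHS]freeg_sumE.
  elim: (dom u) => [|p s IH]; rewrite ?(big_nil, big_cons) //.
  by rewrite phiD IH liftU.
by rewrite !liftE linear_sum; apply: eq_bigr => x _; rewrite linearZ.
Qed.

Lemma linear_tlift (X Y : lmodType rat) A (xa : X -> A -> X) (ay : A -> Y -> Y)
    (Z Z' : lmodType rat) (phi : {linear Z -> Z'}) (b : X -> Y -> Z)
    (t : tensor xa ay) :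
  phi (tlift b t) = tlift (fun x y => phi (b x y)) t.
Proof. by rewrite /tlift linear_fglift. Qed.

Section GradedBimodules.
Variable n : nat.
Local Notation R := {mpoly rat[n]}.


(** [f] is homogeneous of degree [i], with [deg x_k = 2]. *)
Definition poly_deg (i : int) (f : R) : Prop :=
  forall m, m \in msupp f -> (2 * mdeg m)%:Z = i.

(** [gdeg i] is the homogeneous component of degree [i]. *)
Record is_gbimod (M : lmodType rat) (lact : R -> M -> M) (ract : M -> R -> M)
    (gdeg : int -> M -> Prop) : Prop := IsGbimod {
  lact_linear_l : forall m, linear (lact^~ m);
  lact_linear_r : forall f, linear (lact f);
  lact1 : forall m, lact 1 m = m;
  lactM : forall f g m, lact (f * g) m = lact f (lact g m);
  ract_linear_l : forall g, linear (ract^~ g);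
  ract_linear_r : forall m, linear (ract m);
  ract1 : forall m, ract m 1 = m;
  ractM : forall m f g, ract m (f * g) = ract (ract m f) g;
  lractA : forall f m g, ract (lact f m) g = lact f (ract m g);
  gdeg_subspace : forall i, subspace (gdeg i);
  gdeg_gen : forall m, exists (s : seq int) (c : int -> M),
    (forall i, gdeg i (c i)) /\ m = \sum_(i <- s) c i;
  gdeg_indep : forall (s : seq int) (c : int -> M), uniq s ->
    (forall i, gdeg i (c i)) -> \sum_(i <- s) c i = 0 ->
    forall i, i \in s -> c i = 0;
  lact_deg : forall a i f m,
    poly_deg a f -> gdeg i m -> gdeg (a + i) (lact f m);
  ract_deg : forall a i f m,
    poly_deg a f -> gdeg i m -> gdeg (i + a) (ract m f)
}.

Record gbimod := Gbimod {
  gcar :> lmodType rat;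
  lact : R -> gcar -> gcar;
  ract : gcar -> R -> gcar;
  gdeg : int -> gcar -> Prop;
  gbimodP : is_gbimod lact ract gdeg
}.

(** [M(k)_i = M_(i-k)] *)
Lemma gshift_subproof (M : gbimod) (k : int) :
  is_gbimod (@lact M) (@ract M) (fun i => @gdeg M (i - k)).
Proof.
case: (gbimodP M) => h1 h2 h3 h4 h5 h6 h7 h8 h9 hs hg hi hl hr.
split=> //.
- move=> m; have [s [c [hc ->]]] := hg m.
  exists [seq j + k | j <- s], (fun i => c (i - k)); split=> //.
  by rewrite big_map; apply: eq_bigr => j _; rewrite addrK.
- move=> s c us hc s0 i si; rewrite -[i](subrK k).
  apply: (hi [seq j - k | j <- s] (fun j => c (j + k))).
  + by rewrite map_inj_uniq //; apply: addIr.
  + by move=> j; have := hc (j + k); rewrite addrK.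
  + by rewrite big_map -[RHS]s0; apply: eq_bigr => j _; rewrite subrK.
  + by apply/mapP; exists i.
- by move=> a i f m ha hm; rewrite -addrA; apply: hl.
- by move=> a i f m ha hm; rewrite addrAC; apply: hr.
Qed.
Definition gshift M k := Gbimod (gshift_subproof M k).

(** Degree-0 bimodule homomorphisms, with their Q-vector space structure. *)
Section Hom.
Variables M N : gbimod.

Definition is_ghom (f : dprod (fun _ : M => gcar N)) : Prop :=
  [/\ forall c u v, f (c *: u + v) = c *: f u + f v,
      forall a m, f (lact a m) = lact a (f m),
      forall m a, f (ract m a) = ract (f m) a &
      forall i m, gdeg i m -> gdeg i (f m)].

Lemma is_ghom_subspace : subspace is_ghom.
Proof.
case: (gbimodP N) => _ h2 _ _ h5 _ _ _ _ hs _ _ _ _.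
split.
  split=> [c u v|a m|m a|i m _]; rewrite /GRing.zero /= /dprod_zero.
  - by rewrite scaler0 addr0.
  - by rewrite -[0 in RHS](subrr 0) -scaleN1r addrC h2 scaleN1r addNr.
  - by rewrite -[0 in RHS](subrr 0) -scaleN1r addrC h5 scaleN1r addNr.
  - exact: (hs i).1.
move=> c f g [f1 f2 f3 f4] [g1 g2 g3 g4].
have E m : (c *: f + g) m = c *: f m + g m by [].
split=> [d u v|a m|m a|i m hm]; rewrite !E.
- rewrite f1 g1 !scalerDr !scalerA [d * c]mulrC -!addrA; congr (_ + _).
  by rewrite addrCA.
- by rewrite f2 g2 h2.
- by rewrite f3 g3 h5.
- by apply: (hs i).2; [apply: f4 | apply: g4].
Qed.

Definition ghom : Type := subsp is_ghom_subspace.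
HB.instance Definition _ := GRing.Lmodule.on ghom.

Definition ghom_fun (f : ghom) : M -> N := val f.

Lemma ghomP f : is_ghom (ghom_fun f).
Proof. exact/(subspace_predP is_ghom_subspace)/(valP f). Qed.

Fact ghom_fun_linear f : linear (ghom_fun f).
Proof. by case: (ghomP f). Qed.
HB.instance Definition _ f :=
  GRing.isLinear.Build rat M N _ (ghom_fun f) (ghom_fun_linear f).

Definition mkghom (f : M -> N) (hf : is_ghom f) : ghom :=
  exist _ (f : dprod _) (introT (subspace_predP is_ghom_subspace f) hf).

Lemma ghom_eq (f g : ghom) : ghom_fun f =1 ghom_fun g -> f = g.
Proof.
by move=> h; apply: val_inj; apply: functional_extensionality_dep.
Qed.
End Hom.
Coercion ghom_fun : ghom >-> Funclass.

Lemma gcomp_subproof (L M N : gbimod) (g : ghom M N) (f : ghom L M) :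
  is_ghom (fun x => g (f x) : gcar N).
Proof.
case: (ghomP g) => g1 g2 g3 g4; case: (ghomP f) => f1 f2 f3 f4.
split=> [c u v|a m|m a|i m hm]; rewrite ?f1 ?g1 ?f2 ?g2 ?f3 ?g3 //.
exact/g4/f4.
Qed.
Definition gcomp L M N (g : ghom M N) (f : ghom L M) : ghom L N :=
  mkghom (gcomp_subproof g f).

Section PrePost.
Variables (L M N : gbimod).

Definition post (g : ghom M N) (f : ghom L M) : ghom L N := gcomp g f.
Fact post_linear g : linear (post g).
Proof.
move=> c u v; apply: ghom_eq => x.
exact: (ghom_fun_linear g c (ghom_fun u x) (ghom_fun v x)).
Qed.
HB.instance Definition _ g :=
  GRing.isLinear.Build rat (ghom L M) (ghom L N) _ (post g) (post_linear g).

Definition pre (f : ghom L M) (g : ghom M N) : ghom L N := gcomp g f.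
Fact pre_linear f : linear (pre f).
Proof. by move=> c u v; apply: ghom_eq => x. Qed.
HB.instance Definition _ f :=
  GRing.isLinear.Build rat (ghom M N) (ghom L N) _ (pre f) (pre_linear f).
End PrePost.

(** Graded (R, R)-bimodules are graded R^e-modules, so projectivity and Ext in
    graded R^e-modules are expressed in the category of graded bimodules. *)
Definition gprojective (P : gbimod) : Prop :=
  forall (M N : gbimod) (g : ghom M N) (f : ghom P N),
    (forall y : N, exists x : M, g x = y) ->
    exists h : ghom P M, forall p : P, g (h p) = f p.

Record gresolution (X : gbimod) := GResolution {
  robj : nat -> gbimod;
  rdiff : forall j, ghom (robj j.+1) (robj j);
  raug : ghom (robj 0) X;
  robj_proj : forall j, gprojective (robj j);
  raug_surj : forall x : X, exists p : robj 0, raug p = x;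
  rexact0 : forall p : robj 0,
    raug p = 0 <-> exists q : robj 1, rdiff 0 q = p;
  rexact : forall j (p : robj j.+1),
    rdiff j p = 0 <-> exists q : robj j.+2, rdiff j.+1 q = p
}.

Section Ext.
Variables (X : gbimod) (P : gresolution X).

Definition ext_prev (N : gbimod) (j : nat) : lmodType rat :=
  if j is j'.+1 then ghom (robj P j') N else zerosp.

Definition ext_in (N : gbimod) (j : nat) :
    {linear ext_prev N j -> ghom (robj P j) N} :=
  match j return {linear ext_prev N j -> ghom (robj P j) N} with
  | 0 => \0
  | j'.+1 => pre (rdiff P j')
  end.

Definition ext_out (N : gbimod) (j : nat) :
    {linear ghom (robj P j) N -> ghom (robj P j.+1) N} := pre (rdiff P j).

(** [Ext^j(X, N) = H^j(Hom(P, N))] *)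
Definition Ext (j : nat) (N : gbimod) : lmodType rat :=
  homology (ext_in N j) (ext_out N j).

Variables (N N' : gbimod) (f : ghom N N').

Lemma ext_map_cycle j v : ext_out N j v = 0 -> ext_out N' j (post f v) = 0.
Proof.
move=> h; have -> : ext_out N' j (post f v) = post f (ext_out N j v).
  exact: ghom_eq.
by rewrite h linear0.
Qed.

Lemma ext_map_boundary j u :
  exists u', ext_in N' j u' = post f (ext_in N j u).
Proof.
case: j u => [|j] u; first by exists 0; rewrite !linear0.
by exists (post f u); apply: ghom_eq.
Qed.

Definition Ext_map (j : nat) : {linear Ext j N -> Ext j N'} :=
  hmap (post f) (@ext_map_cycle j) (@ext_map_boundary j).
End Ext.

(** Differentials are given for all pairs of degrees and vanish unless the
    second is the successor of the first, so that no transport along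
    [k - 1 + 1 = k] is needed. *)
Record gcomplex := GComplex {
  cobj : int -> gbimod;
  cdiff : forall k l : int, ghom (cobj k) (cobj l);
  cdiff_shape : forall k l, l != k + 1 -> cdiff k l = 0;
  cdiff2 : forall k l m (x : cobj k), cdiff l m (cdiff k l x) = 0
}.

Record gcmap (C D : gcomplex) := GCMap {
  cmor : forall k, ghom (cobj C k) (cobj D k);
  cmorP : forall k l (x : cobj C k),
    cmor l (cdiff C k l x) = cdiff D k l (cmor k x)
}.

Lemma poly_degE (d : nat) (f : R) :
  poly_deg (2 * d)%:Z f <-> f \is d.-homog.
Proof.
split=> [h|/dhomogP h m /h <-] //; apply/dhomogP => m /h [] /eqP.
by rewrite eqn_pmul2l // => /eqP.
Qed.

Lemma poly_degP (i : int) (f : R) : poly_deg i f ->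
  f = 0 \/ exists d, i = (2 * d)%:Z /\ f \is d.-homog.
Proof.
case E: (msupp f) => [|m s] h.
  by left; apply/eqP; rewrite -msupp_eq0 E.
have im : i = (2 * mdeg m)%:Z by rewrite (h m) // E mem_head.
by right; exists (mdeg m); split; rewrite // -poly_degE -im.
Qed.

Lemma poly_deg_subspace i : subspace (poly_deg i).
Proof.
split=> [m|c f g hf hg m]; first by rewrite msupp0.
move/msuppD_le; rewrite mem_cat => /orP[/msuppZ_le|]; [exact: hf | exact: hg].
Qed.

Lemma poly_degM a b (f g : R) :
  poly_deg a f -> poly_deg b g -> poly_deg (a + b) (f * g).
Proof.
move=> hf hg m /msuppM_le /allpairsP[[m1 m2] /= [/hf <- /hg <- ->]].
by rewrite mdegD mulnDr.
Qed.

(** Independence follows from the existence of projections. *)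
Lemma indep_of_proj (M : lmodType rat) (dM : int -> M -> Prop) :
  (forall i, exists p : M -> M, [/\ linear p, forall x, dM i x -> p x = x &
     forall j x, j != i -> dM j x -> p x = 0]) ->
  forall (s : seq int) (c : int -> M), uniq s -> (forall i, dM i (c i)) ->
    \sum_(i <- s) c i = 0 -> forall i, i \in s -> c i = 0.
Proof.
move=> hp s c us hc s0 i si; have [p [plin pid p0]] := hp i.
pose pl : {linear M -> M} := HB.pack p (GRing.isLinear.Build rat M M _ p plin).
have : pl (\sum_(j <- s) c j) = 0 by rewrite s0 linear0.
rewrite linear_sum (bigD1_seq i) //= pid // big1 ?addr0 //.
by move=> j ji; apply: p0 ji _.
Qed.

Lemma poly_proj (i : int) : exists p : R -> R,
  [/\ linear p, forall x, poly_deg i x -> p x = x &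
      forall j x, j != i -> poly_deg j x -> p x = 0].
Proof.
have [[d ->]|hi] := EM (exists d : nat, i = (2 * d)%:Z); last first.
  exists (fun=> 0); split=> //.
  - by move=> c f g; rewrite scaler0 addr0.
  - by move=> f /poly_degP [->|[d [E _]]] //; case: hi; exists d.
exists (pihomog mdeg d); split=> [c f g|f /poly_degE|j f ji /poly_degP].
- exact: linearP.
- exact: pihomog_dE.
- case=> [->|[e [E hf]]]; first exact: linear0.
  by apply: pihomog_ne0 hf; apply: contra ji => /eqP <-; rewrite E.
Qed.

Lemma poly_decomp (f : R) :
  f = \sum_(d <- iota 0 (msize f)) pihomog mdeg d f.
Proof.
rewrite {1}(pihomog_partitionE (mf := mdeg) (leqnn (msize f))).
by rewrite -(big_mkord xpredT (fun d => pihomog mdeg d f)) /index_iota subn0.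
Qed.

Lemma polybim_subproof :
  @is_gbimod R (fun f m => f * m) (fun m f => m * f) poly_deg.
Proof.
split=> //.
- by move=> m c f g; rewrite mulrDl scalerAl.
- by move=> f c m m'; rewrite mulrDr scalerAr.
- by move=> m; rewrite mul1r.
- by move=> f g m; rewrite mulrA.
- by move=> f c m m'; rewrite mulrDl scalerAl.
- by move=> m c f g; rewrite mulrDr scalerAr.
- by move=> m; rewrite mulr1.
- by move=> m f g; rewrite mulrA.
- by move=> f m g; rewrite mulrA.
- exact: poly_deg_subspace.
- move=> f; exists [seq (2 * d)%:Z | d <- iota 0 (msize f)].
  exists (fun i => if (0 <= i) && ~~ odd `|i|%N
                   then pihomog mdeg `|i|./2 f else 0); split.
    move=> i; case: ifP => [/andP[i0 io]|_]; last exact: (poly_deg_subspace i).1.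
    have {1}-> : i = (2 * `|i|./2)%:Z.
      by rewrite mul2n even_halfK // gez0_abs.
    by apply/poly_degE; apply: pihomogP.
  rewrite big_map [LHS]poly_decomp; apply: eq_bigr => d _.
  by rewrite /= mul2n odd_double doubleK.
- exact: indep_of_proj poly_proj.
- by move=> a i f m; apply: poly_degM.
- by move=> a i f m ha hm; apply: poly_degM.
Qed.

Definition polybim : gbimod := Gbimod polybim_subproof.

(** R^W, the symmetric polynomials *)
Definition sympoly : Type := {f : R | f \is symmetric}.

Definition symr (f : R) (s : sympoly) : R := f * val s.
Definition syml (s : sympoly) (f : R) : R := val s * f.

(** R ⊗_{R^W} R *)
Local Notation Btensor := (tensor symr syml).
Local Notation btens := (tens symr syml).

Definition Blact (f : R) : Btensor -> Btensor :=
  tlift (fun g h => btens (f * g) h).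
Definition Bract (t : Btensor) (f : R) : Btensor :=
  tlift (fun g h => btens g (h * f)) t.
Definition Bdeg : int -> Btensor -> Prop := tens_deg poly_deg poly_deg.

Let btP c f f' g : btens (c *: f + f') g = c *: btens f g + btens f' g.
Proof. exact: tensP. Qed.
Let btPr c f g g' : btens f (c *: g + g') = c *: btens f g + btens f g'.
Proof. exact: tensPr. Qed.
Let bt0 g : btens 0 g = 0.
Proof. by have := btP (-1) 0 0 g; rewrite scaler0 addr0 !scaleN1r addNr. Qed.
Let bt0r f : btens f 0 = 0.
Proof. by have := btPr (-1) f 0 0; rewrite scaler0 addr0 !scaleN1r addNr. Qed.

Lemma linear_big (M N : lmodType rat) (p : M -> N) : linear p ->
  forall I (s : seq I) (F : I -> M),
  p (\sum_(i <- s) F i) = \sum_(i <- s) p (F i).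
Proof.
move=> pL I s F.
have p0 : p 0 = 0.
  by have := pL (-1) 0 0; rewrite scaler0 addr0 scaleN1r addNr.
elim: s => [|i s IH]; first by rewrite !big_nil.
by rewrite !big_cons -IH -[F i in LHS]scale1r pL scale1r.
Qed.
Let bt_suml I (s : seq I) (F : I -> R) g :
  btens (\sum_(i <- s) F i) g = \sum_(i <- s) btens (F i) g.
Proof. by apply: (linear_big (p := btens ^~ g)) => c u v; apply: btP. Qed.
Let bt_sumr I (s : seq I) (F : I -> R) f :
  btens f (\sum_(i <- s) F i) = \sum_(i <- s) btens f (F i).
Proof. by apply: (linear_big (p := btens f)) => c u v; apply: btPr. Qed.

Lemma Blact_bal f : balanced symr syml
  (fun g h => btens (f * g) h).
Proof.
split=> [h c g g'|g c h h'|g a h]; first by rewrite mulrDr -scalerAr btP.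
  exact: btPr.
by rewrite [f * _]mulrA; apply: tens_bal.
Qed.
Lemma Bract_bal f : balanced symr syml
  (fun g h => btens g (h * f)).
Proof.
split=> [h c g g'|g c h h'|g a h]; first exact: btP.
  by rewrite mulrDl -scalerAl btPr.
by rewrite tens_bal /syml mulrA.
Qed.
Lemma BlactE f g h : Blact f (btens g h) = btens (f * g) h.
Proof. exact: tliftE (Blact_bal f) g h. Qed.
Lemma BractE f g h : Bract (btens g h) f = btens g (h * f).
Proof. exact: tliftE (Bract_bal f) g h. Qed.
Lemma Blact_linear f : linear (Blact f).
Proof. exact: tlift_linear (Blact_bal f). Qed.
Lemma Bract_linear f : linear (Bract^~ f).
Proof. exact: tlift_linear (Bract_bal f). Qed.

(** The projection of [f ⊗ g] to degree [2 d]. *)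
Definition bproj (d : nat) (f g : R) : Btensor :=
  \sum_(e < d.+1) btens (pihomog mdeg e f) (pihomog mdeg (d - e) g).

Lemma bproj_linear_l d g : linear (bproj d ^~ g).
Proof.
move=> c f f'; rewrite /bproj scaler_sumr -big_split; apply: eq_bigr => e _.
by rewrite linearP btP.
Qed.
Lemma bproj_linear_r d f : linear (bproj d f).
Proof.
move=> c g g'; rewrite /bproj scaler_sumr -big_split; apply: eq_bigr => e _.
by rewrite linearP btPr.
Qed.

Lemma bproj_homog d k l f g : f \is k.-homog -> g \is l.-homog ->
  bproj d f g = if (k + l == d)%N then btens f g else 0.
Proof.
move=> hf hg; rewrite /bproj.
have [hkd|hkd] := leqP k d; last first.
  rewrite gtn_eqF; last exact: leq_trans hkd (leq_addr _ _).
  rewrite big1 // => e _; rewrite (pihomog_ne0 _ hf) ?bt0 //.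
  by rewrite gtn_eqF // (leq_trans _ hkd).
have hkd' : (k < d.+1)%N by [].
rewrite (bigD1 (Ordinal hkd')) //= big1 ?addr0; last first.
  move=> e ne; rewrite (pihomog_ne0 _ hf) ?bt0 //.
  by apply: contra ne => /eqP E; apply/eqP/val_inj; rewrite /= -E.
rewrite (pihomog_dE hf) -{2}(subnKC hkd) eqn_add2l.
case: eqP => [<-|/eqP h]; first by rewrite (pihomog_dE hg).
by rewrite (pihomog_ne0 h hg) bt0r.
Qed.

Lemma bproj_bal d : balanced symr syml
  (bproj d).
Proof.
split; [exact: bproj_linear_l | exact: bproj_linear_r |].
have Ls I (s : seq I) (F : I -> R) g :
    bproj d (\sum_(i <- s) F i) g = \sum_(i <- s) bproj d (F i) g.
  exact: (linear_big (p := bproj d ^~ g) (@bproj_linear_l d g)).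
have Qs I (s : seq I) (F : I -> R) f :
    bproj d f (\sum_(i <- s) F i) = \sum_(i <- s) bproj d f (F i).
  exact: (linear_big (p := bproj d f) (@bproj_linear_r d f)).
move=> f [a a_sym] g; rewrite /symr /syml /=.
rewrite (poly_decomp f) mulr_suml !Ls; apply: eq_bigr => i _.
rewrite (poly_decomp g) mulr_sumr !Qs; apply: eq_bigr => j _.
have := pihomogP mdeg i f; have := pihomogP mdeg j g.
move: (pihomog mdeg i f) (pihomog mdeg j g) => {}f {}g hj hi.
rewrite (poly_decomp a) mulr_suml mulr_sumr Ls Qs; apply: eq_bigr => k _.
have hk := pihomogP mdeg k a.
rewrite (bproj_homog d (dhomogM hi hk) hj) (bproj_homog d hi (dhomogM hk hj)).
rewrite addnA; case: eqP => // _.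
have ak_sym : pihomog mdeg k a \is symmetric by apply: pihomog_sym.
pose ak : sympoly := exist (fun f : R => f \is symmetric) _ ak_sym.
exact: (tens_bal symr syml f ak g).
Qed.

Lemma B_proj (i : int) : exists p : Btensor -> Btensor,
  [/\ linear p, forall x, Bdeg i x -> p x = x &
      forall j x, j != i -> Bdeg j x -> p x = 0].
Proof.
have [[d ->]|hi] := EM (exists d : nat, i = (2 * d)%:Z); last first.
  exists (fun=> 0); split=> //.
  - by move=> c f g; rewrite scaler0 addr0.
  - apply: tens_degP; first by split=> // c u v <- <-; rewrite scaler0 addr0.
    move=> a b f g ab /poly_degP [->|[x [xa _]]]; first by rewrite bt0.
    move=> /poly_degP [->|[y [yb _]]]; first by rewrite bt0r.
    by case: hi; exists (x + y)%N; rewrite -ab xa yb mulnDr.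
pose p := tensor_lift (bproj_bal d).
have pE f g : p (btens f g) = bproj d f g by exact: tliftE (bproj_bal d) f g.
have pL : linear p by exact: tlift_linear (bproj_bal d).
have p0 : p 0 = 0 by exact: linear0.
exists p; split=> //.
- apply: tens_degP; first by split=> [|c u v hu hv]; [exact: linear0 | rewrite pL hu hv].
  move=> a b f g ab /poly_degP [->|[x [xa hf]]]; first by rewrite bt0 /= p0.
  move=> /poly_degP [->|[y [yb hg]]]; first by rewrite bt0r /= p0.
  rewrite /= pE (bproj_homog d hf hg); case: eqP => // ne; case: ne.
  move: ab; rewrite xa yb => -[] /eqP.
  by rewrite -mulnDr eqn_pmul2l // => /eqP.
- move=> j t ji; move: t; apply: tens_degP.
    by split=> [|c u v hu hv]; [exact: linear0 | rewrite pL hu hv scaler0 addr0].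
  move=> a b f g ab /poly_degP [->|[x [xa hf]]]; first by rewrite bt0 /= p0.
  move=> /poly_degP [->|[y [yb hg]]]; first by rewrite bt0r /= p0.
  rewrite /= pE (bproj_homog d hf hg); case: eqP => // E.
  by case/eqP: ji; rewrite -ab xa yb -E mulnDr.
Qed.

Lemma Bdeg_gen (t : Btensor) : exists (s : seq int) (c : int -> Btensor),
  (forall i, Bdeg i (c i)) /\ t = \sum_(i <- s) c i.
Proof.
pose p d := tensor_lift (bproj_bal d).
have pE d f g : p d (btens f g) = bproj d f g by exact: tliftE (bproj_bal d) f g.
have pL d : linear (p d) by exact: tlift_linear (bproj_bal d).
have p0 d : p d 0 = 0 by exact: linear0.
have pdeg d u : Bdeg (2 * d)%:Z (p d u).
  elim/tensor_ind: u => [|c f g u IH].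
    by rewrite p0; apply: (tens_deg_subspace symr syml poly_deg poly_deg _).1.
  rewrite pL; apply: (tens_deg_subspace symr syml poly_deg poly_deg _).2 => //.
  rewrite pE /bproj; elim/big_ind: _ => [|x y hx hy|e _].
  - exact: (tens_deg_subspace symr syml poly_deg poly_deg _).1.
  - by rewrite -[x]scale1r; apply: (tens_deg_subspace symr syml poly_deg poly_deg _).2.
  - have -> : (2 * d)%:Z = (2 * e)%:Z + (2 * (d - e))%:Z :> int.
      by rewrite -PoszD -mulnDr subnKC // -ltnS.
    by apply: tens_deg_tens; apply/poly_degE; apply: pihomogP.
pose key u := exists N, forall M, (N <= M)%N -> u = \sum_(d < M) p d u.
have key0 : key 0.
  by exists 0%N => M _; rewrite big1 // => d _; rewrite p0.
have keyP c u v : key u -> key v -> key (c *: u + v).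
  move=> [N hN] [N' hN']; exists (maxn N N') => M.
  rewrite geq_max => /andP[NM NM'].
  rewrite {1}(hN M) // {1}(hN' M) // scaler_sumr -big_split.
  by apply: eq_bigr => d _; rewrite pL.
have keyD u v : key u -> key v -> key (u + v).
  by move=> hu hv; rewrite -[u]scale1r; apply: keyP.
have : key t.
  elim/tensor_ind: t => [//|c f g u hu]; apply: keyP => //.
  rewrite (poly_decomp f) bt_suml; elim/big_ind: _ => // i _.
  rewrite (poly_decomp g) bt_sumr; elim/big_ind: _ => // j _.
  exists (i + j).+1 => M hM.
  under eq_bigr do rewrite pE
    (bproj_homog _ (pihomogP mdeg i f) (pihomogP mdeg j g)).
  rewrite -big_mkcond (big_pred1 (Ordinal hM)) //.
move=> [N /(_ N (leqnn _)) tE].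
exists [seq (2 * d)%:Z | d <- iota 0 N].
exists (fun i => if (0 <= i) && ~~ odd `|i|%N then p `|i|./2 t else 0); split.
  move=> i; case: ifP => [/andP[i0 io]|_].
    have {1}-> : i = (2 * `|i|./2)%:Z by rewrite mul2n even_halfK // gez0_abs.
    exact: pdeg.
  exact: (tens_deg_subspace symr syml poly_deg poly_deg _).1.
rewrite big_map [LHS]tE -(big_mkord xpredT (fun d => p d t)) /index_iota subn0.
by apply: eq_bigr => d _; rewrite /= mul2n odd_double doubleK.
Qed.

Lemma linear_comb (M N : lmodType rat) (c : rat) (p q : M -> N) :
  linear p -> linear q -> linear (fun t => c *: p t + q t).
Proof.
move=> hp hq d u v; rewrite hp hq !scalerDr !scalerA [c * d]mulrC -!addrA.
by congr (_ + _); rewrite addrCA.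
Qed.
Lemma linear_comp (L M N : lmodType rat) (p : M -> N) (q : L -> M) :
  linear p -> linear q -> linear (fun t => p (q t)).
Proof. by move=> hp hq d u v; rewrite hq hp. Qed.
Lemma linear_id (M : lmodType rat) : linear (fun t : M => t).
Proof. by []. Qed.

Lemma B_subproof : is_gbimod Blact Bract Bdeg.
Proof.
have hl := Blact_linear; have hr := Bract_linear.
split.
- move=> t c f f'; move: t; apply: tensor_eq => [||g h]; first exact: hl.
    exact: linear_comb.
  by rewrite !BlactE mulrDl -scalerAl btP.
- exact: hl.
- apply: tensor_eq => [||g h]; [exact: hl | exact: linear_id |].
  by rewrite BlactE mul1r.
- move=> f f'; apply: tensor_eq => [||g h]; first exact: hl.
    exact: (@linear_comp _ _ _ (Blact f) (Blact f')).
  by rewrite !BlactE mulrA.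
- exact: hr.
- move=> t c f f'; move: t; apply: tensor_eq => [||g h]; first exact: hr.
    exact: (@linear_comb _ _ c (Bract^~ f) (Bract^~ f')).
  by rewrite !BractE mulrDr -scalerAr btPr.
- apply: tensor_eq => [||g h]; [exact: hr | exact: linear_id |].
  by rewrite BractE mulr1.
- move=> t f f'; move: t; apply: tensor_eq => [||g h]; first exact: hr.
    exact: (@linear_comp _ _ _ (Bract^~ f') (Bract^~ f)).
  by rewrite !BractE mulrA.
- move=> f t f'; move: t; apply: tensor_eq => [||g h].
  + exact: (@linear_comp _ _ _ (Bract^~ f') (Blact f)).
  + exact: (@linear_comp _ _ _ (Blact f) (Bract^~ f')).
  + by rewrite BlactE !BractE BlactE.
- exact: tens_deg_subspace.
- exact: Bdeg_gen.
- exact: indep_of_proj B_proj.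
- move=> a i f t hf; move: t; apply: tens_degP.
    split=> [|c u v hu hv]; last first.
      by rewrite hl; apply: (tens_deg_subspace _ _ _ _ _).2.
    suff -> : Blact f 0 = 0 by apply: (tens_deg_subspace _ _ _ _ _).1.
    exact: (linear0 (tensor_lift (Blact_bal f))).
  move=> k l g h <- hg hh; rewrite BlactE addrA.
  by apply: tens_deg_tens => //; apply: poly_degM.
- move=> a i f t hf; move: t; apply: tens_degP.
    split=> [|c u v hu hv]; last first.
      by rewrite hr; apply: (tens_deg_subspace _ _ _ _ _).2.
    suff -> : Bract 0 f = 0 by apply: (tens_deg_subspace _ _ _ _ _).1.
    exact: (linear0 (tensor_lift (Bract_bal f))).
  move=> k l g h <- hg hh; rewrite BractE -addrA.
  by apply: tens_deg_tens => //; apply: poly_degM.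
Qed.

Definition Bbim : gbimod := Gbimod B_subproof.

Definition fin_gen (M : gbimod) : Prop :=
  exists gens : seq M, forall m : M, exists t : seq (R * M * R),
    all (fun u => u.1.2 \in gens) t /\
    m = \sum_(u <- t) lact u.1.1 (ract u.1.2 u.2).

(** [M] is the internal direct sum of the images of the [B(sh i)]. *)
Definition sum_of_B (M : gbimod) : Prop :=
  exists (I : eqType) (sh : I -> int)
    (inc : forall i, ghom (gshift Bbim (sh i)) M),
    (forall m : M, exists (s : seq I) (b : I -> Bbim),
       m = \sum_(i <- s) inc i (b i)) /\
    (forall (s : seq I) (b : I -> Bbim), uniq s ->
       \sum_(i <- s) inc i (b i) = 0 -> forall i, i \in s -> b i = 0).

Definition Bcomplex (C : gcomplex) : Prop :=
  forall k, fin_gen (cobj C k) /\ sum_of_B (cobj C k).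

(** The theory below depends on a choice [P] of graded projective resolutions
    of the bimodules [R(i)], which computes [Ext(R(i), -)]. *)
Section HHH.
Variable P : forall i : int, gresolution (gshift polybim i).

(** [HH(M)] in bidegree [q^i a^j], i.e. [Ext^j(R(i), M)] *)
Definition HH (i : int) (j : nat) (M : gbimod) : lmodType rat := Ext (P i) j M.
Definition HH_map (i : int) (j : nat) (M N : gbimod) (f : ghom M N) :
  {linear HH i j M -> HH i j N} := Ext_map (P i) f j.

Definition HHH_at (C : gcomplex) (i : int) (j : nat) (k : int) : lmodType rat :=
  homology (HH_map i j (cdiff C (k - 1) k)) (HH_map i j (cdiff C k (k + 1))).

Lemma Ext_map_comp X (Q : gresolution X) (L M N : gbimod) (g : ghom M N)
    (f : ghom L M) j x :
  Ext_map Q g j (Ext_map Q f j x) = Ext_map Q (gcomp g f) j x.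
Proof.
have E (M1 M2 : gbimod) (h : ghom M1 M2) z :
    Ext_map Q h j (qpi (boundary_subspace _ _) z) =
    qpi (boundary_subspace _ _) (cmap (@ext_map_cycle _ Q _ _ h j) z).
  exact: hmapE.
rewrite -(qreprK x) !E; congr qpi; apply: val_inj.
exact: ghom_eq.
Qed.

Section ChainMap.
Variables (C D : gcomplex) (f : gcmap C D) (i : int) (j : nat) (k : int).

Lemma HHmap_comm l l' x :
  HH_map i j (cmor f l') (HH_map i j (cdiff C l l') x) =
  HH_map i j (cdiff D l l') (HH_map i j (cmor f l) x).
Proof.
rewrite /HH_map !Ext_map_comp; congr (Ext_map _ _ _ _).
by apply: ghom_eq => y; apply: cmorP.
Qed.

Lemma HHH_map_cycle v : HH_map i j (cdiff C k (k + 1)) v = 0 ->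
  HH_map i j (cdiff D k (k + 1)) (HH_map i j (cmor f k) v) = 0.
Proof. by move=> h; rewrite -HHmap_comm h linear0. Qed.

Lemma HHH_map_boundary u : exists u',
  HH_map i j (cdiff D (k - 1) k) u' =
  HH_map i j (cmor f k) (HH_map i j (cdiff C (k - 1) k) u).
Proof. by exists (HH_map i j (cmor f (k - 1)) u); rewrite HHmap_comm. Qed.

Definition HHH_map : {linear HHH_at C i j k -> HHH_at D i j k} :=
  hmap (HH_map i j (cmor f k)) HHH_map_cycle HHH_map_boundary.
End ChainMap.

End HHH.

(** The action [(f ⊗ g) m = f m g] of B on a bimodule, here for the chosen
    representative of an element of B; it depends only on that element as soon
    as the left and right actions of R^W on [M] agree. *)
Definition bact (M : gbimod) (b : Bbim) (m : M) : M :=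
  tlift (fun f g => lact f (ract m g)) (b : Btensor).

Lemma ghom_bact (M N : gbimod) (f : ghom M N) b m : f (bact b m) = bact b (f m).
Proof.
case: (ghomP f) => _ f2 f3 _.
rewrite [LHS](linear_tlift (ghom_fun f)) /bact; congr tlift.
apply/funext => x; apply/funext => y.
exact: etrans (f2 _ _) (congr1 _ (f3 _ _)).
Qed.

Section TensorB.

(** R is commutative, so its right B-action is also [r (f ⊗ g) = f r g]. *)
Definition ractB (r : polybim) (b : Bbim) : polybim := bact b r.

Definition RB (M : gbimod) : lmodType rat := tensor ractB (@bact M).
Definition rbt (M : gbimod) (r : polybim) (m : M) : RB M := tens ractB (@bact M) r m.

(** The component of degree [i] of [R ⊗_B M] *)
Definition RB_deg (M : gbimod) (i : int) : lmodType rat :=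
  subsp (tens_deg_subspace ractB (@bact M) (@gdeg polybim) (@gdeg M) i).

Section Map.
Variables (M N : gbimod) (f : ghom M N).

Lemma RB_map_bal : balanced ractB (@bact M) (fun r m => rbt r (f m)).
Proof.
split=> [m c r r'|r c m m'|r b m]; first exact: tensP.
  by rewrite linearP; apply: tensPr.
by rewrite ghom_bact; apply: tens_bal.
Qed.
Definition RB_map : {linear RB M -> RB N} := tensor_lift RB_map_bal.

Lemma RB_mapE r m : RB_map (rbt r m) = rbt r (f m).
Proof. exact: tliftE RB_map_bal r m. Qed.

Lemma RB_map_deg i t : tens_deg (@gdeg polybim) (@gdeg M) i t ->
  tens_deg (xa:=ractB) (ay:=@bact N) (@gdeg polybim) (@gdeg N) i (RB_map t).
Proof.
move: t; apply: tens_degP => [|a b r m <- hr hm].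
  have [h0 h1] := tens_deg_subspace ractB (@bact N) (@gdeg polybim) (@gdeg N) i.
  by split=> [|c u v hu hv]; [rewrite linear0 | rewrite linearP; apply: h1].
have -> : RB_map (tens ractB (@bact M) r m) = rbt r (f m) by exact: RB_mapE.
by apply: tens_deg_tens => //; case: (ghomP f) => _ _ _; apply.
Qed.

Definition RB_deg_map_fun (i : int) (t : RB_deg M i) : RB_deg N i :=
  exist _ (RB_map (val t)) (introT (subspace_predP _ _)
    (RB_map_deg (elimT (subspace_predP _ _) (valP t)))).
Fact RB_deg_map_linear i : linear (@RB_deg_map_fun i).
Proof. by move=> c t u; apply: val_inj; rewrite /= !linearP. Qed.
HB.instance Definition _ i := GRing.isLinear.Build rat (RB_deg M i) (RB_deg N i)
  _ (@RB_deg_map_fun i) (@RB_deg_map_linear i).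
Definition RB_deg_map i : {linear RB_deg M i -> RB_deg N i} := @RB_deg_map_fun i.
End Map.

Lemma RB_map_comp (L M N : gbimod) (g : ghom M N) (f : ghom L M) t :
  RB_map g (RB_map f t) = RB_map (gcomp g f) t.
Proof.
move: t; apply: tensor_eq; [|exact: linearP|].
  by move=> c u v; rewrite !linearP.
move=> r m; rewrite -![tens _ _ r m]/(rbt r m) !RB_mapE //.
Qed.

(** [H^k(R ⊗_B C)] in degree [i] *)
Definition HRB (C : gcomplex) (i k : int) : lmodType rat :=
  homology (RB_deg_map (cdiff C (k - 1) k) i) (RB_deg_map (cdiff C k (k + 1)) i).

Section ChainMap.
Variables (C D : gcomplex) (f : gcmap C D) (i k : int).

Lemma RB_comm l l' x :
  RB_deg_map (cmor f l') i (RB_deg_map (cdiff C l l') i x) =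
  RB_deg_map (cdiff D l l') i (RB_deg_map (cmor f l) i x).
Proof.
apply: val_inj; rewrite /= !RB_map_comp; congr (RB_map _ _).
by apply: ghom_eq => y; apply: cmorP.
Qed.

Lemma HRB_map_cycle v : RB_deg_map (cdiff C k (k + 1)) i v = 0 ->
  RB_deg_map (cdiff D k (k + 1)) i (RB_deg_map (cmor f k) i v) = 0.
Proof. by move=> h; rewrite -RB_comm h linear0. Qed.

Lemma HRB_map_boundary u : exists u',
  RB_deg_map (cdiff D (k - 1) k) i u' =
  RB_deg_map (cmor f k) i (RB_deg_map (cdiff C (k - 1) k) i u).
Proof. by exists (RB_deg_map (cmor f (k - 1)) i u); rewrite RB_comm. Qed.

Definition HRB_map : {linear HRB C i k -> HRB D i k} :=
  hmap (RB_deg_map (cmor f k) i) HRB_map_cycle HRB_map_boundary.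
End ChainMap.
End TensorB.

End GradedBimodules.

(** Tridegree [(i, j, k)] stands for [q^i a^j] in homological degree [k]. *)
Notation tridegree := (int * int * int)%type.
Definition trigraded : Type := tridegree -> lmodType rat.

Definition trigraded_iso (V W : trigraded) : Prop :=
  forall d, linear_iso (V d) (W d).

Definition tensorQ (X Y : lmodType rat) : lmodType rat :=
  tensor (fun (x : X) (c : rat) => c *: x) (fun (c : rat) (y : Y) => c *: y).

Definition trigraded_tensor (V W : trigraded) : trigraded :=
  fun d => dsum (fun e : tridegree => tensorQ (V e) (W (d - e))).

(** The exterior algebra on [xi_1, ..., xi_n], [deg xi_k = q^(-2k) a], as a
    triply graded vector space with basis the monomials
    [xi_S = xi_(k_1) ... xi_(k_r)], [S = {k_1 < ... < k_r}]. The index [k] in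
    ['I_n] stands for [k + 1]. *)
Definition ext_degree (n : nat) (S : {set 'I_n}) : tridegree :=
  \sum_(k in S) (- (2 * k.+1)%:Z, 1, 0).

Definition Lambda (n : nat) : trigraded :=
  fun d => {ffun {S : {set 'I_n} | ext_degree S == d} -> rat^o}.

Section TrigradedHHH.
Variables (n : nat) (P : forall i : int, gresolution (gshift (polybim n) i)).
Variable C : gcomplex n.

Definition HHH : trigraded := fun d =>
  let: (i, j, k) := d in
  if j is Posz j' then HHH_at P C i j' k else zerosp.

Definition HHH0_at (i k : int) : lmodType rat := HHH_at P C i 0 k.
Definition HHH0 : trigraded := fun d =>
  let: (i, j, k) := d in if j is Posz 0 then HHH0_at i k else zerosp.
End TrigradedHHH.

(* Main.v *)
Require Import Defs.
From HB Require Import structures.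
From mathcomp Require Import all_boot all_order all_algebra.
From mathcomp Require Import boolp.
From mathcomp Require Import freeg mpoly.

Set Implicit Arguments.
Unset Strict Implicit.
Unset Printing Implicit Defensive.

Import GRing.Theory.
Local Open Scope ring_scope.

(** Over [R^e = R ⊗ R], with variables [x_k], [y_k], the groups [Ext(R(i), M)]
    are computed by the Koszul cochain complex of [f_k = x_k - y_k] on [M]. The
    divided differences [p_s = P[y_0, ..., y_s]] of [P(T) = prod_i (T - x_i)]
    form a regular sequence with [R^e / (p) = B], and they vanish on the
    diagonal, so [p_s = sum_k a_sk f_k]. Contraction with the vector [a_s] is a
    homotopy for multiplication by [p_s]. On a free [R^e]-module [V] the Koszul
    cohomology is [V / (f) V] in top degree; killing [p_0, ..., p_(n-1)] one at
    a time shows that on [M = V / (p) V] it is the exterior algebra on the [n]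
    contractions, applied to the top classes [M / (f) M = R ⊗_B M]. This is
    natural in [M], so it passes to complexes. Hochschild degree 0 consists of
    the classes to which all [n] contractions have been applied, and [xi_s] is
    obtained by omitting one of them. *)

(** * Divided differences and the relations of B *)

(** The splitting of a chain bimodule into copies of B is not respected by the differentials, so it
    must not enter any isomorphism. Classes are therefore built from natural operations only (the
    R^e-action, contractions, homogeneous projections), and the splitting merely serves to decide
    which families of elements give all classes and which give zero. The isomorphisms then come from
    comparing two surjections with the same kernel, and naturality is checked on representatives.
    The resolutions of R(i) are arbitrary, so they are compared with the Koszul one; the comparison
    maps do not involve the bimodule and hence commute with bimodule maps. The constant of the
    regrading: contraction with [a_s] raises the q-degree by 2(n - s), all n of them together by n(n
    + 1), and the top exterior generator has degree -2n; so an element of degree i - n(n - 1) in M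
    gives a class of q-degree i. Omitting the contraction of degree 2k lowers the degree by 2k,
    which is the degree of xi_k. *)

Definition idspan (A V : zmodType) (act : A -> V -> V) (g : nat -> A) (r : nat)
    (v : V) : Prop :=
  exists w : nat -> V, v = \sum_(k < r) act (g k) (w k).

Section IdealSpan.
Variables (A : comNzRingType) (g : nat -> A) (r : nat).
Local Notation J := (idspan *%R g r).

Lemma ideal0 : J 0.
Proof. by exists (fun=> 0); rewrite big1 // => i _; rewrite mulr0. Qed.
Lemma idealD u v : J u -> J v -> J (u + v).
Proof.
move=> [a ->] [b ->]; exists (fun k => a k + b k); rewrite -big_split.
by apply: eq_bigr => i _; rewrite mulrDr.
Qed.
Lemma idealM c u : J u -> J (c * u).
Proof.
move=> [a ->]; exists (fun k => c * a k); rewrite mulr_sumr.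
by apply: eq_bigr => i _; rewrite mulrCA.
Qed.
Lemma idealN u : J u -> J (- u).
Proof. by move=> hu; rewrite -mulN1r; apply: idealM. Qed.
Lemma idealB u v : J u -> J v -> J (u - v).
Proof. by move=> hu hv; apply: idealD => //; apply: idealN. Qed.
Lemma ideal_sum I (s : seq I) (P : pred I) (F : I -> A) :
  (forall i, P i -> J (F i)) -> J (\sum_(i <- s | P i) F i).
Proof. by move=> h; elim/big_ind: _ => //; [apply: ideal0 | apply: idealD]. Qed.
Lemma ideal_gen k : (k < r)%N -> J (g k).
Proof.
move=> kr; exists (fun i => (i == k)%:R); rewrite (bigD1 (Ordinal kr)) //=.
rewrite eqxx mulr1 big1 ?addr0 // => i ne; rewrite (_ : (_ == k) = false).
  by rewrite mulr0.
by apply/negbTE; apply: contra ne => /eqP E; apply/eqP/val_inj.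
Qed.
End IdealSpan.

Lemma ideal_le (A : comNzRingType) (g : nat -> A) r s v : (r <= s)%N ->
  idspan *%R g r v -> idspan *%R g s v.
Proof.
move=> rs [w ->]; apply: ideal_sum => k _; rewrite mulrC; apply: idealM.
by apply: ideal_gen; apply: leq_trans rs.
Qed.

(** [sigma] lowers the exponent of the variable [y] by one, killing the
    monomials without [y]; [y_free c] says that [c] does not involve [y]. *)
Section MonicRegular.
Variables (A : comNzRingType) (y : A) (sigma : {additive A -> A}).
Hypothesis sigmaK : forall q, sigma (y * q) = q.
Hypothesis sigma_nil : forall q, exists N, iter N sigma q = 0.

Definition y_free c := forall q, sigma (c * q) = c * sigma q.

Lemma iter_sigma0 N : iter N sigma 0 = 0.
Proof. by elim: N => //= N ->; rewrite raddf0. Qed.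
Lemma iter_sigmaD N a b :
  iter N sigma (a + b) = iter N sigma a + iter N sigma b.
Proof. by elim: N => //= N ->; rewrite raddfD. Qed.
Lemma iter_sigma_sum N I (s : seq I) (F : I -> A) :
  iter N sigma (\sum_(i <- s) F i) = \sum_(i <- s) iter N sigma (F i).
Proof.
elim: s => [|i s IH]; first by rewrite !big_nil iter_sigma0.
by rewrite !big_cons iter_sigmaD IH.
Qed.
Lemma iter_sigmaM N c q : y_free c -> iter N sigma (c * q) = c * iter N sigma q.
Proof. by move=> hc; elim: N => //= N ->; rewrite hc. Qed.
Lemma iter_sigmaK N q : iter N sigma (y ^+ N * q) = q.
Proof. by elim: N q => [|N IH] q; rewrite ?mul1r // iterSr exprS -mulrA sigmaK IH. Qed.

(** Compare leading coefficients in [y]: the ideal is stable under [sigma], so it contains the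
    leading coefficient of [u * q], which is that of [q]. Subtracting the leading term of [q] lowers
    its degree; the induction is on the number of shifts that kill [q]. *)
Lemma monic_regular (g : nat -> A) r d (c : nat -> A) q :
  (forall k, (k < r)%N -> y_free (g k)) -> (forall e, y_free (c e)) ->
  idspan *%R g r ((y ^+ d + \sum_(e < d) c e * y ^+ e) * q) ->
  idspan *%R g r q.
Proof.
move=> hg hc; set u := y ^+ d + _.
have stab N v : idspan *%R g r v -> idspan *%R g r (iter N sigma v).
  move=> [w ->]; rewrite iter_sigma_sum; apply: ideal_sum => k _.
  rewrite iter_sigmaM; last exact: hg.
  by rewrite mulrC; apply: idealM; apply: ideal_gen.
have [N] := sigma_nil q; elim: N q => [|N IH] q.
  by move=> /= -> _; apply: ideal0.
move=> qN huq; pose l := iter N sigma q.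
(* [l] is the coefficient of [y^N] in [q]. A lower term [c_e y^e q] dies, since more than [N] shifts
   are left for [q] after [y^e] has been cancelled. *)
have top : iter (N + d) sigma (u * q) = l.
  rewrite mulrDl iter_sigmaD iterD iter_sigmaK mulr_suml iter_sigma_sum.
  rewrite big1 ?addr0 // => -[e ed] _ /=; rewrite -mulrA iter_sigmaM //.
  rewrite (_ : (N + d = (d - e).-1 + N.+1 + e)%N); last first.
    by rewrite addnS -addSn prednK ?subn_gt0 // addnAC subnK ?(ltnW ed) // addnC.
  by rewrite iterD iter_sigmaK iterD qN iter_sigma0 mulr0.
have hl : idspan *%R g r l by rewrite -top; apply: stab.
rewrite -[q](subrK (y ^+ N * l)); apply: idealD; last exact: idealM.
apply: IH.
  rewrite -mulrN iter_sigmaD iter_sigmaK -/l.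
  by rewrite subrr.
rewrite mulrBr; apply: idealB => //; rewrite mulrA; exact: idealM.
Qed.
End MonicRegular.

(** * Dividing power series by the factors 1 - y_i T *)

Section TruncatedProducts.
Variables (A : comNzRingType) (n : nat) (c : nat -> A).

(** The reversed polynomial with roots [c_k, ..., c_(n-1)]: its constant term is 1, so that removing
    a root is a division of power series. *)
Definition cprod k : {poly A} := \prod_(k <= i < n) (1 - c i *: 'X).

Lemma cprod_size k m : (n - k < m)%N -> (cprod k)`_m = 0.
Proof.
move=> hm; apply: nth_default; apply: leq_trans hm.
rewrite /cprod; have [nk|kn] := leqP n k; first by rewrite big_geq // size_poly1.
move: {-2}n (leqnn n) => N _.
have [Nk|] := leqP N k; first by rewrite big_geq // size_poly1.
elim: N => [//|N IH]; rewrite ltnS leq_eqVlt => /orP[/eqP->|kN].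
  rewrite big_nat1 subSnn; apply: leq_trans (size_polyD _ _) _.
  by rewrite size_poly1 size_polyN geq_max (leq_trans (size_scale_leq _ _)) // size_polyX.
rewrite big_nat_recr ?(ltnW kN) //= mulrBr mulr1.
apply: leq_trans (size_polyD _ _) _; rewrite geq_max size_polyN subSn ?(ltnW kN) //.
rewrite (leq_trans (IH kN)) //= -scalerAr (leq_trans (size_scale_leq _ _)) //.
have [->|nz] := eqVneq (\prod_(k <= i < N) (1 - c i *: 'X)) 0.
  by rewrite mul0r size_poly0.
by rewrite size_mulX // ltnS IH.
Qed.

Lemma cprod0 k : (cprod k)`_0 = 1.
Proof.
rewrite /cprod; elim/big_ind: _ => [|p q hp hq|i _]; first by rewrite coef1.
  by rewrite coefM big_ord1 hp hq mulr1.
by rewrite coefB coef1 coefZ coefX mulr0 subr0.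
Qed.

Lemma cprodS k m : (k < n)%N ->
  (cprod k)`_m.+1 = (cprod k.+1)`_m.+1 - c k * (cprod k.+1)`_m.
Proof.
move=> kn; rewrite /cprod (big_ltn kn) mulrBl mul1r coefB -scalerAl coefZ.
by rewrite coefXM.
Qed.
End TruncatedProducts.

(** Power series division by [1 - y_0 T], ..., [1 - y_(k-1) T] *)
Fixpoint divs (A : comNzRingType) (y u : nat -> A) (k : nat) : nat -> A :=
  if k is k'.+1 then
    fix div m := if m is m'.+1 then divs y u k' m'.+1 + y k' * div m' else divs y u k' 0
  else u.

Section Divs.
Variables (A : comNzRingType) (y u : nat -> A).

Lemma divsS0 k : divs y u k.+1 0 = divs y u k 0. Proof. by []. Qed.
Lemma divsSS k m :
  divs y u k.+1 m.+1 = divs y u k m.+1 + y k * divs y u k.+1 m.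
Proof. by []. Qed.

(** The geometric series of [1 / (1 - y_k T)]. It shows the coefficient as a polynomial in [y_k],
    monic of degree [m] as soon as [u 0 = 1]. *)
Lemma divs_expand k m :
  divs y u k.+1 m = \sum_(e < m.+1) divs y u k (m - e) * y k ^+ e.
Proof.
elim: m => [|m IH]; first by rewrite big_ord1 divsS0 mulr1.
rewrite divsSS IH [RHS]big_ord_recl subn0 mulr1; congr (_ + _).
rewrite mulr_sumr; apply: eq_bigr => e _.
by rewrite exprS mulrCA.
Qed.

(** If the dividend is the product of all the factors, each division cancels one of them. *)
Lemma divs_cprod n k m : (k <= n)%N -> (forall m, u m = (cprod n y 0)`_m) ->
  divs y u k m = (cprod n y k)`_m.
Proof.
move=> kn hu; elim: k kn m => [|k IH] kn m; first exact: hu.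
elim: m => [|m IHm]; first by rewrite divsS0 IH ?(ltnW kn) // !cprod0.
by rewrite divsSS IHm IH ?(ltnW kn) // cprodS // subrK.
Qed.
End Divs.

Lemma divsB (A : comNzRingType) (y u v : nat -> A) k m :
  divs y (fun m => u m - v m) k m = divs y u k m - divs y v k m.
Proof.
elim: k m => [|k IH] m //; elim: m => [|m IHm]; first exact: IH.
by rewrite !divsSS IHm IH mulrBr opprD !addrA; congr (_ + _); rewrite addrAC.
Qed.
Lemma divs_rmorph (A B : comNzRingType) (h : {rmorphism A -> B}) (y u : nat -> A) k m :
  h (divs y u k m) = divs (h \o y) (h \o u) k m.
Proof.
elim: k m => [|k IH] m //; elim: m => [|m IHm]; first exact: IH.
by rewrite !divsSS rmorphD rmorphM IH IHm.
Qed.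

Section FreeClosed.
Variables (A : comNzRingType) (sigma : {additive A -> A}).
Local Notation free := (y_free sigma).
Lemma freeD a b : free a -> free b -> free (a + b).
Proof. by move=> ha hb q; rewrite !mulrDl raddfD ha hb. Qed.
Lemma freeN a : free a -> free (- a).
Proof. by move=> ha q; rewrite !mulNr raddfN ha. Qed.
Lemma freeM a b : free a -> free b -> free (a * b).
Proof. by move=> ha hb q; rewrite -!mulrA ha hb. Qed.
Lemma free_divs (y u : nat -> A) k m : (forall j, (j < k)%N -> free (y j)) ->
  (forall m, free (u m)) -> free (divs y u k m).
Proof.
move=> hy hu; elim: k hy m => [|k IH] hy // m.
have IHk := IH (fun j jk => hy j (ltnW jk)).
elim: m => [|m IHm]; first exact: IHk.
by rewrite divsSS; apply: freeD => //; apply: freeM => //; apply: hy.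
Qed.
End FreeClosed.

Section VariableShift.
Variables (N : nat) (v : 'I_N).
Local Notation S := {mpoly rat[N]}.

Definition mshift (p : S) : S :=
  \sum_(m <- msupp p | m v != 0%N) p@_m *: 'X_[m - U_(v)].

Lemma mcoeff_mshift p m : (mshift p)@_m = p@_(m + U_(v)).
Proof.
rewrite /mshift raddf_sum /=.
under eq_bigr do rewrite mcoeffZ mcoeffX.
have E (m' : 'X_{1..N}) : m' v != 0%N -> ((m' - U_(v))%MM == m) = (m' == (m + U_(v))%MM).
  move=> h; apply/eqP/eqP => [<-|->]; last by rewrite addmK.
  by rewrite submK // lep1mP.
have [hm|hm] := boolP ((m + U_(v))%MM \in msupp p); last first.
  rewrite (memN_msupp_eq0 hm) big_seq_cond big1 // => m' /andP[m's h].
  rewrite E //; case: eqP => [e|_]; last by rewrite mulr0.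
  by rewrite -e m's in hm.
have hv : (m + U_(v))%MM v != 0%N by rewrite mnmDE mnm1E eqxx addn1.
rewrite (big_rem _ hm) /= hv E // eqxx mulr1 big_seq_cond big1 ?addr0 // => m' /andP[].
rewrite mem_rem_uniq ?msupp_uniq // !inE => /andP[ne _] h.
by rewrite E // (negbTE ne) mulr0.
Qed.

Fact mshift_linear : linear mshift.
Proof.
move=> c p q; apply/mpolyP => m.
by rewrite mcoeffD mcoeffZ !mcoeff_mshift mcoeffD mcoeffZ.
Qed.
HB.instance Definition _ := GRing.isLinear.Build rat S S _ mshift mshift_linear.

Lemma mshiftK q : mshift ('X_v * q) = q.
Proof. by apply/mpolyP => m; rewrite mcoeff_mshift mulrC addmC mcoeffMX. Qed.

Lemma mshift_nil q : exists k, iter k mshift q = 0.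
Proof.
exists (msize q); apply/mpolyP => m; rewrite mcoeff0.
have -> k : (iter k mshift q)@_m = q@_(m + U_(v) *+ k).
  elim: k m => [|k IH] m; first by rewrite mulm0n addm0.
  by rewrite iterS mcoeff_mshift IH mulmS addmA.
apply/memN_msupp_eq0/msize_mdeg_ge.
by rewrite mdegD mdegMn mdeg1 mul1n leq_addl.
Qed.

Lemma mshift_freeX w : w != v -> y_free mshift 'X_w.
Proof.
move=> wv q; apply/mpolyP => m; rewrite mcoeff_mshift !(mulrC 'X_w).
have [hm|hm] := boolP (U_(w) <= m)%MM.
  rewrite -(submK hm); move: (m - U_(w))%MM => k.
  rewrite [(k + _)%MM]addmC -addmA !mcoeffMX.
  by rewrite mcoeff_mshift.
have out (m' : 'X_{1..N}) (p : S) : ~~ (U_(w) <= m')%MM -> (p * 'X_w)@_m' = 0.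
  move=> h; apply: memN_msupp_eq0; apply: contra h => /msuppM_le /allpairsP[[a b] /=].
  by rewrite msuppX inE => -[_ /eqP-> ->]; apply: lem_addl.
rewrite !out //; apply: contra hm; rewrite !lep1mP mnmDE mnm1E (eq_sym v) (negbTE wv).
by rewrite addn0.
Qed.
End VariableShift.

Lemma mpoly_alg_ind N (P : {mpoly rat[N]} -> Prop) :
  (forall c, P c%:MP) -> (forall i, P 'X_i) ->
  (forall p q, P p -> P q -> P (p + q)) -> (forall p q, P p -> P q -> P (p * q)) ->
  forall p, P p.
Proof.
move=> PC PX PD PM; elim/mpolyind => [|c m p _ _ IH]; first by have := PC 0.
apply: PD => //; rewrite -mul_mpolyC; apply: (PM) => //.
rewrite mpolyXE_id; elim/big_ind: _ => [||i _]; [by have := PC 1 | exact: PM |].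
by elim: (m i) => [|k IHk]; [have := PC 1 | rewrite exprS; apply: PM].
Qed.

Lemma pihomogM N d e (f a : {mpoly rat[N]}) : f \is e.-homog ->
  pihomog mdeg (e + d) (f * a) = f * pihomog mdeg d a.
Proof.
move=> hf; rewrite [a in LHS]poly_decomp [X in f * pihomog _ _ X]poly_decomp.
rewrite mulr_sumr !raddf_sum /= mulr_sumr; apply: eq_bigr => k _.
have hk := pihomogP mdeg k a.
have [->|ne] := eqVneq k d; first by rewrite pihomog_id pihomog_dE // dhomogM // pihomogP.
rewrite (@pihomog_ne0 _ _ _ (e + k) _ _ _) ?dhomogM ?eqn_add2l //.
by rewrite (@pihomog_ne0 _ _ _ k) ?mulr0 // eq_sym.
Qed.

Lemma mvar_homog N (i : 'I_N) : ('X_i : {mpoly rat[N]}) \is 1.-homog.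
Proof. by rewrite dhomogX; apply/eqP/mdeg1. Qed.

(** * The ring Q[x, y] and the two regular sequences in it *)

Section Enveloping.
Variable n : nat.
Local Notation R := {mpoly rat[n]}.
Local Notation Re := {mpoly rat[n + n]}.

(** Existentially packed so that unification never unfolds these maps *)
Fact mpoly_morph_ex m k (v : 'I_m -> {mpoly rat[k]}) :
  {h : {rmorphism {mpoly rat[m]} -> {mpoly rat[k]}} |
    (forall i, h 'X_i = v i) /\ (forall c, h c%:MP = c%:MP)}.
Proof.
exists (comp_mpoly [tuple v i | i < m]); split=> [i|c] /=.
  by rewrite comp_mpolyXU -tnth_nth tnth_mktuple.
exact: comp_mpolyC.
Qed.

Definition lemb : {rmorphism R -> Re} :=
  sval (mpoly_morph_ex (fun i => 'X_(lshift n i))).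
Definition remb : {rmorphism R -> Re} :=
  sval (mpoly_morph_ex (fun i => 'X_(rshift n i))).
Definition codiag : {rmorphism Re -> R} :=
  sval (mpoly_morph_ex (fun i => 'X_(match split i with inl j => j | inr j => j end))).

(** Variables indexed by natural numbers, with junk value [0] from [n] on *)
Definition rvar (k : nat) : R := if insub k is Some i then 'X_i else 0.
Definition xvar (k : nat) : Re := lemb (rvar k).
Definition yvar (k : nat) : Re := remb (rvar k).
Definition fdiff (k : nat) : Re := xvar k - yvar k.

Lemma rvarE (i : 'I_n) : rvar i = 'X_i.
Proof. by rewrite /rvar valK. Qed.
Lemma lembX i : lemb 'X_i = 'X_(lshift n i).
Proof. exact: (svalP (mpoly_morph_ex _)).1. Qed.
Lemma rembX i : remb 'X_i = 'X_(rshift n i).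
Proof. exact: (svalP (mpoly_morph_ex _)).1. Qed.
Lemma codiagX i : codiag 'X_i = 'X_(match split i with inl j => j | inr j => j end).
Proof. exact: (svalP (mpoly_morph_ex _)).1. Qed.
Lemma lembC c : lemb c%:MP = c%:MP.
Proof. exact: (svalP (mpoly_morph_ex _)).2. Qed.
Lemma rembC c : remb c%:MP = c%:MP.
Proof. exact: (svalP (mpoly_morph_ex _)).2. Qed.
Lemma codiagC c : codiag c%:MP = c%:MP.
Proof. exact: (svalP (mpoly_morph_ex _)).2. Qed.
Lemma lembZ c p : lemb (c *: p) = c *: lemb p.
Proof. by rewrite -!mul_mpolyC rmorphM lembC. Qed.
Lemma rembZ c p : remb (c *: p) = c *: remb p.
Proof. by rewrite -!mul_mpolyC rmorphM rembC. Qed.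
Lemma codiagZ c p : codiag (c *: p) = c *: codiag p.
Proof. by rewrite -!mul_mpolyC rmorphM codiagC. Qed.

Lemma lembK : cancel lemb codiag.
Proof.
apply: mpoly_alg_ind => [c|i|p q hp hq|p q hp hq].
- by rewrite lembC codiagC.
- by rewrite lembX codiagX (unsplitK (inl i)).
- by rewrite !rmorphD hp hq.
- by rewrite !rmorphM hp hq.
Qed.
Lemma rembK : cancel remb codiag.
Proof.
apply: mpoly_alg_ind => [c|i|p q hp hq|p q hp hq].
- by rewrite rembC codiagC.
- by rewrite rembX codiagX (unsplitK (inr i)).
- by rewrite !rmorphD hp hq.
- by rewrite !rmorphM hp hq.
Qed.

(** Reduces identities for the action of R^e on a bimodule to its left and right actions. *)
Lemma Re_ind (P : Re -> Prop) :
  (forall r, P (lemb r)) -> (forall r, P (remb r)) ->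
  (forall p q, P p -> P q -> P (p + q)) -> (forall p q, P p -> P q -> P (p * q)) ->
  forall p, P p.
Proof.
move=> Pl Pr PD PM; apply: mpoly_alg_ind => // [c|i].
  by rewrite -lembC.
case: (split_ordP i) => j ->; first by rewrite -(lembX j); apply: Pl.
by rewrite -(rembX j); apply: Pr.
Qed.

(** Every [p] is congruent to [lemb (codiag p)] modulo the [x_k - y_k]: this holds for the variables
    and is preserved by sums and products. *)
Lemma codiag_ker q : codiag q = 0 <-> idspan *%R fdiff n q.
Proof.
have key p : idspan *%R fdiff n (p - lemb (codiag p)).
  have f_gen k : idspan *%R fdiff n (fdiff k).
    have [kn|nk] := ltnP k n; first exact: ideal_gen.
    rewrite /fdiff /xvar /yvar /rvar insubN; last by rewrite -leqNgt.
    rewrite rmorph0.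
    rewrite rmorph0.
    rewrite subrr.
    exact: ideal0.
  have step p1 p2 : idspan *%R fdiff n (p1 - lemb (codiag p1)) ->
      idspan *%R fdiff n (p2 - lemb (codiag p2)) ->
      idspan *%R fdiff n (p1 * p2 - lemb (codiag (p1 * p2))).
    move=> h1 h2; rewrite !rmorphM.
    rewrite (_ : _ - _ = p1 * (p2 - lemb (codiag p2)) +
                 lemb (codiag p2) * (p1 - lemb (codiag p1))).
      by apply: idealD; apply: idealM.
    by rewrite !mulrBr addrA [lemb _ * p1]mulrC subrK [lemb _ * lemb _]mulrC.
  move: p; apply: mpoly_alg_ind => // [c|i|p1 p2 h1 h2].
  - by rewrite codiagC lembC subrr; apply: ideal0.
  - case: (split_ordP i) => j ->.
      by rewrite -(lembX j) lembK subrr; apply: ideal0.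
    rewrite -(rembX j) rembK.
    by have /idealN := f_gen j; rewrite /fdiff /xvar /yvar rvarE opprB.
  - by rewrite !rmorphD opprD addrACA; apply: idealD.
split=> [q0|[w ->]]; first by have := key q; rewrite q0 rmorph0 subr0.
rewrite rmorph_sum big1 // => k _.
by rewrite rmorphM /fdiff rmorphB lembK rembK subrr mul0r.
Qed.

Definition csym (m : nat) : R := (cprod n rvar 0)`_m.

Lemma csymE m : csym m = (-1) ^+ m *: mesym n rat m.
Proof.
rewrite /csym /cprod big_mkord.
under eq_bigr do rewrite rvarE addrC -scaleNr.
rewrite bigA_distr coef_sum.
rewrite /mesym scaler_sumr [RHS](big_mkcond (fun J : {set 'I_n} => _ == _)) /=; apply: eq_bigr => J _.
rewrite -big_mkcond /=.
rewrite scaler_prodr prodrN coefZ coefXn eq_sym.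
case: eqP => [->|_]; last by rewrite mulr0.
by rewrite mulr1 -mul_mpolyC rmorphXn rmorphN rmorph1.
Qed.

Lemma csym_sym m : csym m \is symmetric.
Proof. by rewrite csymE rpredZ // mesym_sym. Qed.

Lemma csym_rmorph (A : comNzRingType) (h : {rmorphism R -> A}) m :
  h (csym m) = (cprod n (h \o rvar) 0)`_m.
Proof.
rewrite /csym -coef_map /cprod rmorph_prod; congr ((_ : {poly A})`_m).
apply: eq_bigr => i _.
by rewrite rmorphB rmorph1 /= map_polyZ map_polyX.
Qed.

Lemma rmorph_homog k (h : {rmorphism R -> {mpoly rat[k]}}) d r :
  (forall c, h c%:MP = c%:MP) -> (forall i, h 'X_i \is 1.-homog) ->
  r \is d.-homog -> h r \is d.-homog.
Proof.
move=> hC hX hr; rewrite [r]mpolyE big_seq rmorph_sum; apply: rpred_sum => m hm.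
rewrite -mul_mpolyC rmorphM hC mul_mpolyC rpredZ //.
have <- : mdeg m = d by exact: (dhomog_mf hr hm).
rewrite {hm} mpolyXE_id rmorph_prod mdegE.
elim/big_ind2: _ => [|x a y b|i _]; [exact: dhomog1 | exact: dhomogM |].
by rewrite rmorphXn; have := dhomogMn (m i) (hX i); rewrite mul1n.
Qed.
Lemma lemb_homog d r : r \is d.-homog -> lemb r \is d.-homog.
Proof.
by apply: rmorph_homog => [|i]; [exact: lembC | rewrite lembX; apply: mvar_homog].
Qed.
Lemma remb_homog d r : r \is d.-homog -> remb r \is d.-homog.
Proof.
by apply: rmorph_homog => [|i]; [exact: rembC | rewrite rembX; apply: mvar_homog].
Qed.
Lemma rvar_homog k : rvar k \is 1.-homog.
Proof.
by rewrite /rvar; case: insub => [i|]; [apply: mvar_homog | apply: dhomog0].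
Qed.
Lemma fdiff_homog k : fdiff k \is 1.-homog.
Proof. by rewrite rpredB // ?lemb_homog ?remb_homog ?rvar_homog. Qed.

(** [prel k] is, up to sign, the divided difference
    [P[y_0, ..., y_k]] of [P(T) = prod_i (T - x_i)], a polynomial in
    [y_0, ..., y_k] monic in [y_k] of degree [n - k]. *)
Definition prel (k : nat) : Re := divs yvar (lemb \o csym) k.+1 (n - k).

Lemma divs_homog k m : divs yvar (lemb \o csym) k m \is m.-homog.
Proof.
elim: k m => [|k IH] m.
  by rewrite /= csymE lembZ rpredZ // lemb_homog // dhomog_mesym.
elim: m => [|m IHm]; first exact: IH.
rewrite divsSS rpredD // -(add1n m); apply: dhomogM => //.
exact/remb_homog/rvar_homog.
Qed.
Lemma prel_homog k : prel k \is (n - k).-homog.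
Proof. exact: divs_homog. Qed.

(** On the diagonal the first [k + 1] factors cancel and leave a polynomial of degree at most
    [n - k - 1], one less than the index of the coefficient taken. *)
Lemma codiag_prel k : (k < n)%N -> codiag (prel k) = 0.
Proof.
move=> kn; rewrite divs_rmorph.
rewrite (@divs_cprod _ _ _ n) // => [|m]; last first.
  rewrite /= lembK /csym; congr ((_ : {poly _})`_m).
  by rewrite /cprod; apply: eq_bigr => i _; rewrite /= rembK.
by rewrite cprod_size // ltn_sub2l.
Qed.

Lemma prel_fdiff : exists a : nat -> nat -> Re,
  (forall k l, a k l \is (n - k).-1.-homog) /\
  (forall k, (k < n)%N -> prel k = \sum_(l < n) fdiff l * a k l).
Proof.
have hk k : exists w : nat -> Re, (forall l, w l \is (n - k).-1.-homog) /\
    ((k < n)%N -> prel k = \sum_(l < n) fdiff l * w l).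
  have [kn|_] := ltnP k n; last by exists (fun=> 0); split=> [l|//]; apply: dhomog0.
  have /codiag_ker [w hw] := codiag_prel kn.
  (* Since [prel k] and [fdiff l] are homogeneous, the coefficients may be replaced by their
     components of degree [n - k - 1]. This makes the contractions homogeneous. *)
  exists (fun l => pihomog mdeg (n - k).-1 (w l)); split=> [l|_]; first exact: pihomogP.
  rewrite -[LHS](pihomog_dE (prel_homog k)) hw raddf_sum; apply: eq_bigr => l _ /=.
  have -> : (n - k = 1 + (n - k).-1)%N by rewrite add1n prednK ?subn_gt0.
  by rewrite (pihomogM _ _ (fdiff_homog l)).
have [a ha] := choice hk.
by exists a; split=> k; [move=> l|]; have [h1 h2] := ha k; [apply: h1 | apply: h2].
Qed.

(** With the dividend taken in the [y] instead of the [x], the same coefficient vanishes for degree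
    reasons; so only the differences of elementary symmetric polynomials in [x] and in [y] enter.
    Hence [prel k] acts by zero on B. *)
Lemma prel_csym k : (k < n)%N -> exists b : nat -> Re,
  prel k = \sum_(m < (n - k).+1) b m * (lemb (csym m) - remb (csym m)).
Proof.
move=> kn; rewrite /prel.
have -> : divs yvar (lemb \o csym) k.+1 (n - k) =
    divs yvar (fun m => (lemb \o csym) m - (remb \o csym) m) k.+1 (n - k).
  rewrite divsB [X in _ - X](_ : _ = 0) ?subr0 //.
  rewrite (@divs_cprod _ _ _ n) // => [|m]; last by rewrite /= csym_rmorph.
  by rewrite cprod_size // ltn_sub2l.
pose Q m (r : Re) := exists b : nat -> Re,
  r = \sum_(j < m.+1) b j * (lemb (csym j) - remb (csym j)).
have Qle m m' r : (m <= m')%N -> Q m r -> Q m' r.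
  move=> mm [b ->]; exists (fun j => if (j <= m)%N then b j else 0).
  rewrite (big_ord_widen m'.+1 (fun j => b j * (lemb (csym j) - remb (csym j)))) //.
  rewrite big_mkcond; apply: eq_bigr => j _; rewrite ltnS; case: ifP => // _.
  by rewrite mul0r.
suff : forall j m, Q m (divs yvar (fun m => (lemb \o csym) m - (remb \o csym) m) j m).
  exact.
have QD m r1 r2 : Q m r1 -> Q m r2 -> Q m (r1 + r2).
  move=> [b1 ->] [b2 ->]; exists (fun j => b1 j + b2 j); rewrite -big_split.
  by apply: eq_bigr => j _; rewrite mulrDl.
have QM m c r : Q m r -> Q m (c * r).
  move=> [b ->]; exists (fun j => c * b j); rewrite mulr_sumr.
  by apply: eq_bigr => j _; rewrite mulrA.
elim=> [|j IH] m.
  exists (fun i => (i == m)%:R); rewrite big_ord_recr /= eqxx mul1r big1 ?add0r //.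
  by move=> i _; rewrite ltn_eqF // mul0r.
elim: m => [|m IHm]; first exact: IH.
rewrite divsSS; apply: QD => //; apply: QM; exact: Qle IHm.
Qed.

(** Modulo [prel] the division of [prod_i (1 - x_i T)] by all the [1 - y_i T] is exact with quotient
    1, so the elementary symmetric polynomials in [x] and in [y] agree; they generate all the
    symmetric ones. *)
Lemma sym_prel s : s \is symmetric -> idspan *%R prel n (lemb s - remb s).
Proof.
set J := idspan _ _ _ => hs.
(* After [k] divisions the quotient has degree at most [n - k] modulo [J]: the first coefficient
   beyond is a [prel] (or zero, for [k = 0]), and the recursion gives the later ones. *)
have A k m : (k <= n)%N -> (n - k < m)%N -> J (divs yvar (lemb \o csym) k m).
  elim: k m => [|k IH] m kn hm.
    rewrite /= csymE lembZ mesym_geqnE; last by rewrite subn0 in hm.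
    by rewrite rmorph0 scaler0; apply: ideal0.
  have [->|ne] := eqVneq m (n - k)%N.
    by have := @ideal_gen _ prel n k kn.
  elim: m hm ne => [|m IHm] hm ne.
    by rewrite ltn0 in hm.
  rewrite divsSS; apply: idealD.
    by apply: IH; rewrite ?(ltnW kn) // ltn_neqAle eq_sym ne /= -(subnSK kn).
  apply: idealM; have [->|ne'] := eqVneq m (n - k)%N.
    by have := @ideal_gen _ prel n k kn.
  apply: IHm => //; move: hm; rewrite ltnS -(subnSK kn) in ne' ne *.
  by rewrite leq_eqVlt => /orP[/eqP E|//]; rewrite E eqxx in ne.
(* Multiplies the factors back one at a time, starting from the quotient 1 after all [n]
   divisions. *)
have B k m : (k <= n)%N ->
    J (divs yvar (lemb \o csym) (n - k) m - (cprod n yvar (n - k))`_m).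
  elim: k m => [|k IH] m kn.
    rewrite subn0; case: m => [|m].
      rewrite cprod0 (_ : divs _ _ _ _ = 1) ?subrr; first exact: ideal0.
      have E k : divs yvar (lemb \o csym) k 0 = lemb (csym 0).
        by elim: k => // k IH; rewrite divsS0.
      by rewrite E csymE mesym0E expr0 scale1r rmorph1.
    by rewrite cprod_size ?subnn // subr0; apply: A; rewrite ?subnn.
  have nk : (n - k.+1 < n)%N by rewrite ltn_subrL (leq_ltn_trans _ kn).
  have e : (n - k = (n - k.+1).+1)%N by rewrite subnSK.
  case: m => [|m].
    have := IH 0 (ltnW kn); rewrite e divsS0 !cprod0; exact.
  rewrite cprodS // -e.
  have -> : divs yvar (lemb \o csym) (n - k.+1) m.+1 =
     divs yvar (lemb \o csym) (n - k) m.+1 -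
     yvar (n - k.+1) * divs yvar (lemb \o csym) (n - k) m.
    by rewrite e divsSS addrK.
  rewrite opprB [_ * _ - (cprod _ _ _)`__]addrC addrACA [- _ + _]addrC -mulrBr.
  rewrite -[X in _ * X]opprB mulrN.
  by apply: idealB; [|apply: idealM]; apply: IH; apply: ltnW.
have C m : J (lemb (csym m) - remb (csym m)).
  by have := B n m (leqnn n); rewrite subnn (csym_rmorph remb).
rewrite (symfP hs); move: (symf s) => t.
pose Q r := J (lemb r - remb r).
have QM p q : Q p -> Q q -> Q (p * q).
  move=> hp hq; rewrite /Q !rmorphM.
  rewrite (_ : _ - _ = lemb p * (lemb q - remb q) + remb q * (lemb p - remb p)).
    by apply: idealD; apply: idealM.
  by rewrite !mulrBr addrA [remb q * lemb p]mulrC subrK [remb q * _]mulrC.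
have Q1 : Q 1 by rewrite /Q !rmorph1 subrr; apply: ideal0.
have QC c : Q c%:MP by rewrite /Q lembC rembC subrr; apply: ideal0.
rewrite -/(Q _) comp_mpolyEX; elim/big_ind: _ => [|p q hp hq|m _].
- by rewrite /Q !rmorph0 subrr; apply: ideal0.
- by rewrite /Q !rmorphD opprD addrACA; apply: idealD.
- rewrite -mul_mpolyC; apply: (QM) => //; rewrite comp_mpolyX.
  elim/big_ind: _ => [||i _] //; elim: (m i) => [|k IH] //.
  rewrite exprS; apply: (QM) => //; rewrite tnth_mktuple.
  have -> : mesym n rat i.+1 = ((-1) ^+ i.+1)%:MP * csym i.+1.
    by rewrite csymE mul_mpolyC scalerA -expr2 sqrr_sign scale1r.
  by apply: QM => //; apply: C.
Qed.

Section Regular.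
Variable i : 'I_n.
Local Notation free := (y_free (mshift (rshift n i))).

Lemma lemb_free r : free (lemb r).
Proof.
move: r; apply: mpoly_alg_ind => [c|j|p q hp hq|p q hp hq].
- move=> q; rewrite lembC !mul_mpolyC; apply/mpolyP => m.
  by rewrite mcoeff_mshift !mcoeffZ mcoeff_mshift.
- rewrite lembX; apply: mshift_freeX; rewrite -(inj_eq val_inj) /= ltn_eqF //.
  by rewrite ltn_addr.
- by rewrite rmorphD; apply: freeD.
- by rewrite rmorphM; apply: freeM.
Qed.
Lemma yvar_free j : (j < i)%N -> free (yvar j).
Proof.
move=> ji; have jn := ltn_trans ji (ltn_ord i).
rewrite /yvar (rvarE (Ordinal jn)) rembX; apply: mshift_freeX.
by rewrite -(inj_eq val_inj) /= eqn_add2l ltn_eqF.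
Qed.
Lemma yvarK q : mshift (rshift n i) (yvar i * q) = q.
Proof. by rewrite /yvar rvarE rembX mshiftK. Qed.

(** Up to sign [fdiff i] is monic of degree 1 in [y_i], a variable that the earlier elements do not
    involve. *)
Lemma fdiff_regular q :
  idspan *%R fdiff i (fdiff i * q) -> idspan *%R fdiff i q.
Proof.
move=> /idealN h; apply: (@monic_regular _ (yvar i) (mshift (rshift n i))
   yvarK (@mshift_nil _ _) fdiff i 1 (fun=> - xvar i)) => [k ki|e|].
- by apply: freeD; [apply: lemb_free | apply/freeN/yvar_free].
- by apply/freeN/lemb_free.
- by rewrite expr1 big_ord1 expr0 mulr1 -[X in X * q]opprB mulNr.
Qed.

(** By [divs_expand], [prel i] is monic of degree [n - i] in [y_i]; its coefficients and the earlier
    [prel k] involve only the [x] and [y_0, ..., y_(i-1)]. *)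
Lemma prel_regular q :
  idspan *%R prel i (prel i * q) -> idspan *%R prel i q.
Proof.
have free_d k m : (k <= i)%N -> free (divs yvar (lemb \o csym) k m).
  move=> ki; apply: free_divs => [j jk|j]; last exact: lemb_free.
  by apply: yvar_free; apply: leq_trans ki.
move=> h; apply: (@monic_regular _ (yvar i) (mshift (rshift n i))
   yvarK (@mshift_nil _ _) prel i (n - i)
   (fun e => divs yvar (lemb \o csym) i (n - i - e))) => [k ki|e|].
- exact: free_d.
- exact: free_d.
- move: h; rewrite {2}/prel divs_expand big_ord_recr /= subnn addrC.
  have E k : divs yvar (lemb \o csym) k 0 = 1.
    elim: k => [|k IH]; last by rewrite divsS0.
    by rewrite /= csymE mesym0E expr0 scale1r rmorph1.
  by rewrite E mul1r.
Qed.
End Regular.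
End Enveloping.

(** * Equalities in abelian groups *)

Inductive zexp := ZVar of nat | ZAdd of zexp & zexp | ZOpp of zexp | ZZero.

Fixpoint zeval (V : zmodType) (env : seq V) (e : zexp) : V :=
  match e with
  | ZVar i => nth 0 env i
  | ZAdd a b => zeval env a + zeval env b
  | ZOpp a => - zeval env a
  | ZZero => 0
  end.

Fixpoint zcoef (e : zexp) (i : nat) : int :=
  match e with
  | ZVar j => (i == j)%:Z
  | ZAdd a b => zcoef a i + zcoef b i
  | ZOpp a => - zcoef a i
  | ZZero => 0
  end.

Lemma zevalE (V : zmodType) (env : seq V) e :
  zeval env e = \sum_(i < size env) nth 0 env i *~ zcoef e i.
Proof.
elim: e => [j|a IHa b IHb|a IHa|] /=.
- have [js|sj] := ltnP j (size env).
    rewrite (bigD1 (Ordinal js)) //= eqxx big1 ?addr0 // => i ne.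
    rewrite (_ : (i == j :> nat) = false) //.
    by apply/negbTE; apply: contra ne => /eqP e; apply/eqP/val_inj.
  rewrite nth_default // big1 // => i _.
  by rewrite ltn_eqF // (leq_trans (ltn_ord i)).
- by rewrite IHa IHb -big_split; apply: eq_bigr => i _; rewrite mulrzDr.
- by rewrite IHa -sumrN; apply: eq_bigr => i _; rewrite mulrNz.
- by rewrite big1.
Qed.

(** Both sides are integer combinations of the atoms in [env]; [zmod] reifies an equation and leaves
    the comparison of coefficients to computation. *)
Lemma zeval_eq (V : zmodType) (env : seq V) e1 e2 :
  all (fun i => zcoef e1 i == zcoef e2 i) (iota 0 (size env)) ->
  zeval env e1 = zeval env e2.
Proof.
move=> /allP h; rewrite !zevalE; apply: eq_bigr => i _.
have hi : val i \in iota 0 (size env) by rewrite mem_iota ltn_ord.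
by rewrite (eqP (h _ hi)).
Qed.

Ltac zindex x env :=
  lazymatch env with
  | ?y :: ?l =>
    match goal with
    | _ => let _ := match goal with _ => unify x y end in constr:(O)
    | _ => let k := zindex x l in constr:(S k)
    end
  end.
Ltac zmem x env :=
  lazymatch env with
  | nil => constr:(false)
  | ?y :: ?l =>
    match goal with
    | _ => let _ := match goal with _ => unify x y end in constr:(true)
    | _ => zmem x l
    end
  end.
Ltac zvars t env :=
  lazymatch t with
  | (?a + ?b)%R => let e := zvars a env in zvars b e
  | (- ?a)%R => zvars a env
  | 0%R => env
  | _ => let m := zmem t env in
         lazymatch m with true => env | false => constr:(t :: env) end
  end.
Ltac zreify t env :=
  lazymatch t with
  | (?a + ?b)%R => let x := zreify a env in let y := zreify b env in constr:(ZAdd x y)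
  | (- ?a)%R => let x := zreify a env in constr:(ZOpp x)
  | 0%R => constr:(ZZero)
  | _ => let i := zindex t env in constr:(ZVar i)
  end.
Ltac zmod :=
  lazymatch goal with
  | |- @eq ?T ?x ?y =>
    let env0 := zvars x (@nil T) in let env := zvars y env0 in
    let a := zreify x env in let b := zreify y env in
    apply: (@zeval_eq _ env a b); vm_compute; reflexivity
  end.

(** * Koszul cochains and contractions *)

Record smod (A : comNzRingType) := Smod {
  scar :> lmodType rat;
  sact : A -> scar -> scar;
  sactDl : forall a b v, sact (a + b) v = sact a v + sact b v;
  sact_linear : forall a, linear (sact a);
  sact1 : forall v, sact 1 v = v;
  sactM : forall a b v, sact (a * b) v = sact a (sact b v)
}.
HB.instance Definition _ A (M : smod A) a :=
  GRing.isLinear.Build rat M M _ (@sact A M a) (@sact_linear A M a).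
Arguments sact {A s}.

Section SmodTheory.
Variables (A : comNzRingType) (M : smod A).
Implicit Types (a b : A) (v : M).

Lemma sact0l v : sact 0 v = 0.
Proof. by apply: (addrI (sact 0 v)); rewrite -sactDl !addr0. Qed.
Lemma sactNl a v : sact (- a) v = - sact a v.
Proof. by apply/eqP; rewrite eq_sym eqr_oppLR -addr_eq0 -sactDl subrr sact0l. Qed.
Lemma sactC a b v : sact a (sact b v) = sact b (sact a v).
Proof. by rewrite -!sactM mulrC. Qed.
Lemma sact_suml I (s : seq I) (F : I -> A) v :
  sact (\sum_(i <- s) F i) v = \sum_(i <- s) sact (F i) v.
Proof.
elim: s => [|i s IH]; first by rewrite !big_nil sact0l.
by rewrite !big_cons sactDl IH.
Qed.

Section Span.
Variables (g : nat -> A) (r : nat).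
Local Notation J := (idspan (@sact A M) g r).
Lemma span0 : J 0.
Proof. by exists (fun=> 0); rewrite big1 // => i _; rewrite linear0. Qed.
Lemma spanD u v : J u -> J v -> J (u + v).
Proof.
move=> [a ->] [b ->]; exists (fun k => a k + b k); rewrite -big_split.
by apply: eq_bigr => i _; rewrite linearD.
Qed.
Lemma spanN u : J u -> J (- u).
Proof.
move=> [a ->]; exists (fun k => - a k); rewrite -sumrN.
by apply: eq_bigr => i _; rewrite linearN.
Qed.
Lemma spanB u v : J u -> J v -> J (u - v).
Proof. by move=> hu hv; apply: spanD => //; apply: spanN. Qed.
End Span.

Lemma span_recr g r v : idspan (@sact A M) g r.+1 v <->
  exists j w, idspan (@sact A M) g r j /\ v = j + sact (g r) w.
Proof.
split=> [[w ->]|[j [w [[x ->] ->]]]].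
  exists (\sum_(k < r) sact (g k) (w k)), (w r); split; first by exists w.
  by rewrite big_ord_recr.
exists (fun k => if (k < r)%N then x k else w); rewrite big_ord_recr /= ltnn.
by congr (_ + _); apply: eq_bigr => k _; rewrite ltn_ord.
Qed.

Lemma span_recr1 g r v : idspan (@sact A M) g r v -> idspan (@sact A M) g r.+1 v.
Proof. by move=> h; apply/span_recr; exists v, 0; rewrite linear0 addr0. Qed.
Lemma span_recr2 g r v : idspan (@sact A M) g r.+1 (sact (g r) v).
Proof. by apply/span_recr; exists 0, v; rewrite add0r; split=> //; apply: span0. Qed.
End SmodTheory.

Lemma span_map (A : comNzRingType) (M N : smod A) (h : {linear M -> N}) g r v :
  (forall a v, h (sact a v) = sact a (h v)) ->
  idspan (@sact A M) g r v -> idspan (@sact A N) g r (h v).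
Proof.
move=> hA [w ->]; exists (fun k => h (w k)); rewrite linear_sum.
by apply: eq_bigr => k _; rewrite hA.
Qed.

Definition sregular (A : comNzRingType) (g : nat -> A) n (M : smod A) :=
  forall k (v : M), (k < n)%N -> idspan (@sact A M) g k (sact (g k) v) ->
    idspan (@sact A M) g k v.

(** If every cocycle of [d] is cohomologous to some [top z], then modulo the
    regular sequence [p_0, ..., p_(r-1)] the cohomology of [d] is free on the
    classes [top z] over the exterior operators [iota_0, ..., iota_(r-1)]. *)
Section ExteriorFree.
Variables (A : comNzRingType) (M N : smod A) (n : nat).
Variables (d : {linear N -> N}) (iota : nat -> {linear N -> N}).
Variables (top : {linear M -> N}) (p : nat -> A).
Hypothesis dA : forall a c, d (sact a c) = sact a (d c).
Hypothesis iotaA : forall s a c, iota s (sact a c) = sact a (iota s c).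
Hypothesis d2 : forall c, d (d c) = 0.
Hypothesis diota : forall s c, (s < n)%N ->
  d (iota s c) + iota s (d c) = sact (p s) c.
Hypothesis dtop : forall z, d (top z) = 0.

(** The sum over bit sequences [b] of length [r] of the composite of the selected [iota_s], applied
    to [top (z b)]. The head of [b] decides on the outermost operator, [iota_(r-1)]. *)
Fixpoint kI (r : nat) (z : bitseq -> M) : N :=
  if r is r'.+1 then
    kI r' (fun b => z (false :: b)) + iota r' (kI r' (fun b => z (true :: b)))
  else top (z [::]).

Local Notation J := (idspan (@sact A N) p).

Let Jd r c : J r c -> J r (d c). Proof. exact: span_map. Qed.
Let Jiota s r c : J r c -> J r (iota s c). Proof. exact: span_map. Qed.
Let diotaE s c : (s < n)%N -> d (iota s c) = sact (p s) c - iota s (d c).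
Proof. by move=> sn; rewrite -(diota c sn) addrK. Qed.

Lemma d_kI r z : (r <= n)%N -> J r (d (kI r z)).
Proof.
elim: r z => [|r IH] z rn /=; first by rewrite dtop; apply: span0.
rewrite linearD diotaE //; apply: spanD; first exact/span_recr1/IH/ltnW.
by apply: spanB; [apply: span_recr2 | apply/Jiota/span_recr1/IH/ltnW].
Qed.

Lemma kI_exact r z : (r <= n)%N ->
  (forall b, size b = r -> exists u, top (z b) = d u) ->
  exists u, J r (kI r z - d u).
Proof.
elim: r z => [|r IH] z rn hz /=.
  by have [u ->] := hz [::] erefl; exists u; rewrite subrr; apply: span0.
have [|u1 h1] := IH (fun b => z (false :: b)) (ltnW rn).
  by move=> b sb; apply: hz; rewrite /= sb.
have [|u2 h2] := IH (fun b => z (true :: b)) (ltnW rn).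
  by move=> b sb; apply: hz; rewrite /= sb.
(* The sign comes from [iota_r (d u2) = p_r u2 - d (iota_r u2)]. *)
exists (u1 - iota r u2); move: h1 h2; set x := kI _ _; set y := kI _ _ => h1 h2.
have -> : x + iota r y - d (u1 - iota r u2) =
    (x - d u1) + iota r (y - d u2) + sact (p r) u2.
  by rewrite !(linearB d, linearB (iota r)) -(diota u2 rn) /=; zmod.
apply: spanD; last exact: span_recr2.
by apply/span_recr1/spanD => //; apply: Jiota.
Qed.

Hypothesis reg : sregular p n N.
Hypothesis base : forall c, d c = 0 -> exists z u, c = top z + d u.

(** As [p_r] is regular and null-homotopic, the long exact sequence of multiplication by [p_r]
    breaks into short ones. A cochain with [d c = p_r v] modulo [J r] goes to the class of [v], of
    which [iota_r v] is a lift; subtracting it leaves a cocycle modulo [J r]. *)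
Lemma kI_surj r c : (r <= n)%N -> J r (d c) -> exists z u, J r (c - (kI r z + d u)).
Proof.
elim: r c => [|r IH] c rn /=.
  move=> [w]; rewrite big_ord0 => /base [z [u ->]]; exists (fun=> z), u.
  by rewrite subrr; apply: span0.
move=> /span_recr [j [v [hj dc]]].
have dv : J r (d v).
  apply: (reg rn); rewrite -dA.
  have -> : d (sact (p r) v) = - d j.
    by apply/eqP; rewrite -addr_eq0 addrC -linearD -dc d2.
  by apply/spanN/Jd.
have [z2 [w h2]] := IH v (ltnW rn) dv.
have [|z1 [w' h1]] := IH (c - iota r v) (ltnW rn).
  rewrite linearB dc diotaE //.
  have -> : j + sact (p r) v - (sact (p r) v - iota r (d v)) = j + iota r (d v) by zmod.
  by apply: spanD => //; apply: Jiota.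
exists (fun b => if head false b then z2 (behead b) else z1 (behead b)), (w' - iota r w).
rewrite /=; move: h1 h2; set x := kI _ _; set y := kI _ _ => h1 h2.
have -> : c - (x + iota r y + d (w' - iota r w)) =
   (c - iota r v - (x + d w')) + iota r (v - (y + d w)) + sact (p r) w.
  by rewrite !(linearB d, linearD d, linearB (iota r), linearD (iota r), linearN d, linearN (iota r)) -(diota w rn) /=; zmod.
apply: spanD; last exact: span_recr2.
by apply/span_recr1/spanD => //; apply: Jiota.
Qed.

Lemma kI_inj r z u : (r <= n)%N -> J r (kI r z - d u) ->
  forall b, size b = r -> exists u, top (z b) = d u.
Proof.
elim: r z u => [|r IH] z u rn /=.
  move=> [w]; rewrite big_ord0 => /eqP; rewrite subr_eq0 => /eqP h b /size0nil ->.
  by exists u.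
move=> /span_recr [j [v [hj]]].
have hx := d_kI (fun b => z (false :: b)) (ltnW rn).
have hy := d_kI (fun b => z (true :: b)) (ltnW rn).
have IH1 := IH (fun b => z (false :: b)) _ (ltnW rn).
have IH2 := IH (fun b => z (true :: b)) _ (ltnW rn).
have ex2 := kI_exact (z := fun b => z (true :: b)) (ltnW rn).
move: hx hy IH1 IH2 ex2; set x := kI _ _; set y := kI _ _ => hx hy IH1 IH2 ex2 E.
(* Applying [d] to [E] and cancelling [p_r] shows that the part under [iota_r] is exact modulo
   [J r]. *)
have yv : J r (y - d v).
  apply: (reg rn).
  have -> : sact (p r) (y - d v) = d j - d x + iota r (d y).
    have := congr1 d E; rewrite !(linearB d, linearD d, linearB (iota r), linearD (iota r), linearN d, linearN (iota r)) d2 diotaE // dA => E'.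
    have -> : d j = d j + sact (p r) (d v) - sact (p r) (d v) by zmod.
    by rewrite -E' (linearB (@sact A N (p r))) /=; zmod.
  by apply: spanD; [apply: spanB => //; apply: Jd | apply: Jiota].
have h2 := IH2 _ yv; have [u2 hu2] := ex2 h2.
(* Once [y] is replaced by a coboundary, [x] differs from a coboundary by [p_r v'] modulo [J r].
   Here [d v'] lies in [J r], so [p_r v' = d (iota_r v') + iota_r (d v')] is itself exact modulo
   [J r]. *)
have h1 : forall b, size b = r -> exists u, top (z (false :: b)) = d u.
  pose j' := j - iota r (y - d u2); pose v' := v - u2.
  have hj' : J r j' by apply: spanB => //; apply: Jiota.
  have E' : x - d (u + iota r u2) = j' + sact (p r) v'.
    have Ex : x = j + sact (p r) v + d u - iota r y.
      by rewrite -E; zmod.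
    by rewrite /j' /v' (linearB (@sact A N (p r))) /= !(linearB d, linearD d, linearB (iota r), linearD (iota r), linearN d, linearN (iota r)) -(diota u2 rn) Ex; zmod.
  have dv' : J r (d v').
    apply: (reg rn); rewrite -dA.
    have -> : d (sact (p r) v') = d x - d j'.
      have := congr1 d E'; rewrite (linearB d) d2 subr0 (linearD d) => ->.
      by rewrite addrC addKr.
    by apply: spanB => //; apply: Jd.
  apply: (IH1 (u + iota r u2 + iota r v')).
  have -> : x - d (u + iota r u2 + iota r v') = j' + iota r (d v').
    rewrite (linearD d) opprD addrA E' -(diota v' rn); zmod.
  by apply: spanD => //; apply: Jiota.
by case=> [//|[] b] /= [sb]; [apply: h2 | apply: h1].
Qed.
End ExteriorFree.

Lemma sum_pair (U V : zmodType) I (s : seq I) (F : I -> U) (G : I -> V) :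
  \sum_(i <- s) ((F i, G i) : U * V) = (\sum_(i <- s) F i, \sum_(i <- s) G i).
Proof. by elim: s => [|i s IH]; rewrite ?big_nil // !big_cons IH. Qed.

Section ProductModule.
Variables (A : comNzRingType) (M N : smod A).

Definition sprod_act (a : A) (c : M * N) : M * N := (sact a c.1, sact a c.2).
Fact sprod_actDl a b v : sprod_act (a + b) v = sprod_act a v + sprod_act b v.
Proof. by rewrite /sprod_act !sactDl. Qed.
Fact sprod_act_linear a : linear (sprod_act a).
Proof. by move=> k u v; rewrite /sprod_act /= !linearP. Qed.
Fact sprod_act1 v : sprod_act 1 v = v.
Proof. by case: v => u v; rewrite /sprod_act !sact1. Qed.
Fact sprod_actM a b v : sprod_act (a * b) v = sprod_act a (sprod_act b v).
Proof. by rewrite /sprod_act !sactM. Qed.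

Definition sprod : smod A :=
  @Smod A (M * N)%type sprod_act sprod_actDl sprod_act_linear sprod_act1 sprod_actM.

Lemma span_prod g r (c : sprod) : idspan (@sact A sprod) g r c <->
  idspan (@sact A M) g r c.1 /\ idspan (@sact A N) g r c.2.
Proof.
case: c => c1 c2; split=> /= [[w]|[[w1 ->] [w2 ->]]].
  rewrite [X in _ = X](_ : _ =
    (\sum_(k < r) sact (g k) (w k).1, \sum_(k < r) sact (g k) (w k).2)).
    by case=> -> ->; split; [exists (fun k => (w k).1) | exists (fun k => (w k).2)].
  by rewrite -sum_pair.
by exists (fun k => (w1 k, w2 k)); rewrite -sum_pair.
Qed.

Lemma sregular_prod g n : sregular g n M -> sregular g n N -> sregular g n sprod.
Proof.
move=> hM hN k [u v] kn /span_prod [h1 h2]; apply/span_prod; split.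
  exact: hM h1.
exact: hN h2.
Qed.
End ProductModule.

(** * The Koszul cochain complex of a sequence *)

Section Koszul.
Variables (A : comNzRingType) (M : smod A).

Fixpoint kos (r : nat) : smod A := if r is r'.+1 then sprod (kos r') (kos r') else M.

Lemma sregular_kos g n r : sregular g n M -> sregular g n (kos r).
Proof. by move=> h; elim: r => //= r IH; apply: sregular_prod. Qed.

Variable f : nat -> A.

(** The Koszul cochain complex of [f_0, ..., f_(r-1)] on [M]; the second factor
    of [kos r.+1 = kos r * kos r] holds the multiples of the [r]-th exterior
    generator. *)
Fixpoint kd_fun (r : nat) : kos r -> kos r :=
  match r return kos r -> kos r with
  | 0 => fun=> 0
  | r'.+1 => fun c => (kd_fun c.1, sact (f r') c.1 - kd_fun c.2)
  end.

Fact kd_linear r : linear (@kd_fun r).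
Proof.
elim: r => [|r IH] a u v /=; first by rewrite scaler0 addr0.
congr (_, _); first exact: IH.
by rewrite IH linearP /= scalerBr opprD addrACA.
Qed.
HB.instance Definition _ r := GRing.isLinear.Build rat (kos r) (kos r) _ (@kd_fun r) (@kd_linear r).
Definition kd r : {linear kos r -> kos r} := @kd_fun r.

Lemma kdS r (c : kos r.+1) : kd r.+1 c = (kd r c.1, sact (f r) c.1 - kd r c.2).
Proof. by []. Qed.
Lemma kosactS r a (c : kos r.+1) : sact a c = (sact a c.1, sact a c.2) :> kos r.+1.
Proof. by []. Qed.

Lemma kd_act r a c : kd r (sact a c) = sact a (kd r c).
Proof.
elim: r c => [|r IH] c; first by rewrite [RHS]linear0.
rewrite kdS !kosactS /= !IH; congr (_, _).
by rewrite (linearB (sact a)) sactC.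
Qed.

Lemma kd2 r c : kd r (kd r c) = 0.
Proof.
elim: r c => [|r IH] c //; rewrite kdS /= IH; congr (_, _).
by rewrite -kd_act (linearB (kd r)) IH subr0 subrr.
Qed.

(** Contraction with the vector [v]; the sign in the second component comes from passing the last
    exterior generator. *)
Fixpoint kiota_fun (v : nat -> A) (r : nat) : kos r -> kos r :=
  match r return kos r -> kos r with
  | 0 => fun=> 0
  | r'.+1 => fun c => (kiota_fun v c.1 + sact (v r') c.2, - kiota_fun v c.2)
  end.
Fact kiota_linear v r : linear (@kiota_fun v r).
Proof.
elim: r => [|r IH] a u w /=; first by rewrite scaler0 addr0.
congr (_, _); last by rewrite /= IH opprD -scalerN.
by rewrite IH linearP /= scalerDr addrACA.
Qed.
HB.instance Definition _ v r :=
  GRing.isLinear.Build rat (kos r) (kos r) _ (@kiota_fun v r) (@kiota_linear v r).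
Definition kiota v r : {linear kos r -> kos r} := @kiota_fun v r.

Lemma kiotaS v r (c : kos r.+1) :
  kiota v r.+1 c = (kiota v r c.1 + sact (v r) c.2, - kiota v r c.2).
Proof. by []. Qed.

Lemma kiota_act v r a c : kiota v r (sact a c) = sact a (kiota v r c).
Proof.
elim: r c => [|r IH] c; first by rewrite [RHS]linear0.
rewrite kiotaS !kosactS /= !IH; congr (_, _).
  by rewrite (linearD (sact a)) sactC.
by rewrite (linearN (sact a)).
Qed.

(** The Cartan formula, source of the homotopies for the [p_s]. *)
Lemma kd_kiota v r c : kd r (kiota v r c) + kiota v r (kd r c) =
  sact (\sum_(k < r) v k * f k) c.
Proof.
elim: r c => [|r IH] c; first by rewrite big_ord0 sact0l [LHS]addr0.
rewrite big_ord_recr kdS !kiotaS kosactS !kdS; congr (_, _).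
  rewrite /= sactDl -IH (linearD (kd r)) kd_act sactM (linearB (sact (v r))) /=.
  by zmod.
rewrite /= sactDl -IH (linearB (kiota v r)) (linearD (sact (f r))) !(linearN (kd r)).
by rewrite kiota_act sactM sactC /=; zmod.
Qed.

Fixpoint ktop_fun (r : nat) : M -> kos r :=
  match r return M -> kos r with
  | 0 => fun z => z
  | r'.+1 => fun z => (0, ktop_fun r' z)
  end.
Fact ktop_linear r : linear (@ktop_fun r).
Proof.
elim: r => [|r IH] a u v //=; congr (_, _); last exact: IH.
by rewrite /= scaler0 addr0.
Qed.
HB.instance Definition _ r :=
  GRing.isLinear.Build rat M (kos r) _ (@ktop_fun r) (@ktop_linear r).
Definition ktop r : {linear M -> kos r} := @ktop_fun r.

Lemma kd_top r z : kd r (ktop r z) = 0.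
Proof.
elim: r => [|r IH] //; rewrite kdS /=; congr (_, _); first by rewrite (linear0 (kd r)).
by rewrite [kd_fun _]IH linear0 subr0.
Qed.

Lemma ktop_act r a z : ktop r (sact a z) = sact a (ktop r z).
Proof.
elim: r => [|r IH] //; rewrite kosactS /=; congr (_, _); last exact: IH.
by rewrite linear0.
Qed.

Fixpoint kbot (r : nat) : kos r -> M :=
  match r return kos r -> M with
  | 0 => fun c => c
  | r'.+1 => fun c => kbot c.2
  end.
Lemma kbotK r z : kbot (ktop r z) = z.
Proof. by elim: r => //= r IH. Qed.
Lemma kbotB r c c' : @kbot r (c - c') = kbot c - kbot c'.
Proof. by elim: r c c' => //= r IH c c'; rewrite -IH. Qed.
Lemma kbot_act r a c : @kbot r (sact a c) = sact a (kbot c).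
Proof. by elim: r c => //= r IH c; rewrite -IH. Qed.

(** Identifies the top cohomology with [M / (f) M]: the last component of a coboundary is a
    combination of the [f_k], with signs absorbed by [spanN]. *)
Lemma ktop_exact r z : (exists u, ktop r z = kd r u) <-> idspan (@sact A M) f r z.
Proof.
split=> [[u E]|].
  rewrite -(kbotK r z) E; elim: r u {z E} => [|r IH] u; first exact: span0.
  rewrite kdS /= kbotB kbot_act addrC; apply/span_recr.
  by exists (- kbot (kd r u.2)), (kbot u.1); split=> //; apply: spanN.
elim: r z => [|r IH] z.
  by move=> [w ->]; exists 0; rewrite big_ord0 linear0.
move=> /span_recr [j [w [/IH [u E] ->]]]; exists (ktop r w, - u).
rewrite kdS kd_top (linearN (kd r)) opprK -E -ktop_act addrC.
by rewrite -(linearD (ktop r)).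
Qed.

Lemma kos_acyclic n r c : (r <= n)%N -> sregular f n M -> kd r c = 0 ->
  exists z u, c = ktop r z + kd r u.
Proof.
move=> rn reg; elim: r c rn => [|r IH] c rn; first by exists c, 0; rewrite addr0.
move=> E; have E1 : kd r c.1 = 0 := congr1 fst E.
have E2 : sact (f r) c.1 - kd r c.2 = 0 := congr1 snd E.
have {E1} [z [u E1]] := IH _ (ltnW rn) E1.
(* The second component of the cocycle condition makes the top class of [f_r z] exact; regularity
   cancels [f_r], so the top class of [z], and with it [c.1], is a coboundary. *)
have hz : idspan (@sact A M) f r z.
  apply: (reg _ _ rn); apply/ktop_exact.
  exists (c.2 - sact (f r) u); move/eqP: E2; rewrite subr_eq0 => /eqP E2.
  by rewrite ktop_act (linearB (kd r)) -E2 E1 (linearD (sact (f r))) kd_act addrK.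
have [u' Eu] := (ktop_exact r z).2 hz.
have [|z2 [u2 {}E]] := IH (c.2 - sact (f r) (u' + u)) (ltnW rn).
  rewrite (linearB (kd r)) kd_act (linearD (kd r)) -Eu -E1.
  by apply/eqP; rewrite -opprB oppr_eq0 E2.
exists z2, (u' + u, - u2); rewrite kdS [(_, _).1]/= [(_, _).2]/= (linearD (kd r)) -Eu -E1.
rewrite (linearN (kd r)) opprK [c]surjective_pairing; congr (_, _).
  by rewrite add0r.
move/eqP: E; rewrite subr_eq => /eqP ->.
by rewrite /ktop /=; zmod.
Qed.
End Koszul.

Section KoszulMap.
Variables (A : comNzRingType) (M N : smod A) (h : {linear M -> N}).

Fixpoint kmap_fun (r : nat) : kos M r -> kos N r :=
  match r return kos M r -> kos N r with
  | 0 => h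
  | r'.+1 => fun c => (kmap_fun c.1, kmap_fun c.2)
  end.
Fact kmap_linear r : linear (@kmap_fun r).
Proof.
elim: r => [|r IH] a u v /=; first exact: linearP.
by rewrite !IH.
Qed.
HB.instance Definition _ r :=
  GRing.isLinear.Build rat (kos M r) (kos N r) _ (@kmap_fun r) (@kmap_linear r).
Definition kmap r : {linear kos M r -> kos N r} := @kmap_fun r.

Hypothesis hA : forall a v, h (sact a v) = sact a (h v).

Lemma kmap_act r a c : kmap r (sact a c) = sact a (kmap r c).
Proof. by elim: r c => [|r IH] c; [apply: hA | rewrite !kosactS /= -!IH]. Qed.

Lemma kmap_kd f r c : kmap r (kd M f r c) = kd N f r (kmap r c).
Proof.
elim: r c => [|r IH] c; first exact: linear0.
rewrite !kdS /= -[kmap_fun _]/(kmap r _) IH; congr (_, _).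
by rewrite -[kmap_fun _]/(kmap r _) (linearB (kmap r)) IH kmap_act.
Qed.

Lemma kmap_kiota v r c : kmap r (kiota M v r c) = kiota N v r (kmap r c).
Proof.
elim: r c => [|r IH] c; first exact: linear0.
rewrite !kiotaS /= -[kmap_fun _]/(kmap r _) (linearD (kmap r)) IH kmap_act; congr (_, _).
by rewrite -[kmap_fun _]/(kmap r _) (linearN (kmap r)) IH.
Qed.

Lemma kmap_top r z : kmap r (ktop M r z) = ktop N r (h z).
Proof.
elim: r => [|r IH] //=; congr (_, _); first exact: (linear0 (kmap r)).
exact: IH.
Qed.

Lemma kmap_kI n (v : nat -> nat -> A) r z :
  kmap n (kI (fun s => kiota M (v s) n) (ktop M n) r z) =
  kI (fun s => kiota N (v s) n) (ktop N n) r (h \o z).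
Proof.
elim: r z => [|r IH] z /=; first exact: kmap_top.
by rewrite (linearD (kmap n)) kmap_kiota !IH.
Qed.

Lemma kmap_surj r : (forall y, exists x, h x = y) -> forall c, exists c', kmap r c' = c.
Proof.
move=> hs; elim: r => [|r IH] //= [c1 c2].
have [x1 <-] := IH c1; have [x2 <-] := IH c2.
by exists (x1, x2).
Qed.

Lemma kmap_ker g m r : (forall x, h x = 0 -> idspan (@sact A M) g m x) ->
  forall c, kmap r c = 0 -> idspan (@sact A (kos M r)) g m c.
Proof.
move=> hk; elim: r => [|r IH] //= c [h1 h2].
by apply/span_prod; split; apply: IH.
Qed.
End KoszulMap.

(** * Graded bimodules *)

Lemma linear_fun0 (U V : lmodType rat) (p : U -> V) : linear p -> p 0 = 0.
Proof. by move=> /(_ (-1) 0 0); rewrite scaler0 addr0 scaleN1r addNr. Qed.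

Section BimoduleAction.
Variable n : nat.
Local Notation R := {mpoly rat[n]}.
Local Notation Re := {mpoly rat[n + n]}.

Section Action.
Variable M : gbimod n.

Definition lpart (m : 'X_{1..n + n}) : 'X_{1..n} := [multinom m (lshift n i) | i < n].
Definition rpart (m : 'X_{1..n + n}) : 'X_{1..n} := [multinom m (rshift n i) | i < n].

Lemma lpartD m m' : lpart (m + m') = (lpart m + lpart m')%MM.
Proof. by apply/mnmP => i; rewrite !(mnmE, mnmDE). Qed.
Lemma rpartD m m' : rpart (m + m') = (rpart m + rpart m')%MM.
Proof. by apply/mnmP => i; rewrite !(mnmE, mnmDE). Qed.
Lemma lpart0 : lpart 0 = 0%MM.
Proof. by apply/mnmP => i; rewrite !(mnmE, mnm0E). Qed.
Lemma rpart0 : rpart 0 = 0%MM.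
Proof. by apply/mnmP => i; rewrite !(mnmE, mnm0E). Qed.
Lemma mdeg_parts m : mdeg m = (mdeg (lpart m) + mdeg (rpart m))%N.
Proof.
rewrite !mdegE big_split_ord /=; congr (_ + _)%N; apply: eq_bigr => i _; exact/esym/mnmE.
Qed.

Definition monact (m : 'X_{1..n + n}) (v : M) : M :=
  lact 'X_[lpart m] (ract v 'X_[rpart m]).
(** [Re] is a polynomial model of R^e: the first [n] variables act from the left, the last [n] from
    the right. *)
Definition gact (p : Re) (v : M) : M := \sum_(m <- msupp p) p@_m *: monact m v.

Let HM := gbimodP M.

Lemma lact0l (v : M) : lact 0 v = 0.
Proof. exact: (linear_fun0 (lact_linear_l HM v)). Qed.
Lemma ract0r (v : M) : ract v 0 = 0.
Proof. exact: (linear_fun0 (ract_linear_r HM v)). Qed.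
Lemma lact_sum I (s : seq I) (f : R) (F : I -> M) :
  lact f (\sum_(i <- s) F i) = \sum_(i <- s) lact f (F i).
Proof. by apply: (linear_big (p := lact f)); apply: lact_linear_r HM f. Qed.
Lemma ract_sum I (s : seq I) (f : R) (F : I -> M) :
  ract (\sum_(i <- s) F i) f = \sum_(i <- s) ract (F i) f.
Proof. by apply: (linear_big (p := fun v => ract v f)); apply: ract_linear_l HM f. Qed.
Lemma lactZl c f (v : M) : lact (c *: f) v = c *: lact f v.
Proof. by have := lact_linear_l HM v c f 0; rewrite !addr0 lact0l addr0. Qed.
Lemma ractZr c f (v : M) : ract v (c *: f) = c *: ract v f.
Proof. by have := ract_linear_r HM v c f 0; rewrite !addr0 ract0r addr0. Qed.
Lemma lactDl f g (v : M) : lact (f + g) v = lact f v + lact g v.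
Proof. by have := lact_linear_l HM v 1 f g; rewrite !scale1r. Qed.
Lemma ractDr f g (v : M) : ract v (f + g) = ract v f + ract v g.
Proof. by have := ract_linear_r HM v 1 f g; rewrite !scale1r. Qed.

Lemma monact_linear m : linear (monact m).
Proof. by move=> c u v; rewrite /monact (ract_linear_l HM) (lact_linear_r HM). Qed.
Lemma monactD m m' v : monact (m + m') v = monact m (monact m' v).
Proof.
rewrite /monact lpartD rpartD !mpolyXD (lactM HM).
by rewrite ['X_[rpart m] * _]mulrC (ractM HM) -(lractA HM).
Qed.
Lemma monact0 v : monact 0 v = v.
Proof. by rewrite /monact lpart0 rpart0 mpolyX0 (ract1 HM) (lact1 HM). Qed.

Lemma gact_supp s p v : uniq s -> {subset msupp p <= s} ->
  gact p v = \sum_(m <- s) p@_m *: monact m v.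
Proof.
move=> us hs; rewrite (bigID (mem (msupp p))) /= [X in _ + X]big1 ?addr0; last first.
  by move=> m hm; rewrite memN_msupp_eq0 ?scale0r.
rewrite -big_filter; apply: perm_big; apply: uniq_perm; rewrite ?msupp_uniq ?filter_uniq //.
move=> m; rewrite mem_filter.
by case: (boolP (m \in msupp p)) => //= /hs ->.
Qed.

Lemma gactP c p q v : gact (c *: p + q) v = c *: gact p v + gact q v.
Proof.
pose s := undup (msupp p ++ msupp q ++ msupp (c *: p + q)).
have us : uniq s by apply: undup_uniq.
rewrite !(@gact_supp s) //; try by move=> m hm; rewrite mem_undup !mem_cat hm ?orbT.
rewrite scaler_sumr -big_split; apply: eq_bigr => m _ /=.
by rewrite mcoeffD mcoeffZ scalerDl scalerA.
Qed.
Lemma gact0 v : gact 0 v = 0. Proof. by rewrite /gact msupp0 big_nil. Qed.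
Lemma gactDl p q v : gact (p + q) v = gact p v + gact q v.
Proof. by have := gactP 1 p q v; rewrite !scale1r. Qed.
Lemma gactZl c p v : gact (c *: p) v = c *: gact p v.
Proof. by rewrite -[c *: p]addr0 gactP gact0 addr0. Qed.
Lemma gactX m v : gact 'X_[m] v = monact m v.
Proof. by rewrite /gact msuppX big_seq1 mcoeffX eqxx scale1r. Qed.

Lemma gact_linear p : linear (gact p).
Proof.
move=> c u v; rewrite /gact scaler_sumr -big_split; apply: eq_bigr => m _ /=.
by rewrite monact_linear scalerDr !scalerA mulrC.
Qed.
Lemma gact1 v : gact 1 v = v.
Proof. by rewrite -mpolyX0 gactX monact0. Qed.
Lemma gactM p q v : gact (p * q) v = gact p (gact q v).
Proof.
elim/mpolyind: p => [|c m p _ _ IH]; first by rewrite mul0r !gact0.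
rewrite mulrDl !gactDl IH -scalerAl !gactZl; congr (_ *: _ + _).
elim/mpolyind: q {IH} => [|c' m' q _ _ IH].
  by rewrite mulr0 !gact0 (linear_fun0 (gact_linear 'X_[m])).
rewrite mulrDr !gactDl IH -scalerAr -mpolyXD !gactZl !gactX monactD.
by rewrite monact_linear.
Qed.

Definition gsmod : smod Re := @Smod Re M gact gactDl gact_linear gact1 gactM.

Lemma gact_lemb f v : gact (lemb n f) v = lact f v.
Proof.
move: f v; apply: mpoly_alg_ind => [c|i|p q hp hq|p q hp hq] v.
- rewrite lembC -alg_mpolyC gactZl gact1 -alg_mpolyC lactZl.
  by rewrite (lact1 HM).
- rewrite lembX gactX /monact.
  have -> : lpart U_(lshift n i) = U_(i)%MM.
    by apply/mnmP => j; rewrite mnmE !mnm1E eq_lshift.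
  have -> : rpart U_(lshift n i) = 0%MM.
    by apply/mnmP => j; rewrite mnmE mnm1E mnm0E eq_lrshift.
  by rewrite mpolyX0 (ract1 HM).
- by rewrite rmorphD gactDl hp hq lactDl.
- by rewrite rmorphM gactM hp hq (lactM HM).
Qed.
Lemma gact_remb f v : gact (remb n f) v = ract v f.
Proof.
move: f v; apply: mpoly_alg_ind => [c|i|p q hp hq|p q hp hq] v.
- rewrite rembC -alg_mpolyC gactZl gact1 -alg_mpolyC ractZr.
  by rewrite (ract1 HM).
- rewrite rembX gactX /monact.
  have -> : rpart U_(rshift n i) = U_(i)%MM.
    by apply/mnmP => j; rewrite mnmE !mnm1E eq_rshift.
  have -> : lpart U_(rshift n i) = 0%MM.
    by apply/mnmP => j; rewrite mnmE mnm1E mnm0E eq_rlshift.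
  by rewrite mpolyX0 (lact1 HM).
- by rewrite rmorphD gactDl hp hq ractDr.
- by rewrite rmorphM mulrC gactM hp hq (ractM HM).
Qed.

Lemma gact_deg d i p (v : M) : p \is d.-homog -> gdeg i v ->
  gdeg ((2 * d)%:Z + i) (gact p v).
Proof.
move=> hp hv; have [h0 hD] := gdeg_subspace HM ((2 * d)%:Z + i).
rewrite /gact big_seq; elim/big_ind: _ => [//|x y hx hy|m hm].
  by rewrite -[x]scale1r; apply: hD.
rewrite -[_ *: _]addr0; apply: hD => //.
have -> : (2 * d)%:Z + i = (2 * mdeg (lpart m))%:Z + (i + (2 * mdeg (rpart m))%:Z).
  have <- : mdeg m = d by exact: (dhomog_mf hp hm).
  by rewrite mdeg_parts mulnDr PoszD; zmod.
apply: (lact_deg HM); last apply: (ract_deg HM) => //.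
  by apply/poly_degE; rewrite dhomogX; apply/eqP.
by apply/poly_degE; rewrite dhomogX; apply/eqP.
Qed.
End Action.

Lemma ghom_gact (M N : gbimod n) (h : ghom M N) p v : h (gact p v) = gact p (h v).
Proof.
move: p v; apply: Re_ind => [r|r|p q hp hq|p q hp hq] v.
- by rewrite !gact_lemb; case: (ghomP h) => _ h2 _ _; apply: h2.
- by rewrite !gact_remb; case: (ghomP h) => _ _ h2 _; apply: h2.
- by rewrite !gactDl (linearD (ghom_fun h)) /= hp hq.
- by rewrite !gactM hp hq.
Qed.
End BimoduleAction.

Section Grading.
Variables (n : nat) (M : gbimod n).
Let HM := gbimodP M.

Lemma gdeg0 i : @gdeg n M i 0. Proof. exact: (gdeg_subspace HM i).1. Qed.
Lemma gdegP i c (u v : M) : gdeg i u -> gdeg i v -> gdeg i (c *: u + v).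
Proof. exact: (gdeg_subspace HM i).2. Qed.

(** Components are a function on [int] of finite support, so that two decompositions can be compared
    degree by degree and [gproj] is obtained by choice. *)
Definition is_decomp (v : M) (c : int -> M) : Prop :=
  (forall i, gdeg i (c i)) /\
  exists s : seq int, [/\ uniq s, forall i, i \notin s -> c i = 0 & v = \sum_(i <- s) c i].

Lemma decomp_supp v c : is_decomp v c -> exists s : seq int,
  forall t, uniq t -> {subset s <= t} -> v = \sum_(i <- t) c i.
Proof.
move=> [_ [s [us hs ->]]]; exists s => t ut st.
rewrite [RHS](bigID (mem s)) /= [X in _ + X]big1 ?addr0; last by move=> i /hs.
rewrite -[RHS]big_filter; apply: perm_big; apply: uniq_perm; rewrite ?filter_uniq //.
move=> i; rewrite mem_filter.
by case: (boolP (i \in s)) => //= /st ->.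
Qed.

Lemma decomp_supp0 v c : is_decomp v c -> exists s : seq int,
  forall i, i \notin s -> c i = 0.
Proof. by move=> [_ [s [_ hs _]]]; exists s. Qed.

Lemma decompP k u v a b : is_decomp u a -> is_decomp v b ->
  is_decomp (k *: u + v) (fun i => k *: a i + b i).
Proof.
move=> hu hv; have [s hs] := decomp_supp hu; have [t ht] := decomp_supp hv.
have [s' hs'] := decomp_supp0 hu; have [t' ht'] := decomp_supp0 hv.
split; first by move=> i; apply: gdegP; [apply: hu.1 | apply: hv.1].
exists (undup (s ++ t ++ s' ++ t')); split; first exact: undup_uniq.
  move=> i; rewrite mem_undup !mem_cat !negb_or => /and4P[_ _ h1 h2].
  by rewrite hs' // ht' // scaler0 addr0.
rewrite (hs (undup (s ++ t ++ s' ++ t'))) ?undup_uniq //; last first.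
  by move=> i hi; rewrite mem_undup !mem_cat hi.
rewrite (ht (undup (s ++ t ++ s' ++ t'))) ?undup_uniq //; last first.
  by move=> i hi; rewrite mem_undup !mem_cat hi orbT.
by rewrite scaler_sumr -big_split.
Qed.

Lemma decomp1 j v : gdeg j v -> is_decomp v (fun i => if i == j then v else 0).
Proof.
move=> hv; split; first by move=> i; case: eqP => [->//|_]; apply: gdeg0.
exists [:: j]; split=> // [i|]; last by rewrite big_seq1 eqxx.
by rewrite inE => /negbTE ->.
Qed.

Lemma decomp_ex v : exists c, is_decomp v c.
Proof.
have [s [c [hc ->]]] := gdeg_gen HM v.
elim: s => [|i s [b hb]]; first by rewrite big_nil; eexists; apply: (decomp1 (gdeg0 0)).
by rewrite big_cons -[c i]scale1r; eexists; apply: decompP hb; apply: decomp1 (hc i).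
Qed.

Lemma decomp_uniq v a b : is_decomp v a -> is_decomp v b -> a =1 b.
Proof.
move=> ha hb i; have := decompP (-1) hb ha; rewrite scaleN1r addNr => h.
have [hd [s [us hs s0]]] := h; apply/eqP; rewrite -subr_eq0 addrC -scaleN1r; apply/eqP.
have [si|/hs//] := boolP (i \in s).
exact: (gdeg_indep HM us hd (esym s0) si).
Qed.

Definition gproj (i : int) (v : M) : M := projT1 (cid (decomp_ex v)) i.

Lemma gproj_decomp v : is_decomp v (gproj^~ v).
Proof. exact: projT2 (cid (decomp_ex v)). Qed.
Lemma gprojE v c i : is_decomp v c -> gproj i v = c i.
Proof. by move=> h; apply: (decomp_uniq (gproj_decomp v) h). Qed.

Fact gproj_linear i : linear (gproj i).
Proof.
move=> k u v; apply: (gprojE (c := fun i => k *: gproj i u + gproj i v)).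
by apply: decompP; apply: gproj_decomp.
Qed.
HB.instance Definition _ i := GRing.isLinear.Build rat M M _ (gproj i) (gproj_linear i).

Lemma gproj_deg i v : gdeg i (gproj i v).
Proof. exact: (gproj_decomp v).1. Qed.
Lemma gproj_id i v : gdeg i v -> gproj i v = v.
Proof. by move/decomp1/gprojE => ->; rewrite eqxx. Qed.
Lemma gprojP i v : gdeg i v <-> gproj i v = v.
Proof. by split=> [/gproj_id//|<-]; apply: gproj_deg. Qed.

Lemma gproj_gact d i p v : p \is d.-homog ->
  gproj ((2 * d)%:Z + i) (gact p v) = gact p (gproj i v).
Proof.
move=> hp; rewrite (gprojE (c := fun j => gact p (gproj (j - (2 * d)%:Z) v))).
  by rewrite addrC addKr.
split=> [j|].
  have := gact_deg hp (gproj_deg (j - (2 * d)%:Z) v).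
  by rewrite addrCA subrr addr0.
have [_ [s [us hs E]]] := gproj_decomp v.
exists [seq (2 * d)%:Z + j | j <- s]; split.
- by rewrite map_inj_uniq //; apply: addrI.
- move=> j hj; rewrite hs ?(linear_fun0 (@gact_linear _ M p)) //.
  by apply: contra hj => hj; apply/mapP; eexists; first exact: hj; rewrite addrCA subrr addr0.
- rewrite big_map [in LHS]E (linear_big (@gact_linear _ M p)).
  by apply: eq_bigr => j _; rewrite addrAC subrr add0r.
Qed.
End Grading.

Lemma gproj_ghom n (M N : gbimod n) (h : ghom M N) i v :
  gproj i (h v) = h (gproj i v).
Proof.
apply: (gprojE (c := fun j => h (gproj j v))).
have [_ [s [us hs E]]] := gproj_decomp v.
split=> [j|]; first by case: (ghomP h) => _ _ _; apply; apply: gproj_deg.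
exists s; split=> // [j /hs -> |]; first by rewrite linear0.
by rewrite [in LHS]E linear_sum.
Qed.

Section FreeModule.
Variables (N m : nat).
Local Notation S := {mpoly rat[N]}.
Definition ffact (a : S) (v : {ffun 'I_m -> S}) : {ffun 'I_m -> S} := [ffun i => a * v i].
Fact ffactDl a b v : ffact (a + b) v = ffact a v + ffact b v.
Proof. by apply/ffunP => i; rewrite !ffunE mulrDl. Qed.
Fact ffact_linear a : linear (ffact a).
Proof.
move=> c u v; apply/ffunP => i; rewrite !ffunE mulrDr; congr (_ + _).
by rewrite -scalerAr.
Qed.
Fact ffact1 v : ffact 1 v = v.
Proof. by apply/ffunP => i; rewrite !ffunE mul1r. Qed.
Fact ffactM a b v : ffact (a * b) v = ffact a (ffact b v).
Proof. by apply/ffunP => i; rewrite !ffunE mulrA. Qed.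
Definition ffmod : smod S :=
  @Smod S {ffun 'I_m -> S} ffact ffactDl ffact_linear ffact1 ffactM.

Lemma span_ffmod g r (v : ffmod) :
  idspan (@sact S ffmod) g r v <-> forall i, idspan *%R g r ((v : {ffun _ -> _}) i).
Proof.
split=> [[w ->] i|].
  exists (fun k => (w k : {ffun _ -> _}) i); rewrite sum_ffunE.
  by apply: eq_bigr => k _; rewrite ffunE.
move=> /choice [w hw]; exists (fun k => [ffun i => w i k] : ffmod).
apply/ffunP => i; rewrite hw sum_ffunE.
by apply: eq_bigr => k _; rewrite !ffunE.
Qed.

Lemma sregular_ffmod g r :
  (forall k q, (k < r)%N -> idspan *%R g k (g k * q) -> idspan *%R g k q) ->
  sregular g r ffmod.
Proof.
move=> h k v kr /span_ffmod hv; apply/span_ffmod => i; apply: h kr _.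
by have := hv i; rewrite ffunE.
Qed.
End FreeModule.

Section MakeLinear.
Variables (U V : lmodType rat) (p : U -> V).
Definition mklin_fun (_ : linear p) : U -> V := p.
HB.instance Definition _ (h : linear p) := GRing.isLinear.Build rat U V _ (mklin_fun h) h.
Definition mklin (h : linear p) : {linear U -> V} := mklin_fun h.
End MakeLinear.

(** * Presenting sums of copies of B over R^e *)

Section SumsOfB.
Variable n : nat.
Local Notation R := {mpoly rat[n]}.
Local Notation Re := {mpoly rat[n + n]}.
Local Notation bt := (tens (@symr n) (@syml n)).

Definition kap (p : Re) : Bbim n := gact p (bt 1 1 : Bbim n).

Lemma kap_mul f g : kap (lemb n f * remb n g) = bt f g.
Proof.
rewrite /kap gactM gact_lemb gact_remb.
have -> : @ract n (Bbim n) (bt 1 1) g = bt 1 g by rewrite /= BractE mul1r.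
by rewrite /= BlactE mulr1.
Qed.

Lemma kap_linear : linear kap.
Proof. by move=> c p q; apply: gactP. Qed.
HB.instance Definition _ := GRing.isLinear.Build rat Re (Bbim n) _ kap kap_linear.

Lemma kap_surj (t : Bbim n) : exists p, kap p = t.
Proof.
elim/tensor_ind: t => [|c f g t [p <-]]; first by exists 0; rewrite linear0.
by exists (c *: (lemb n f * remb n g) + p); rewrite kap_linear kap_mul.
Qed.

Lemma span_subspace : subspace (V := Re) (idspan *%R (prel n) n).
Proof.
split; first exact: ideal0.
move=> c u v hu hv; apply: idealD => //; rewrite -mul_mpolyC; exact: idealM.
Qed.
Local Notation Q := (quotsp span_subspace).
Local Notation pr := (qpi span_subspace).

Let brel (f g : R) : Q := pr (lemb n f * remb n g).

Lemma brel_bal : balanced (@symr n) (@syml n) brel.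
Proof.
split=> [g c f f'|f c g g'|f [s hs] g].
- by rewrite /brel rmorphD lembZ mulrDl -scalerAl linearP.
- by rewrite /brel rmorphD rembZ mulrDr -scalerAr linearP.
- apply/qpiP; rewrite /symr /syml !rmorphM /= mulrA mulrAC [X in _ - X]mulrAC -mulrBr.
  by apply: idealM; apply: sym_prel.
Qed.

Let brelL : {linear Bbim n -> Q} := tensor_lift brel_bal.
Let brelE f g : brelL (bt f g) = brel f g. Proof. exact: tliftE brel_bal f g. Qed.

Let mulq (p : Re) (x : Q) : Q := pr (p * qrepr x).
Let mulqE p q : mulq p (pr q) = pr (p * q).
Proof. by apply/qpiP; rewrite -mulrBr; apply: idealM; apply: qpi_repr. Qed.
Let mulq_linear p : linear (mulq p).
Proof.
move=> c x y; rewrite -(qreprK x) -(qreprK y) -linearP !mulqE mulrDr -scalerAr.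
exact: linearP.
Qed.

(** By [sym_prel], [f ⊗ g |-> f(x) g(y)] is well defined from B to [Re] modulo [prel]. It is
    [Re]-linear, so it sends [kap p] back to the class of [p]. *)
Lemma kap_ker p : kap p = 0 -> idspan *%R (prel n) n p.
Proof.
have key q t : brelL (gact q t) = mulq q (brelL t).
  move: q t; apply: Re_ind => [r|r|q1 q2 h1 h2|q1 q2 h1 h2] t.
  - rewrite gact_lemb; move: t; apply: tensor_eq => [||f g].
    + by move=> c u v; rewrite /= Blact_linear linearP.
    + by move=> c u v; rewrite linearP mulq_linear.
    + by rewrite /= BlactE !brelE mulqE /brel rmorphM mulrA.
  - rewrite gact_remb; move: t; apply: tensor_eq => [||f g].
    + by move=> c u v; rewrite /= Bract_linear linearP.
    + by move=> c u v; rewrite linearP mulq_linear.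
    + by rewrite /= BractE !brelE mulqE /brel rmorphM [remb n r * _]mulrC mulrA.
  - rewrite gactDl linearD h1 h2 /=; move: (brelL t) => x.
    by rewrite -(qreprK x) !mulqE mulrDl linearD.
  - rewrite gactM h1 h2; move: (brelL t) => x.
    by rewrite -(qreprK x) !mulqE mulrA.
move=> p0; have := key p (bt 1 1); rewrite [gact _ _]p0 linear0 brelE mulqE.
rewrite /brel !rmorph1 !mulr1 -[0 in LHS](linear0 pr) => /esym/qpiP.
by rewrite subr0.
Qed.

Definition symmetric_bim (M : gbimod n) : Prop :=
  forall s (m : M), s \is symmetric -> lact s m = ract m s.

Lemma symmetric_B : symmetric_bim (Bbim n).
Proof.
move=> s m hs; move: m; apply: tensor_eq => [||f g].
- exact: Blact_linear.
- exact: Bract_linear.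
- rewrite /= BlactE BractE mulrC [g * s]mulrC.
  exact: (tens_bal (@symr n) (@syml n) f (exist _ s hs) g).
Qed.

Lemma symmetric_sum_of_B M : sum_of_B M -> symmetric_bim M.
Proof.
move=> [I [sh [inc [gen _]]]] s m hs; have [t [b ->]] := gen m.
rewrite lact_sum ract_sum; apply: eq_bigr => i _.
case: (ghomP (inc i)) => _ h1 h2 _; rewrite -h1 -h2; congr (inc i _).
exact: symmetric_B.
Qed.

Lemma prel_act0 M : symmetric_bim M -> forall k (m : M), (k < n)%N ->
  gact (prel n k) m = 0.
Proof.
move=> hM k m kn; have [b ->] := prel_csym kn.
rewrite -[LHS]/(@sact _ (gsmod M) _ m) sact_suml big1 // => j _.
rewrite sactM [X in sact _ X](_ : _ = 0) ?linear0 //.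
rewrite sactDl sactNl /=.
by rewrite gact_lemb gact_remb hM ?subrr // csym_sym.
Qed.

(** Finitely many generators have components in finitely many summands, so these exhaust [M], and
    [kap] presents each of them. The grading shifts are ignored here; degrees are recovered later by
    homogeneous projections. *)
Lemma sum_of_B_pres M : fin_gen M -> sum_of_B M -> exists m,
  exists phi : {linear ffmod (n + n) m -> M},
  [/\ forall a v, phi (sact a v) = gact a (phi v),
      forall x, exists v, phi v = x &
      forall v, phi v = 0 -> idspan (@sact Re (ffmod (n + n) m)) (prel n) n v].
Proof.
move=> [gens hgens] [I [sh [inc [gen indep]]]].
have [s [us hs]] : exists s : seq I, uniq s /\
    forall x : M, exists b : I -> Bbim n, x = \sum_(i <- s) inc i (b i).
  (* Quantifying over all larger [t] lets the index lists of several generators be merged. *)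
  have [s hs] : exists s : seq I, forall g : M, g \in gens ->
      forall t, uniq t -> {subset s <= t} ->
      exists b : I -> Bbim n, g = \sum_(i <- t) inc i (b i).
    elim: gens {hgens} => [|g gens [s IH]]; first by exists [::].
    have [s' [b E]] := gen g; exists (s' ++ s) => g'; rewrite inE => /orP[/eqP->|hg'].
      (* [s'] may repeat an index, so its coefficients are collected. *)
      move=> t ut st; exists (fun i => \sum_(j <- s' | j == i) b j).
      have st' : {subset s' <= t} by move=> i hi; apply: st; rewrite mem_cat hi.
      have lem i : inc i (\sum_(j <- s' | j == i) b j) = \sum_(j <- s' | j == i) inc j (b j).
        rewrite linear_sum; apply: eq_bigr => j /eqP -> //.
      under eq_bigr do rewrite lem.
      rewrite E (exchange_big_dep xpredT) //= big_seq [RHS]big_seq.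
      apply: eq_bigr => j js; rewrite -big_filter (perm_big [:: j]) ?big_seq1 //.
      apply: uniq_perm; rewrite ?filter_uniq // => i; rewrite mem_filter inE eq_sym.
      by case: eqP => //= ->; apply: st'.
    by move=> t ut st; apply: IH => // i hi; apply: st; rewrite mem_cat hi orbT.
  exists (undup s); split; first exact: undup_uniq.
  move=> x; have [t [ht ->]] := hgens x.
  elim: t ht => [|[[f g] h] t IH] /=.
    by move=> _; exists (fun=> 0); rewrite big_nil big1 // => i _; rewrite linear0.
  move=> /andP[hg /IH [b E]].
  have [|b' Eg] := hs g hg (undup s) (undup_uniq s) _.
    by move=> i; rewrite mem_undup.
  exists (fun i => lact f (ract (b' i) h) + b i).
  rewrite big_cons E /= {1}Eg ract_sum lact_sum -big_split.
  apply: eq_bigr => i _; rewrite (linearD (ghom_fun (inc i))) /=; congr (_ + _).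
  by case: (ghomP (inc i)) => _ h1 h2 _; rewrite -h2 -h1.
pose m := size s; pose V := ffmod (n + n) m.
pose ph (v : V) : M := \sum_(j < m) inc (tnth (in_tuple s) j) (kap ((v : {ffun _ -> _}) j)).
have ph_lin : linear ph.
  move=> c u v; rewrite /ph scaler_sumr -big_split; apply: eq_bigr => j _.
  by rewrite !ffunE kap_linear linearP.
exists m, (mklin ph_lin).
have idx (b : I -> Bbim n) : \sum_(i <- s) inc i (b i) =
    \sum_(j < m) inc (tnth (in_tuple s) j) (b (tnth (in_tuple s) j)).
  by rewrite -[X in \sum_(i <- X) _]/(val (in_tuple s)) big_tuple.
split=> [a v|x|v] /=.
- rewrite (@linear_big _ _ (gact a)); last exact: gact_linear.
  apply: eq_bigr => j _; rewrite ffunE /kap gactM.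
  exact: ghom_gact.
- have [b ->] := hs x; rewrite idx.
  have /choice [w hw] j := kap_surj (b (tnth (in_tuple s) j)).
  by exists [ffun j => w j]; apply: eq_bigr => j _; rewrite ffunE hw.
- move=> v0; apply/span_ffmod => j; apply: kap_ker.
  (* The coordinates of [v] along [s], extended by zero to all of [I] as [indep] asks. *)
  pose b (i : I) : Bbim n :=
    if insub (index i s) is Some j then kap ((v : {ffun _ -> _}) j) else 0.
  have bE k : b (tnth (in_tuple s) k) = kap ((v : {ffun _ -> _}) k).
    rewrite /b (tnth_nth (tnth (in_tuple s) j)) index_uniq ?ltn_ord //.
    by rewrite valK.
  rewrite -bE; apply: (indep s b us); last exact: mem_tnth.
  rewrite idx -[RHS]v0; apply: eq_bigr => k _.
  by rewrite bE.
Qed.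
End SumsOfB.

(** * Koszul cohomology of sums of copies of B *)

Section ContractionsOnSumsOfB.
Variable n : nat.
Local Notation Re := {mpoly rat[n + n]}.

Definition rcoef : nat -> nat -> Re := sval (cid (prel_fdiff n)).
Lemma rcoef_homog k l : rcoef k l \is (n - k).-1.-homog.
Proof. exact: (svalP (cid (prel_fdiff n))).1. Qed.
Lemma rcoefE k : (k < n)%N -> \sum_(l < n) rcoef k l * fdiff n l = prel n k.
Proof.
move=> kn; rewrite (svalP (cid (prel_fdiff n))).2 //.
by apply: eq_bigr => l _; rewrite mulrC.
Qed.

Section OnModule.
Variable M : smod Re.
Definition sd : {linear kos M n -> kos M n} := kd M (fdiff n) n.
Definition siota (s : nat) : {linear kos M n -> kos M n} := kiota M (rcoef s) n.
Definition sI (z : bitseq -> M) : kos M n := kI siota (ktop M n) n z.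

Lemma sd_siota s c : (s < n)%N -> sd (siota s c) + siota s (sd c) = sact (prel n s) c.
Proof. by move=> sn; rewrite kd_kiota rcoefE. Qed.
Lemma siota_act s a c : siota s (sact a c) = sact a (siota s c).
Proof. exact: kiota_act. Qed.
Lemma sd_act a c : sd (sact a c) = sact a (sd c).
Proof. exact: kd_act. Qed.
Lemma sd2 c : sd (sd c) = 0.
Proof. exact: kd2. Qed.
Lemma sd_top z : sd (ktop M n z) = 0.
Proof. exact: kd_top. Qed.
End OnModule.

Section OnBimodule.
Variable M : gbimod n.
Local Notation GM := (gsmod M).
Hypothesis M_sym : symmetric_bim M.

(** On such a bimodule [prel] acts by zero, so congruences modulo [prel] become equalities. *)
Lemma span_prel0 (c : kos GM n) r : (r <= n)%N ->
  idspan (@sact Re (kos GM n)) (prel n) r c -> c = 0.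
Proof.
have act0 s k (x : kos GM s) : (k < n)%N -> sact (prel n k) x = 0.
  move=> kn; elim: s x => [|s IH] x; first exact: prel_act0.
  by rewrite kosactS !IH.
by move=> rn [w ->]; rewrite big1 // => k _; apply/act0/(leq_trans (ltn_ord k)).
Qed.

Lemma sd_sI z : sd GM (@sI GM z) = 0.
Proof.
apply: (span_prel0 (leqnn n)).
exact: (d_kI (@siota_act GM) (@sd_siota GM) (@sd_top GM) z (leqnn n)).
Qed.

Lemma sI_exact z :
  (forall b, size b = n -> idspan (@sact Re GM) (fdiff n) n (z b)) ->
  exists u, @sI GM z = sd GM u.
Proof.
move=> hz; have [|u hu] := kI_exact (@siota_act GM) (@sd_siota GM) (top := ktop GM n) (z := z) (leqnn n).
  by move=> b sb; apply/ktop_exact/hz.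
by exists u; apply/eqP; rewrite -subr_eq0; apply/eqP/(span_prel0 (leqnn n)).
Qed.
End OnBimodule.

Section OnSum.
Variable M : gbimod n.
Local Notation GM := (gsmod M).
Hypotheses (M_fg : fin_gen M) (M_sum : sum_of_B M).
Let M_sym := symmetric_sum_of_B M_sum.

Lemma ffmod_regular m : sregular (prel n) n (ffmod (n + n) m) /\
  sregular (fdiff n) n (ffmod (n + n) m).
Proof.
split; apply: sregular_ffmod => k q kn h.
  exact: (@prel_regular _ (Ordinal kn)).
exact: (@fdiff_regular _ (Ordinal kn)).
Qed.

(** The [prel s] act by zero on [M], so regularity is used on the free cover [V]. The kernel of [K]
    is the span of [prel], hence equations in the cochains on [M] are congruences modulo [prel] in
    those on [V], where [kI_surj] and [kI_inj] apply. *)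
Lemma sd_cohomology : (forall c, sd GM c = 0 -> exists z u, c = @sI GM z + sd GM u) /\
  (forall z u, @sI GM z = sd GM u ->
     forall b, size b = n -> idspan (@sact Re GM) (fdiff n) n (z b)).
Proof.
have [m [phi0 [phiA0 phi_surj phi_ker]]] := sum_of_B_pres M_fg M_sum.
set V := ffmod (n + n) m in phi0 phiA0 phi_surj phi_ker.
pose phi : {linear V -> GM} := phi0.
have phiA : forall a v, phi (sact a v) = sact a (phi v) := phiA0.
have [reg_p reg_f] := ffmod_regular m.
pose K := @kmap Re V GM phi n.
have K_sd c : K (sd V c) = sd GM (K c) by apply: kmap_kd.
have K_sI z : K (@sI V z) = @sI GM (phi \o z) by apply: kmap_kI.
have K_J c : idspan (@sact Re (kos V n)) (prel n) n c -> K c = 0.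
  move=> h; apply: (span_prel0 M_sym (leqnn n)).
  exact: (span_map (h := K) (kmap_act phiA (r := n)) h).
have K_ker c : K c = 0 -> idspan (@sact Re (kos V n)) (prel n) n c.
  exact: kmap_ker.
have K_surj c : exists c', K c' = c by apply: kmap_surj.
split=> [c|z u E].
  have [c' <-] := K_surj c; rewrite -K_sd => /K_ker h.
  have [z [u hu]] := kI_surj (@sd_act V) (@siota_act V) (@sd2 V) (@sd_siota V)
    (sregular_kos reg_p) (fun c0 => kos_acyclic (leqnn n) reg_f) (leqnn n) h.
  exists (phi \o z), (K u); rewrite -K_sI -K_sd -(linearD K).
  by apply/eqP; rewrite -subr_eq0 -(linearB K); apply/eqP/K_J.
have [u' Eu] := K_surj u; have /choice [w hw] := phi_surj.
pose z' b := w (z b).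
have Ez : phi \o z' = z by apply/funext => b; apply: hw.
have h : idspan (@sact Re (kos V n)) (prel n) n (@sI V z' - sd V u').
  by apply: K_ker; rewrite (linearB K) K_sI K_sd Ez Eu E subrr.
move=> b sb; rewrite -(hw (z b)); apply: (span_map phiA); apply/ktop_exact.
exact: (kI_inj (@sd_act V) (@siota_act V) (@sd2 V) (@sd_siota V) (@sd_top V)
  (sregular_kos reg_p) (leqnn n) h sb).
Qed.
End OnSum.
End ContractionsOnSumsOfB.

Lemma kIS (A : comNzRingType) (M N : smod A) (iota : nat -> {linear N -> N})
    (top : {linear M -> N}) r (z : bitseq -> M) :
  kI iota top r.+1 z =
  kI iota top r (fun b => z (false :: b)) + iota r (kI iota top r (fun b => z (true :: b))).
Proof. by []. Qed.

Lemma kI_eq (A : comNzRingType) (M N : smod A) (iota : nat -> {linear N -> N})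
    (top : {linear M -> N}) r (z z' : bitseq -> M) :
  (forall b, size b = r -> z b = z' b) -> kI iota top r z = kI iota top r z'.
Proof.
elim: r z z' => [|r IH] z z' h /=; first by rewrite h.
by congr (_ + iota r _); apply: IH => b sb; apply: h; rewrite /= sb.
Qed.

(** Projection of the Koszul cochains on [M] to Koszul degree [j] and internal
    degree [i], the exterior generators having internal degree [-2]. *)
Section Projection.
Variables (n : nat) (M : gbimod n).
Local Notation Re := {mpoly rat[n + n]}.
Local Notation GM := (gsmod M).

Fixpoint kproj_fun (r : nat) (j i : int) : kos GM r -> kos GM r :=
  match r return kos GM r -> kos GM r with
  | 0 => fun c => if j == 0 then gproj i (c : M) else 0
  | r'.+1 => fun c => (kproj_fun j i c.1, kproj_fun (j - 1) (i + 2%:Z) c.2)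
  end.
Fact kproj_linear r j i : linear (@kproj_fun r j i).
Proof.
elim: r j i => [|r IH] j i a u v /=.
  by case: eqP => _; [apply: linearP | rewrite scaler0 addr0].
by rewrite !IH.
Qed.
HB.instance Definition _ r j i := GRing.isLinear.Build rat (kos GM r) (kos GM r) _
  (@kproj_fun r j i) (@kproj_linear r j i).
Definition kproj r j i : {linear kos GM r -> kos GM r} := @kproj_fun r j i.

Lemma kprojS r j i (c : kos GM r.+1) :
  kproj r.+1 j i c = (kproj r j i c.1, kproj r (j - 1) (i + 2%:Z) c.2).
Proof. by []. Qed.

Lemma kproj_act r j i d p c : p \is d.-homog ->
  kproj r j (i + (2 * d)%:Z) (sact p c) = sact p (kproj r j i c).
Proof.
move=> hp; elim: r j i c => [|r IH] j i c.
  rewrite /kproj /=; case: eqP => _; last by rewrite (linear_fun0 (@gact_linear _ M p)).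
  by rewrite addrC gproj_gact.
by rewrite kosactS !kprojS kosactS IH addrAC IH.
Qed.

Lemma kproj_kd r j i c : kproj r (j + 1) i (kd GM (fdiff n) r c) =
  kd GM (fdiff n) r (kproj r j i c).
Proof.
elim: r j i c => [|r IH] j i c; first exact: (linear0 (kproj 0 _ _)).
rewrite !kdS !kprojS [(_, _).1]/= [(_, _).2]/= IH; congr (_, _).
rewrite addrK (linearB (kproj r j (i + 2%:Z))) /=; congr (_ - _).
  by rewrite -(kproj_act _ _ _ (fdiff_homog n r)).
by rewrite -{1}(subrK 1 j) IH.
Qed.

Lemma kproj_kiota v e r j i c : (forall k, v k \is e.-homog) ->
  kproj r (j - 1) (i + (2 * e.+1)%:Z) (kiota GM v r c) =
  kiota GM v r (kproj r j i c).
Proof.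
move=> hv; elim: r j i c => [|r IH] j i c; first exact: (linear0 (kproj 0 _ _)).
rewrite !kiotaS !kprojS [(_, _).1]/= [(_, _).2]/=; congr (_, _).
  rewrite (linearD (kproj r _ _)) /= IH; congr (_ + _).
  by rewrite mulnS PoszD addrA (kproj_act _ _ _ (hv r)).
rewrite (linearN (kproj r _ _)) /= -IH; congr (- kproj _ _ _ _).
by rewrite addrAC.
Qed.

Lemma kproj_top r j i z : kproj r j i (ktop GM r z) =
  ktop GM r (if j == r%:Z then gproj (i + (2 * r)%:Z) z else 0).
Proof.
elim: r j i => [|r IH] j i.
  by rewrite /kproj /= muln0 addr0.
have kS z' : ktop GM r.+1 z' = (0, ktop GM r z') by [].
rewrite !kS kprojS [(_, _).1]/= [(_, _).2]/= (linear0 (kproj r j i)) IH.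
have -> : (j - 1 == r%:Z) = (j == r.+1%:Z) by rewrite subr_eq -addn1 PoszD.
have -> : i + 2%:Z + (2 * r)%:Z = i + (2 * r.+1)%:Z by rewrite mulnS PoszD addrA.
by [].
Qed.

(** Half the [q]-degree of the composite of the contractions selected by [b],
    the one with index [s] having degree [2 (n - s)]; the head of [b] stands
    for the last contraction. *)
Fixpoint bweight (b : bitseq) : nat :=
  if b is x :: b' then ((if x then n - size b' else 0) + bweight b')%N else 0%N.

(** The part of [z b] that ends in bidegree [(j, i)]: starting in Koszul degree [n], with internal
    degree lowered by [2 n], the contractions selected by [b] lower the former by their number and
    raise the latter by [2 * bweight b]. *)
Definition zproj (j i : int) (z : bitseq -> M) (b : bitseq) : M :=
  if j + (count id b)%:Z == n%:Z
  then gproj (i - (2 * bweight b)%:Z + (2 * n)%:Z) (z b) else 0.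

Lemma kproj_kI r j i z : (r <= n)%N ->
  kproj n j i (kI (siota GM) (ktop GM n) r z) =
  kI (siota GM) (ktop GM n) r (zproj j i z).
Proof.
elim: r j i z => [|r IH] j i z rn.
  by rewrite /= kproj_top /zproj /= addr0 muln0 subr0.
rewrite !kIS (linearD (kproj n j i)) IH ?(ltnW rn) //; congr (_ + _).
rewrite -[LHS]/(kproj n j i (kiota GM (rcoef n r) n _)).
rewrite -[RHS]/(kiota GM (rcoef n r) n _).
(* The contraction of index [r] has coefficients of polynomial degree [n - r - 1], so it raises the
   internal degree by [2 (n - r)]. *)
have -> : j = j + 1 - 1 by rewrite addrK.
have -> : i = i - (2 * (n - r))%:Z + (2 * (n - r).-1.+1)%:Z.
  by rewrite prednK ?subn_gt0 // subrK.
rewrite kproj_kiota; last by move=> k; apply: rcoef_homog.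
rewrite IH ?(ltnW rn) //; congr (kiota _ _ _ _); apply: kI_eq => b sb.
rewrite /zproj /= sb prednK ?subn_gt0 // subrK addrK.
rewrite [(true + _)%N]addnC PoszD addrA addrAC.
by rewrite mulnDr PoszD opprD !addrA.
Qed.
End Projection.

(** * The Koszul resolution *)

Section Constructions.
Variable n : nat.
Local Notation R := {mpoly rat[n]}.
Local Notation Re := {mpoly rat[n + n]}.

Lemma zerosp_eq (x y : zerosp) : x = y.
Proof. by rewrite (thinmx0 x) (thinmx0 y). Qed.

Fact gzero_subproof : @is_gbimod n zerosp (fun _ m => m) (fun m _ => m) (fun _ _ => True).
Proof.
split; do ?[by move=> *; apply: zerosp_eq | by move=> ? ? ? ?; apply: zerosp_eq].
- by move=> i; split.
- by move=> m; exists [::], (fun=> 0); split=> //; apply: zerosp_eq.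
- by [].
- by [].
Qed.
Definition gzero : gbimod n := Gbimod gzero_subproof.

Section Sum.
Variables M N : gbimod n.
Let HM := gbimodP M.
Let HN := gbimodP N.

Fact gsum_subproof : @is_gbimod n (M * N)%type
  (fun f m => (lact f m.1, lact f m.2)) (fun m f => (ract m.1 f, ract m.2 f))
  (fun i m => gdeg i m.1 /\ gdeg i m.2).
Proof.
split.
- by move=> m c f g; rewrite (lact_linear_l HM) (lact_linear_l HN).
- by move=> f c u v; rewrite /= (lact_linear_r HM) (lact_linear_r HN).
- by case=> a b; rewrite /= (lact1 HM) (lact1 HN).
- by move=> f g m; rewrite /= (lactM HM) (lactM HN).
- by move=> g c u v; rewrite /= (ract_linear_l HM) (ract_linear_l HN).
- by move=> m c f g; rewrite (ract_linear_r HM) (ract_linear_r HN).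
- by case=> a b; rewrite /= (ract1 HM) (ract1 HN).
- by move=> m f g; rewrite /= (ractM HM) (ractM HN).
- by move=> f m g; rewrite /= (lractA HM) (lractA HN).
- move=> i; split=> [|c u v [u1 u2] [v1 v2]]; first by split; apply: gdeg0.
  by split; apply: gdegP.
- move=> [u v].
  have [s hs] := decomp_supp (gproj_decomp u).
  have [t ht] := decomp_supp (gproj_decomp v).
  exists (undup (s ++ t)), (fun i => (gproj i u, gproj i v)); split.
    by move=> i; split; apply: gproj_deg.
  rewrite sum_pair -hs ?undup_uniq //; last first.
    by move=> i hi; rewrite mem_undup mem_cat hi.
  rewrite -ht ?undup_uniq // => i hi; by rewrite mem_undup mem_cat hi orbT.
- move=> s c us hc s0 i si.
  have E : (\sum_(i <- s) (c i).1, \sum_(i <- s) (c i).2) = 0 :> M * N.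
    by rewrite -sum_pair -[RHS]s0; apply: eq_bigr => j _; case: (c j).
  case: E => E1 E2; rewrite [c i]surjective_pairing; congr (_, _).
    exact: (gdeg_indep HM us (fun j => (hc j).1) E1 si).
  exact: (gdeg_indep HN us (fun j => (hc j).2) E2 si).
- by move=> a i f m ha [h1 h2]; split; [apply: (lact_deg HM) | apply: (lact_deg HN)].
- by move=> a i f m ha [h1 h2]; split; [apply: (ract_deg HM) | apply: (ract_deg HN)].
Qed.
Definition gsum : gbimod n := Gbimod gsum_subproof.

Lemma gact_gsum p (c : gsum) : gact p c = (gact p c.1, gact p c.2).
Proof.
move: p c; apply: Re_ind => [r|r|p q hp hq|p q hp hq] c.
- by rewrite !gact_lemb.
- by rewrite !gact_remb.
- by rewrite !gactDl hp hq.
- by rewrite !gactM hq hp.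
Qed.
End Sum.

(** [R ⊗_Q R], the free bimodule on one generator of degree 0 *)
Fact free_subproof : @is_gbimod n Re (fun f m => lemb n f * m)
  (fun m f => m * remb n f) (@poly_deg (n + n)).
Proof.
have H := gbimodP (polybim (n + n)).
split.
- by move=> m c f g; rewrite rmorphD lembZ mulrDl -scalerAl.
- by move=> f c u v; rewrite mulrDr -scalerAr.
- by move=> m; rewrite rmorph1 mul1r.
- by move=> f g m; rewrite rmorphM mulrA.
- by move=> g c u v; rewrite mulrDl -scalerAl.
- by move=> m c f g; rewrite rmorphD rembZ mulrDr -scalerAr.
- by move=> m; rewrite rmorph1 mulr1.
- by move=> m f g; rewrite rmorphM mulrA.
- by move=> f m g; rewrite mulrA.
- exact: (gdeg_subspace H).
- exact: (gdeg_gen H).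
- exact: (gdeg_indep H).
- move=> a i f m /poly_degP [->|[d [E hf]]] hm; rewrite ?E.
    by rewrite rmorph0 mul0r; apply: (@poly_deg_subspace (n + n) (a + i)).1.
  by apply: poly_degM => //; apply/poly_degE/lemb_homog.
- move=> a i f m /poly_degP [->|[d [E hf]]] hm; rewrite ?E.
    by rewrite rmorph0 mulr0; apply: (@poly_deg_subspace (n + n) (i + a)).1.
  by apply: poly_degM => //; apply/poly_degE/remb_homog.
Qed.
Definition freebim : gbimod n := Gbimod free_subproof.

Lemma gact_free p (q : freebim) : gact p q = p * q :> Re.
Proof.
move: p q; apply: Re_ind => [r|r|p q hp hq|p q hp hq] c.
- by rewrite gact_lemb.
- by rewrite gact_remb /= mulrC.
- by rewrite !gactDl mulrDl hp hq.
- by rewrite !gactM hp hq mulrA.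
Qed.

Lemma is_ghom_gact (M N : gbimod n) (h : M -> N) : linear h ->
  (forall p v, h (gact p v) = gact p (h v)) ->
  (forall i v, gdeg i v -> gdeg i (h v)) -> is_ghom h.
Proof.
move=> hl hg hd; split=> //.
- by move=> a m; rewrite -!gact_lemb.
- by move=> m a; rewrite -!gact_remb.
Qed.

(** The Koszul resolution of [R] over [R ⊗ R]; [kres_tail r j] is its term
    of degree [j + 1] for the first [r] elements [x_k - y_k]. *)
Fixpoint kres_tail (r j : nat) : gbimod n :=
  if r is r'.+1 then
    gsum (kres_tail r' j)
         (gshift (if j is j'.+1 then kres_tail r' j' else freebim) 2)
  else gzero.
Definition kres (r j : nat) : gbimod n :=
  if j is j'.+1 then kres_tail r j' else freebim.

(** The cone of multiplication by [fdiff n r'] on the complex of the earlier elements, whence the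
    sign in the second component. *)
Fixpoint kbd (r : nat) : forall j, kres_tail r j -> kres r j :=
  match r return forall j, kres_tail r j -> kres r j with
  | 0 => fun j _ => 0
  | r'.+1 => fun j =>
    match j return kres_tail r'.+1 j -> kres r'.+1 j with
    | 0 => fun c => (@kbd r' 0 c.1 : Re) + fdiff n r' * (c.2 : Re)
    | j'.+1 => fun c => (kbd c.1 + gact (fdiff n r') (c.2 : kres_tail r' j'), - kbd (c.2 : kres_tail r' j'))
    end
  end.
End Constructions.

Section KoszulResolution.
Variable n : nat.
Local Notation R := {mpoly rat[n]}.
Local Notation Re := {mpoly rat[n + n]}.
Local Notation kt := (@kres_tail n).
Local Notation kr := (@kres n).

Lemma kbdS0 r (c : kt r.+1 0) : @kbd n r.+1 0 c = kbd c.1 + @gact n (freebim n) (fdiff n r) c.2 :> freebim n.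
Proof. by rewrite gact_free. Qed.
Lemma kbdSS r j (c : kt r.+1 j.+1) :
  @kbd n r.+1 j.+1 c = (kbd c.1 + @gact n (kt r j) (fdiff n r) c.2, - @kbd n r j c.2).
Proof. by []. Qed.

Lemma gact_kt r j p (c : kt r.+1 j) :
  gact p c = (gact p c.1, @gact n (kr r j) p c.2).
Proof. exact: gact_gsum. Qed.

Lemma gact0r (M : gbimod n) p : gact p (0 : M) = 0.
Proof. exact: (linear_fun0 (gact_linear p)). Qed.
Lemma gactDr (M : gbimod n) p (u v : M) : gact p (u + v) = gact p u + gact p v.
Proof. by have := gact_linear p 1 u v; rewrite !scale1r. Qed.
Lemma gactNr (M : gbimod n) p (u : M) : gact p (- u) = - gact p u.
Proof. by have := gact_linear p (-1) u 0; rewrite !addr0 gact0r addr0 !scaleN1r. Qed.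

Lemma kbd_linear r j : linear (@kbd n r j).
Proof.
elim: r j => [|r IH] [|j] k u v.
- by rewrite /= scaler0 addr0.
- by rewrite /= scaler0 addr0.
- rewrite !kbdS0 /= IH (@gact_linear n (freebim n)) scalerDr addrACA //.
- rewrite !kbdSS /= IH (@gact_linear n (kt r j)) IH.
  congr (_, _); first by rewrite /= scalerDr addrACA.
  by rewrite /= opprD scalerN.
Qed.
HB.instance Definition _ r j := GRing.isLinear.Build rat (kt r j) (kr r j) _
  (@kbd n r j) (@kbd_linear r j).

Lemma kbd_gact r j p c : @kbd n r j (gact p c) = gact p (kbd c).
Proof.
elim: r j c => [|r IH] [|j] c; try by rewrite /= gact0r.
- rewrite !kbdS0 gact_kt /= IH gactDr; congr (_ + _).
  by rewrite !gact_free mulrCA.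
- rewrite !kbdSS !gact_kt /= !IH gactNr gactDr; congr (_ + _, _).
  by rewrite -!gactM mulrC.
Qed.

Lemma fdiff_deg r (M : gbimod n) e (v : M) :
  gdeg (e - 2%:Z) v -> gdeg e (gact (fdiff n r) v).
Proof. by move/(gact_deg (fdiff_homog n r)); rewrite addrC subrK. Qed.

Lemma gdegD (M : gbimod n) e (u v : M) : gdeg e u -> gdeg e v -> gdeg e (u + v).
Proof. by move=> hu hv; rewrite -[u]scale1r; apply: gdegP. Qed.
Lemma gdegN (M : gbimod n) e (u : M) : gdeg e u -> gdeg e (- u).
Proof. by move=> hu; rewrite -scaleN1r -[_ *: _]addr0; apply: gdegP => //; apply: gdeg0. Qed.

Lemma kbd_deg r j i c : gdeg i c -> gdeg i (@kbd n r j c).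
Proof.
elim: r j i c => [|r IH] [|j] i c; try by move=> _; apply: gdeg0.
- move=> [h1 h2]; rewrite kbdS0; apply: (@gdegD (freebim n)); first exact: IH h1.
  exact: fdiff_deg.
- move=> [h1 h2]; rewrite kbdSS; split=> /=; last exact/(@gdegN (kr r j))/IH.
  by apply: (@gdegD (kt r j)); [apply: IH h1 | apply: fdiff_deg].
Qed.

Lemma kbd2 r j c : @kbd n r j (@kbd n r j.+1 c) = 0.
Proof.
elim: r j c => [|r IH] j c; first by rewrite linear0.
rewrite kbdSS; case: j c => [|j] c.
- rewrite kbdS0 /= (linearD (@kbd n r 0)) /= IH add0r kbd_gact.
  by rewrite (gactNr (M := freebim n)); apply: subrr.
- rewrite kbdSS /= (linearD (@kbd n r j.+1)) /= IH add0r kbd_gact.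
  rewrite (linearN (@kbd n r j)) /= IH oppr0; congr (_, _).
  by rewrite (gactNr (M := kt r j)); apply: subrr.
  exact: oppr0.
Qed.

Lemma kbd_exact r : (r <= n)%N ->
  (forall b : Re, (exists q : kt r 0, kbd q = b) <-> idspan *%R (fdiff n) r b) /\
  (forall j (p : kt r j), kbd p = 0 -> exists q : kt r j.+1, kbd q = p).
Proof.
elim: r => [|r IH] rn.
  split=> [b|j p _]; last by exists 0; apply: zerosp_eq.
  split=> [[q <-]|[w ->]]; first exact: ideal0.
  by exists 0; rewrite big_ord0.
have [IH0 IHS] := IH (ltnW rn); split=> [b|j c].
  split=> [[c <-]|[w ->]].
    rewrite kbdS0 gact_free addrC; apply: idealD; last first.
      by apply: ideal_le (leqnSn r) _; apply/IH0; exists c.1.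
    by rewrite mulrC; apply: idealM; apply: ideal_gen.
  have [|q hq] := (IH0 (\sum_(k < r) fdiff n k * w k)).2; first by exists w.
  by exists ((q, w r) : kt r.+1 0); rewrite kbdS0 gact_free hq big_ord_recr.
(* A cycle [(a, b)] of the cone bounds as soon as [b] does: then [a + f_r b'] is a cycle of the
   smaller complex. *)
have ex_a (a : kt r j) (b : kr r j) : kbd a + gact (fdiff n r) b = 0 ->
    forall b', kbd b' = b -> exists q : kt r.+1 j.+1, @kbd n r.+1 j.+1 q = (a, b).
  move=> E b' hb'; have [|a' ha'] := IHS j (a + gact (fdiff n r) b').
    by rewrite (linearD (@kbd n r j)) /= kbd_gact hb'.
  exists ((a', - b') : kt r.+1 j.+1); rewrite kbdSS /= gactNr ha' addrK.
  by rewrite (linearN (@kbd n r j)) /= opprK hb'.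
case: j c ex_a => [|j] [a b] ex_a.
  rewrite kbdS0 => E; have [|b' hb'] := (IH0 b).2; last exact: ex_a hb'.
  (* Only here is regularity needed: [f_r b] is a boundary, so it lies in the ideal of the earlier
     elements, and then so does [b]. *)
  apply: (@fdiff_regular _ (Ordinal rn)) => /=; rewrite -gact_free.
  have -> : gact (fdiff n r) (b : freebim n) = - @kbd n r 0 a.
    by apply/eqP; rewrite -addr_eq0 addrC; apply/eqP.
  by apply/idealN/IH0; exists a.
rewrite kbdSS => -[E1 E2].
have [|b' hb'] := IHS j b; last exact: ex_a hb'.
by apply/eqP; rewrite -oppr_eq0; apply/eqP.
Qed.

(** * Koszul cochains as homomorphisms on Koszul chains *)

Section Pairing.
Variable M : gbimod n.
Local Notation GM := (gsmod M).

Fixpoint kbase r : kos GM r -> M :=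
  match r return kos GM r -> M with 0 => fun c => c | r'.+1 => fun c => kbase c.1 end.
Fixpoint kunit r : M -> kos GM r :=
  match r return M -> kos GM r with 0 => fun m => m | r'.+1 => fun m => (kunit r' m, 0) end.

(** The value of a cochain on a chain of degree [j + 1]. [kos] holds all Koszul degrees at once and
    only the matching one is seen, so the inverse [kev] needs a homogeneity hypothesis. *)
Fixpoint kpair_tail r : forall j, kos GM r -> kt r j -> M :=
  match r return forall j, kos GM r -> kt r j -> M with
  | 0 => fun j _ _ => 0
  | r'.+1 => fun j c p => kpair_tail c.1 p.1 +
     (match j return kr r' j -> M with
      | 0 => fun b => gact (b : Re) (kbase c.2)
      | j'.+1 => fun b => kpair_tail c.2 (b : kt r' j')
      end) p.2
  end.
Definition kpair r j (c : kos GM r) : kr r j -> M :=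
  match j return kr r j -> M with
  | 0 => fun b => gact (b : Re) (kbase c)
  | j'.+1 => fun b => kpair_tail c (b : kt r j')
  end.

Lemma kpairS r j (c : kos GM r.+1) (p : kt r.+1 j) :
  @kpair r.+1 j.+1 c p = @kpair r j.+1 c.1 p.1 + @kpair r j c.2 p.2.
Proof. by case: j p. Qed.

(** Records the values of [phi] on the free generators of the chains. *)
Fixpoint kev_tail r : forall j, (kt r j -> M) -> kos GM r :=
  match r return forall j, (kt r j -> M) -> kos GM r with
  | 0 => fun j _ => 0
  | r'.+1 => fun j phi => (kev_tail (fun a => phi (a, 0)),
     (match j return (kr r' j -> M) -> kos GM r' with
      | 0 => fun psi => kunit r' (psi (1 : Re))
      | j'.+1 => fun psi => kev_tail (psi : kt r' j' -> M)
      end) (fun b => phi (0, b)))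
  end.
Definition kev r j : (kr r j -> M) -> kos GM r :=
  match j return (kr r j -> M) -> kos GM r with
  | 0 => fun phi => kunit r (phi (1 : Re))
  | j'.+1 => fun phi => kev_tail (phi : kt r j' -> M)
  end.

Lemma kevS r j (phi : kt r.+1 j -> M) :
  @kev r.+1 j.+1 phi =
  (@kev r j.+1 (fun a => phi (a, 0)), @kev r j (fun b => phi (0, b))).
Proof. by case: j phi. Qed.

Lemma kbase_linear r : linear (@kbase r).
Proof. by elim: r => [|r IH] k u v //=; rewrite IH. Qed.
Lemma kbase_act r p c : @kbase r (sact p c) = gact p (kbase c).
Proof. by elim: r c => [|r IH] c //=; rewrite -IH. Qed.
Lemma kbase_kd r c : @kbase r (kd GM (fdiff n) r c) = 0.
Proof. by elim: r c => [|r IH] c //=; apply: IH. Qed.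
Lemma kbaseK r m : kbase (kunit r m) = m.
Proof. by elim: r. Qed.

Lemma kpair_linear r j c : linear (@kpair r j c).
Proof.
elim: r j c => [|r IH] [|j] c k u v; try exact: gactP.
  by rewrite /= scaler0 addr0.
by rewrite !kpairS !IH scalerDr addrACA.
Qed.
Lemma kpair_gact r j c p q : @kpair r j c (gact q p) = gact q (kpair c p).
Proof.
elim: r j c p => [|r IH] [|j] c p; try by rewrite /= gact_free gactM.
  by rewrite /= gact0r.
by rewrite !kpairS gact_kt !IH gactDr.
Qed.
Lemma kpair_linear_l r j p : linear (fun c => @kpair r j c p).
Proof.
elim: r j p => [|r IH] [|j] p k u v; try by rewrite /kpair kbase_linear gact_linear.
  by rewrite /= scaler0 addr0.
by rewrite !kpairS !IH scalerDr addrACA.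
Qed.
Lemma kpair_sact r j q c p : @kpair r j (sact q c) p = gact q (kpair c p).
Proof.
elim: r j c p => [|r IH] [|j] c p; try by rewrite /kpair kbase_act -!gactM mulrC.
  by rewrite /= gact0r.
by rewrite !kpairS !IH gactDr.
Qed.

Lemma kpairDr r j c p q : @kpair r j c (p + q) = kpair c p + kpair c q.
Proof. by have := kpair_linear c 1 p q; rewrite !scale1r. Qed.
Lemma kpair0r r j c : @kpair r j c 0 = 0.
Proof. exact: (linear_fun0 (kpair_linear c)). Qed.
Lemma kpairNr r j c p : @kpair r j c (- p) = - kpair c p.
Proof. by apply/eqP; rewrite -addr_eq0 -kpairDr addNr kpair0r. Qed.
Lemma kpairBl r j a b q : @kpair r j (a - b) q = kpair a q - kpair b q.
Proof. by have := @kpair_linear_l r j q (-1) b a; rewrite !scaleN1r ![- _ + _]addrC. Qed.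

(** Turns precomposition with the boundary into the Koszul differential, so that Ext can be computed
    by [kd]. *)
Lemma kpair_kd r j c p : @kpair r j.+1 (kd GM (fdiff n) r c) p = @kpair r j c (kbd p).
Proof.
elim: r j c p => [|r IH] j c p; first by rewrite (linear_fun0 (@kpair_linear 0 j c)).
rewrite kdS kpairS [(_, _).1]/= [(_, _).2]/= IH kpairBl kpair_sact.
case: j p => [|j] p.
  rewrite kbdS0 /= kbase_kd gact0r subr0 gact_free [RHS]gactDl; congr (_ + _).
  by rewrite gactM.
rewrite kbdSS kpairS [(_, _).1]/= [(_, _).2]/= IH kpairDr kpairNr kpair_gact.
by zmod.
Qed.

Lemma kpair0l r j p : @kpair r j 0 p = 0.
Proof. exact: (linear_fun0 (@kpair_linear_l r j p)). Qed.

Lemma kpair_kev r j (phi : kr r j -> M) : linear phi ->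
  (forall q p, phi (gact q p) = gact q (phi p)) -> forall p, kpair (kev phi) p = phi p.
Proof.
elim: r j phi => [|r IH] [|j] phi hl hg p; try by rewrite /kpair /kev kbaseK -hg; congr phi; apply: etrans (gact_free _ _) (mulr1 _).
  by rewrite /= (zerosp_eq p 0) (linear_fun0 hl).
rewrite kpairS kevS [(_, _).1]/= [(_, _).2]/= !IH.
- have := hl 1 (p.1, 0) (0, p.2); rewrite !scale1r => <-.
  by congr phi; rewrite [RHS]surjective_pairing; congr (_, _); rewrite /= ?addr0 ?add0r.
- by move=> k u v; rewrite -hl; congr (phi (_, _)); rewrite /= scaler0 addr0.
- by move=> q b; rewrite -hg gact_kt gact0r.
- by move=> k u v; rewrite -hl; congr (phi (_, _)); rewrite /= scaler0 addr0.
- by move=> q b; rewrite -hg gact_kt gact0r.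
Qed.

Lemma kproj_neg r (j i : int) c : (j < 0)%R -> kproj M r j i c = 0.
Proof.
elim: r j i c => [|r IH] j i c j0; first by rewrite /kproj /= Order.POrderTheory.lt_eqF.
by rewrite kprojS !IH // Num.Theory.ltrBlDr (Order.POrderTheory.lt_trans j0).
Qed.

Lemma kev_kpair r (j : nat) i c : kproj M r j%:Z i c = c -> kev (@kpair r j c) = c.
Proof.
elim: r j i c => [|r IH] j i c E.
  by case: j E => [|j] /=; rewrite ?gact1 // /kproj /= => <-.
case: j E => [|j] E.
  have E1 : kproj M r 0 i c.1 = c.1 := congr1 fst E.
  have E2 : kproj M r (0 - 1) (i + 2%:Z) c.2 = c.2 := congr1 snd E.
  rewrite /= gact1 [RHS]surjective_pairing -E2 kproj_neg //; congr (_, _).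
  by rewrite -[RHS](IH 0 i) //= gact1.
have E1 : kproj M r j.+1%:Z i c.1 = c.1 := congr1 fst E.
have E2 : kproj M r (j.+1%:Z - 1) (i + 2%:Z) c.2 = c.2 := congr1 snd E.
have ej : j.+1%:Z - 1 = j%:Z by rewrite -addn1 PoszD addrK.
rewrite ej in E2.
rewrite kevS [RHS]surjective_pairing; congr (_, _).
  rewrite -[RHS](IH _ _ _ E1); congr (kev _); apply/funext => p.
  by rewrite kpairS [(_, _).1]/= [(_, _).2]/= kpair0r addr0.
rewrite -[RHS](IH _ _ _ E2); congr (kev _); apply/funext => p.
by rewrite kpairS [(_, _).1]/= [(_, _).2]/= kpair0r add0r.
Qed.

Lemma kbase_deg r i c : kproj M r 0 i c = c -> gdeg i (kbase c).
Proof.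
elim: r c => [|r IH] c E; first by apply/gprojP.
exact: IH (congr1 fst E).
Qed.

Lemma kpair_deg r j i d c p : kproj M r j%:Z i c = c -> gdeg d p ->
  gdeg (d + i) (@kpair r j c p).
Proof.
have free_deg e (b : freebim n) (m : M) : gdeg e b -> gdeg i m ->
    gdeg (e + i) (gact (b : Re) m).
  move=> /poly_degP [->|[a [-> ha]]] hm; first by rewrite gact0; apply: gdeg0.
  exact: gact_deg.
elim: r j i d c p free_deg => [|r IH] [|j] i d c p free_deg E hp.
- by apply: free_deg => //; apply: kbase_deg.
- exact: gdeg0.
- by apply: free_deg => //; apply: kbase_deg.
have E1 : kproj M r j.+1%:Z i c.1 = c.1 := congr1 fst E.
have E2 : kproj M r (j.+1%:Z - 1) (i + 2%:Z) c.2 = c.2 := congr1 snd E.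
have ej : j.+1%:Z - 1 = j%:Z by rewrite -addn1 PoszD addrK.
rewrite ej in E2; case: hp => h1 h2; rewrite kpairS.
apply: gdegD; first exact: IH.
have -> : d + i = (d - 2%:Z) + (i + 2%:Z) by zmod.
apply: IH => // e b m hb hm.
move: hb => /poly_degP [->|[a [-> ha]]]; first by rewrite gact0; apply: gdeg0.
exact: gact_deg.
Qed.

Lemma kunit_deg r i m : gdeg i m -> kproj M r 0 i (kunit r m) = kunit r m.
Proof.
move=> hm; elim: r => [|r IH]; first by rewrite /kproj /= gproj_id.
by rewrite kprojS /= IH kproj_neg.
Qed.

Lemma kev_deg r j i (phi : kr r j -> M) :
  (forall d p, gdeg d p -> gdeg (d + i) (phi p)) -> kproj M r j%:Z i (kev phi) = kev phi.
Proof.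
have one_deg : @gdeg n (freebim n) 0 (1 : Re).
  by apply/(@poly_degE (n + n) 0); apply: dhomog1.
elim: r j i phi => [|r IH] [|j] i phi h.
- by apply: kunit_deg; rewrite -[i]add0r; apply: h.
- by rewrite /kproj.
- by apply: kunit_deg; rewrite -[i]add0r; apply: h.
have ej : j.+1%:Z - 1 = j%:Z by rewrite -addn1 PoszD addrK.
rewrite kevS kprojS [(_, _).1]/= [(_, _).2]/= ej !IH //.
  by move=> d a ha; apply: h; split=> //; apply: gdeg0.
move=> d b hb; have -> : d + (i + 2%:Z) = (d + 2%:Z) + i by zmod.
by apply: h; split=> /=; [apply: gdeg0 | rewrite addrK].
Qed.
End Pairing.

Lemma kproj_kmap (M N : gbimod n) (h : ghom M N) r j i c :
  kproj N r j i (@kmap Re (gsmod M) (gsmod N) (ghom_fun h) r c) =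
  @kmap Re (gsmod M) (gsmod N) (ghom_fun h) r (kproj M r j i c).
Proof.
elim: r j i c => [|r IH] j i c.
  rewrite /kproj /kmap /=; case: eqP => _; last by rewrite linear0.
  exact: gproj_ghom.
by rewrite kprojS /= [LHS](congr2 pair (IH j i c.1) (IH (j - 1) (i + 2%:Z) c.2)).
Qed.

Lemma kpair_kmap (M N : gbimod n) (h : ghom M N) r j c p :
  @kpair N r j (@kmap Re (gsmod M) (gsmod N) (ghom_fun h) r c) p = h (kpair c p).
Proof.
elim: r j c p => [|r IH] [|j] c p.
- by rewrite /= ghom_gact.
- by rewrite /= linear0.
- rewrite /kpair ghom_gact; congr (gact _ _).
  by elim: (r.+1) c {IH p} => [|s IHs] c //=; apply: IHs.
- rewrite !kpairS.
  exact: etrans (congr2 +%R (IH _ _ _) (IH _ _ _)) (esym (linearD (ghom_fun h) _ _)).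
Qed.

Fact kghom_subproof (M : gbimod n) (i : int) j (c : kos (gsmod M) n) :
  kproj M n j%:Z i c = c -> @is_ghom n (gshift (kr n j) i) M (kpair c).
Proof.
move=> E; apply: is_ghom_gact.
- exact: kpair_linear.
- by move=> p v; apply: kpair_gact.
- by move=> d v hv; rewrite -[d](subrK i); apply: kpair_deg.
Qed.
Definition kghom (M : gbimod n) i j c (E : kproj M n j%:Z i c = c) :
  ghom (gshift (kr n j) i) M := mkghom (kghom_subproof E).

Lemma kev_ghom (M : gbimod n) i j (phi : ghom (gshift (kr n j) i) M) :
  kproj M n j%:Z i (@kev M n j phi) = @kev M n j phi /\
  (forall p, kpair (@kev M n j phi) p = phi p).
Proof.
split.
  apply: kev_deg => d p hp; case: (ghomP phi) => _ _ _; apply.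
  by rewrite /= addrK.
by apply: kpair_kev => [|q p]; [exact: (ghom_fun_linear phi) | exact: (ghom_gact phi)].
Qed.

Lemma kprojK (M : gbimod n) r j i c : kproj M r j i (kproj M r j i c) = kproj M r j i c.
Proof.
elim: r j i c => [|r IH] j i c; last by rewrite !kprojS !IH.
by rewrite /kproj /=; case: eqP => // _; rewrite gproj_id //; apply: gproj_deg.
Qed.
Arguments kprojK {M r} j i c.

(** The values of [f] on the free generators are lifted along [g], then projected to the right
    bidegree; projections commute with [g], so the result is a homogeneous lift. *)
Lemma kres_proj i j : gprojective (gshift (kr n j) i).
Proof.
move=> M N g f g_surj; have [Ef pf] := kev_ghom f.
have [c hc] := @kmap_surj Re (gsmod M) (gsmod N) (ghom_fun g) n g_surj (@kev N n j f).
exists (kghom (kprojK j%:Z i c)) => p; rewrite -pf -Ef -hc kproj_kmap.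
exact/esym/kpair_kmap.
Qed.

Section Resolution.
Variable i : int.

Fact krdiff_subproof j : @is_ghom n (gshift (kr n j.+1) i) (gshift (kr n j) i) (@kbd n n j).
Proof.
apply: is_ghom_gact.
- exact: kbd_linear.
- by move=> p v; apply: kbd_gact.
- by move=> d v; apply: kbd_deg.
Qed.
Definition krdiff j : ghom (gshift (kr n j.+1) i) (gshift (kr n j) i) :=
  mkghom (krdiff_subproof j).

Fact kraug_subproof : @is_ghom n (gshift (kr n 0) i) (gshift (polybim n) i) (codiag n).
Proof.
split=> [c u v|a m|m a|d m].
- by rewrite rmorphD codiagZ.
- by rewrite /= rmorphM lembK.
- by rewrite /= rmorphM rembK.
- move=> /poly_degP [->|[e [E hm]]]; first by rewrite rmorph0; apply: (@gdeg0 n (gshift (polybim n) i)).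
  rewrite [gdeg _ _]/(poly_deg (d - i) (codiag n m)) E; apply/poly_degE.
  apply: (rmorph_homog (h := codiag n) (@codiagC n) _ hm) => k.
  by rewrite codiagX; apply: mvar_homog.
Qed.
Definition kraug : ghom (gshift (kr n 0) i) (gshift (polybim n) i) :=
  mkghom kraug_subproof.

Fact kraug_surj (x : gshift (polybim n) i) : exists p, kraug p = x.
Proof. by exists (lemb n x); apply: lembK. Qed.
Fact krexact0 (p : gshift (kr n 0) i) :
  kraug p = 0 <-> exists q : gshift (kr n 1) i, krdiff 0 q = p.
Proof.
have [h0 _] := kbd_exact (leqnn n).
exact: iff_trans (codiag_ker (p : Re)) (iff_sym (h0 p)).
Qed.
Fact krexact j (p : gshift (kr n j.+1) i) :
  krdiff j p = 0 <-> exists q : gshift (kr n j.+2) i, krdiff j.+1 q = p.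
Proof.
have [_ hS] := kbd_exact (leqnn n).
by split=> [/hS//|[q <-]]; apply: kbd2.
Qed.

Definition kresolution : gresolution (gshift (polybim n) i) :=
  GResolution (fun j => @kres_proj i j) kraug_surj krexact0 krexact.
End Resolution.
End KoszulResolution.

Lemma linear_sub (U V : lmodType rat) (p q : U -> V) :
  linear p -> linear q -> linear (fun x => p x - q x).
Proof. by move=> hp hq c u v; rewrite hp hq scalerBr opprD addrACA. Qed.

(** * Comparison of resolutions *)

Section Kernels.
Variables (n : nat) (M N : gbimod n) (h : ghom M N).
Let HM := gbimodP M.

Definition in_gker (m : M) : Prop := h m = 0.
Fact in_gker_subspace : subspace in_gker.
Proof.
split=> [|c u v hu hv]; first exact: linear0.
by rewrite /in_gker (ghom_fun_linear h) hu hv scaler0 addr0.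
Qed.
Let K : lmodType rat := subsp in_gker_subspace.
Let in_gkerP (m : K) : in_gker (val m).
Proof. exact/(subspace_predP in_gker_subspace)/(valP m). Qed.
Let mkK (m : M) (hm : in_gker m) : K := exist _ m (introT (subspace_predP in_gker_subspace m) hm).

Lemma gker_lact f (m : K) : in_gker (lact f (val m)).
Proof. by case: (ghomP h) => _ h2 _ _; rewrite /in_gker h2 in_gkerP -gact_lemb gact0r. Qed.
Lemma gker_ract f (m : K) : in_gker (ract (val m) f).
Proof. by case: (ghomP h) => _ _ h2 _; rewrite /in_gker h2 in_gkerP -gact_remb gact0r. Qed.
Lemma gker_gproj i (m : K) : in_gker (gproj i (val m)).
Proof. by rewrite /in_gker -gproj_ghom in_gkerP linear0. Qed.

Let val_sum I (s : seq I) (F : I -> K) : val (\sum_(i <- s) F i) = \sum_(i <- s) val (F i).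
Proof. by elim: s => [|i s IH]; rewrite ?big_nil // !big_cons -IH. Qed.

Fact gker_subproof : @is_gbimod n K (fun f m => mkK (gker_lact f m))
  (fun m f => mkK (gker_ract f m)) (fun i m => gdeg i (val m)).
Proof.
split.
- by move=> m c f g; apply: val_inj; rewrite /= (lact_linear_l HM).
- by move=> f c u v; apply: val_inj; rewrite /= (lact_linear_r HM).
- by move=> m; apply: val_inj; rewrite /= (lact1 HM).
- by move=> f g m; apply: val_inj; rewrite /= (lactM HM).
- by move=> f c u v; apply: val_inj; rewrite /= (ract_linear_l HM).
- by move=> m c f g; apply: val_inj; rewrite /= (ract_linear_r HM).
- by move=> m; apply: val_inj; rewrite /= (ract1 HM).
- by move=> m f g; apply: val_inj; rewrite /= (ractM HM).
- by move=> f m g; apply: val_inj; rewrite /= (lractA HM).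
- by move=> i; split=> [|c u v hu hv]; [apply: gdeg0 | apply: gdegP].
- move=> m; have [_ [s [us hs E]]] := gproj_decomp (val m).
  exists s, (fun i => mkK (gker_gproj i m)); split=> [i|]; first exact: gproj_deg.
  by apply: val_inj; rewrite val_sum.
- move=> s c us hc s0 i si; apply: val_inj.
  apply: (gdeg_indep HM us hc _ si).
  by rewrite -val_sum s0.
- by move=> a i f m ha hm; apply: (lact_deg HM).
- by move=> a i f m ha hm; apply: (ract_deg HM).
Qed.
Definition gker : gbimod n := Gbimod gker_subproof.

Lemma gker_factor (A : gbimod n) (f : ghom A M) : (forall a, h (f a) = 0) ->
  exists f' : ghom A gker, forall a, val (f' a : K) = f a.
Proof.
move=> hf; pose f' (a : A) : gker := mkK (hf a).
have hf' : is_ghom f'.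
  case: (ghomP f) => f1 f2 f3 f4; split.
  - by move=> c u v; apply: val_inj; apply: f1.
  - by move=> c u; apply: val_inj; apply: f2.
  - by move=> c u; apply: val_inj; apply: f3.
  - exact: f4.
by exists (mkghom hf').
Qed.

Lemma gproj_lift (A L : gbimod n) (g : ghom L M) (f : ghom A M) : gprojective A ->
  (forall m, h m = 0 <-> exists l, g l = m) -> (forall a, h (f a) = 0) ->
  exists k : ghom A L, forall a, g (k a) = f a.
Proof.
move=> Aproj ex hf; have [f' ef'] := gker_factor hf.
have [|g' eg'] := @gker_factor L g; first by move=> l; apply/ex; exists l.
have [|k ek] := Aproj L gker g' f'.
  move=> y; have [l hl] := (ex (val (y : K))).1 (in_gkerP y); exists l.
  by apply: val_inj; rewrite -hl; apply: eg'.
by exists k => a; rewrite -eg' -ef' ek.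
Qed.
End Kernels.

Section Comparison.
Variable n : nat.

Section Lift.
Variables (X : gbimod n) (P Q : gresolution X).

(** Treats the augmentation as the differential out of degree 0; the target is packed with the map
    because it varies with [j]. *)
Definition raug_or_diff (Q : gresolution X) j :
    {Y : gbimod n & ghom (robj Q j) Y} :=
  match j with
  | 0 => existT _ _ (raug Q)
  | j'.+1 => existT _ _ (rdiff Q j')
  end.
Definition rcyc j (q : robj Q j) : Prop := projT2 (raug_or_diff Q j) q = 0.

Lemma rcyc_exact j (q : robj Q j) : rcyc q <-> exists q', rdiff Q j q' = q.
Proof. by case: j q => [|j] q; [apply: rexact0 | apply: rexact]. Qed.

Lemma rlift (A : gbimod n) j (f : ghom A (robj Q j)) : gprojective A ->
  (forall a, rcyc (f a)) -> exists h : ghom A (robj Q j.+1), forall a, rdiff Q j (h a) = f a.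
Proof. by move=> hA hf; apply: gproj_lift hA _ hf => q; apply: rcyc_exact. Qed.

Definition is_chain_map (t : forall j, ghom (robj P j) (robj Q j)) : Prop :=
  forall j p, rdiff Q j (t j.+1 p) = t j (rdiff P j p).

Lemma chain_map_ex : exists t : forall j, ghom (robj P j) (robj Q j),
  (forall p, raug Q (t 0 p) = raug P p) /\ is_chain_map t.
Proof.
pose ok j (t : ghom (robj P j) (robj Q j)) := forall p, rcyc (t (rdiff P j p)).
have [t0 ht0] := @robj_proj _ _ P 0 _ _ (raug Q) (raug P) (@raug_surj _ _ Q).
have ok0 : ok 0 t0.
  by move=> p; rewrite /rcyc /= ht0; apply/rexact0; exists p.
(* The recursion carries the condition [ok], which is what allows the next lift. *)
have step j (t : {t | ok j t}) : {t' | ok j.+1 t' /\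
    forall p, rdiff Q j (t' p) = sval t (rdiff P j p)}.
  apply: cid; case: t => t okt /=.
  have [|t' ht'] := @rlift _ j (gcomp t (rdiff P j)) (@robj_proj _ _ P j.+1); first exact: okt.
  have {}ht' p : rdiff Q j (t' p) = t (rdiff P j p) := ht' p.
  exists t'; split=> // p; rewrite /rcyc /= ht'.
  have -> : rdiff P j (rdiff P j.+1 p) = 0 by apply/rexact; exists p.
  exact: linear0.
pose t := nat_rect (fun j => {t | ok j t}) (exist _ t0 ok0)
  (fun j t => exist _ (sval (step j t)) (svalP (step j t)).1).
exists (fun j => sval (t j)); split=> [p|j p]; first exact: ht0.
exact: (svalP (step j (t j))).2.
Qed.

Lemma homotopy_ex (t : forall j, ghom (robj P j) (robj Q j)) : is_chain_map t ->
  (forall p, raug Q (t 0 p) = 0) -> exists s : forall j, ghom (robj P j) (robj Q j.+1),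
    (forall p, t 0 p = rdiff Q 0 (s 0 p)) /\
    (forall j p, t j.+1 p = rdiff Q j.+1 (s j.+1 p) + s j (rdiff P j p)).
Proof.
move=> ht t0.
pose ok j (s : ghom (robj P j) (robj Q j.+1)) :=
  forall p, rdiff Q j (s (rdiff P j p)) = t j (rdiff P j p).
have [|s0 hs0] := @rlift _ 0 (t 0) (@robj_proj _ _ P 0); first exact: t0.
have ok0 : ok 0 s0 by move=> p; apply: hs0.
have step j (s : {s | ok j s}) : {s' | ok j.+1 s' /\
    forall p, t j.+1 p = rdiff Q j.+1 (s' p) + sval s (rdiff P j p)}.
  apply: cid; case: s => s oks /=.
  (* The next homotopy must lift [t - s d], which is a cycle by the condition carried with [s]. *)
  pose f (p : robj P j.+1) := t j.+1 p - s (rdiff P j p) : robj Q j.+1.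
  have hf : is_ghom f.
    apply: is_ghom_gact.
    - apply: linear_sub; first exact: (ghom_fun_linear (t j.+1)).
      exact: (linear_comp (ghom_fun_linear s) (ghom_fun_linear (rdiff P j))).
    - by move=> p v; rewrite /f !ghom_gact gactDr gactNr.
    - move=> i v hv; apply: gdegD; last apply: gdegN.
        by case: (ghomP (t j.+1)) => _ _ _; apply.
      case: (ghomP s) => _ _ _; apply.
      by case: (ghomP (rdiff P j)) => _ _ _; apply.
  have [|s' hs'] := @rlift _ j.+1 (mkghom hf) (@robj_proj _ _ P j.+1).
    move=> p; rewrite /rcyc /= -[mkghom hf p]/(f p) /f.
    by rewrite (linearB (ghom_fun (rdiff Q j))) /= ht oks subrr.
  exists s'; split=> p; rewrite hs' -[mkghom hf _]/(f _) /f; last by rewrite subrK.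
  have -> : rdiff P j (rdiff P j.+1 p) = 0 by apply/rexact; exists p.
  by rewrite linear0 subr0.
pose s := nat_rect (fun j => {s | ok j s}) (exist _ s0 ok0)
  (fun j s => exist _ (sval (step j s)) (svalP (step j s)).1).
exists (fun j => sval (s j)); split=> [p|j p]; first exact/esym/hs0.
exact: (svalP (step j (s j))).2.
Qed.
End Lift.

Section ExtCompare.
Variables (X : gbimod n) (P Q : gresolution X) (M : gbimod n).

Definition ext_cocycle (P : gresolution X) j (v : ghom (robj P j) M) : Prop :=
  forall p, v (rdiff P j p) = 0.
Definition ext_coboundary (P : gresolution X) j : ghom (robj P j) M -> Prop :=
  match j return ghom (robj P j) M -> Prop with
  | 0 => fun v => forall p, v p = 0
  | j'.+1 => fun v => exists u : ghom (robj P j') M, forall p, v p = u (rdiff P j' p)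
  end.

(** An endomorphism over the identity of [X] is homotopic to the identity, and composing a homotopy
    with a cocycle gives a coboundary. *)
Lemma ext_endo (t : forall j, ghom (robj P j) (robj P j)) j (v w : ghom (robj P j) M) :
  is_chain_map t -> (forall p, raug P (t 0 p) = raug P p) ->
  ext_cocycle v -> (forall p, w p = v (t j p) - v p) -> ext_coboundary w.
Proof.
move=> ht t0 hv hw.
pose f k (p : robj P k) := t k p - p : robj P k.
have hf k : is_ghom (f k).
  apply: is_ghom_gact.
  - by apply: linear_sub; first exact: (ghom_fun_linear (t k)).
  - by move=> p x; rewrite /f !ghom_gact gactDr gactNr.
  - move=> i x hx; apply: gdegD; last exact: gdegN.
    by case: (ghomP (t k)) => _ _ _; apply.
have [||s [s0 sS]] := @homotopy_ex X P P (fun k => mkghom (hf k)).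
- move=> k p; rewrite -![mkghom (hf _) _]/(f _ _) /f.
  by rewrite (linearB (ghom_fun (rdiff P k))) /= ht.
- move=> p; rewrite -![mkghom (hf _) _]/(f _ _) /f.
  by rewrite (linearB (ghom_fun (raug P))) /= t0 subrr.
have E p : w p = v (f j p) by rewrite hw /f (linearB (ghom_fun v)).
case: j v w hv hw E => [|j] v w hv hw E.
  by move=> p; rewrite E [f 0 p]s0 hv.
exists (gcomp v (s j)) => p.
by rewrite E [f j.+1 p]sS (linearD (ghom_fun v)) /= hv add0r.
Qed.

Variables (t : forall j, ghom (robj P j) (robj Q j)).
Hypotheses (ht : is_chain_map t) (t0 : forall p, raug Q (t 0 p) = raug P p).

(** Precompose with a comparison map in the opposite direction; the round trip is an endomorphism
    over the identity. *)
Lemma ext_comp_surj j (v : ghom (robj P j) M) : ext_cocycle v ->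
  exists w : ghom (robj Q j) M, ext_cocycle w /\ ext_coboundary (gcomp w (t j) - v).
Proof.
move=> hv; have [t' [t'0 ht']] := chain_map_ex Q P.
exists (gcomp v (t' j)); split=> [p|].
  by rewrite -[LHS]/(v (t' j (rdiff Q j p))) -ht' hv.
apply: (@ext_endo (fun j => gcomp (t' j) (t j)) _ v _) => //.
- by move=> k p; rewrite -[LHS]/(rdiff P k (t' k.+1 (t k.+1 p))) ht' ht.
- by move=> p; rewrite -[LHS]/(raug P (t' 0 (t 0 p))) t'0 t0.
Qed.
End ExtCompare.

Lemma ext_comp_inj (X : gbimod n) (P Q : gresolution X) (M : gbimod n)
    (t : forall j, ghom (robj P j) (robj Q j)) : is_chain_map t ->
  (forall p, raug Q (t 0 p) = raug P p) -> forall j (w : ghom (robj Q j) M),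
  ext_cocycle w -> ext_coboundary (gcomp w (t j)) -> ext_coboundary w.
Proof.
move=> ht t0 j w hw; have [t' [t'0 ht']] := chain_map_ex Q P.
have /= H := @ext_endo X Q M (fun j => gcomp (t j) (t' j)) j w (gcomp w (gcomp (t j) (t' j)) - w).
have {}H : ext_coboundary (gcomp w (gcomp (t j) (t' j)) - w).
  apply: H => //.
  - by move=> k p; rewrite -[LHS]/(rdiff Q k (t k.+1 (t' k.+1 p))) ht ht'.
  - by move=> p; rewrite -[LHS]/(raug Q (t 0 (t' 0 p))) t0 t'0.
case: j w hw H => [|j] w hw H /=.
  move=> h p; have := H p; rewrite -[LHS]/(w (t 0 (t' 0 p)) - w p).
  by rewrite [w _]h sub0r => /eqP; rewrite oppr_eq0 => /eqP.
move=> [u hu]; have [u' hu'] := H.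
exists (gcomp u (t' j) - u') => p.
rewrite -[RHS]/(u (t' j (rdiff Q j p)) - u' (rdiff Q j p)) -hu' -ht' -hu.
rewrite -[X in _ = _ - X]/(w (t j.+1 (t' j.+1 p)) - w p).
by rewrite opprB addrC subrK.
Qed.
End Comparison.

(** * Linear isomorphisms and homology *)

Lemma choice_dep (T : Type) (X : T -> Type) (P : forall t, X t -> Prop) :
  (forall t, exists x, P t x) -> exists f : forall t, X t, forall t, P t (f t).
Proof. by move=> h; exists (fun t => sval (cid (h t))) => t; apply: svalP. Qed.

Section SpanIso.
Variables (Z A B : lmodType rat) (a : {linear Z -> A}) (b : {linear Z -> B}).
Hypotheses (a_surj : forall y, exists z, a z = y) (b_surj : forall y, exists z, b z = y).
Hypothesis ker_ab : forall z, a z = 0 <-> b z = 0.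

(** Equal kernels make the choice of preimages irrelevant. The equation determines [phi], so
    naturality can later be checked on [Z]. *)
Lemma span_iso : exists phi : {linear A -> B}, bijective phi /\ forall z, phi (a z) = b z.
Proof.
have [s hs] := choice a_surj; have [t ht] := choice b_surj.
have E z : b (s (a z)) = b z.
  by apply/eqP; rewrite -subr_eq0 -(linearB b); apply/eqP/ker_ab; rewrite (linearB a) /= hs subrr.
have F z : a (t (b z)) = a z.
  by apply/eqP; rewrite -subr_eq0 -(linearB a); apply/eqP/ker_ab; rewrite (linearB b) /= ht subrr.
have lin : linear (fun x => b (s x)).
  by move=> c u v; rewrite -{1}(hs u) -{1}(hs v) -(linearP a) E (linearP b).
exists (mklin lin); split=> [|z]; last exact: E.
exists (fun y => a (t y)) => x /=; last by rewrite /mklin_fun E ht.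
by rewrite /mklin_fun F hs.
Qed.
End SpanIso.

Lemma linear_iso_refl V : linear_iso V V.
Proof. by exists (mklin (fun c u v => erefl : (c *: u + v) = (c *: u + v))); exists id. Qed.
Lemma linear_iso_sym V W : linear_iso V W -> linear_iso W V.
Proof.
move=> [phi [psi hp hq]].
have lin : linear psi.
  by move=> c u v; apply: (can_inj hp); rewrite hq linearP !hq.
by exists (mklin lin); exists phi.
Qed.
Lemma linear_iso_trans U V W : linear_iso U V -> linear_iso V W -> linear_iso U W.
Proof.
move=> [f bf] [g bg].
have lin : linear (g \o f) by move=> c u v /=; rewrite !linearP.
by exists (mklin lin); apply: bij_comp.
Qed.

Section HomologyIso.
Variables (U V W : lmodType rat) (f : {linear U -> V}) (g : {linear V -> W}).
Variables (U' V' W' : lmodType rat) (f' : {linear U' -> V'}) (g' : {linear V' -> W'}).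

(** The two conditions besides bijectivity stand in for isomorphisms of the outer terms: they let
    the inverse of [b] act on homology. *)
Lemma hmap_bij (b : {linear V -> V'}) bZ bB : bijective b ->
  (forall v, g' (b v) = 0 -> g v = 0) -> (forall u', exists u, b (f u) = f' u') ->
  bijective (@hmap U V W f g U' V' W' f' g' b bZ bB).
Proof.
move=> [c bc cb] hZ hB.
have lin : linear c by move=> k u v; apply: (can_inj bc); rewrite cb linearP !cb.
have cZ v : g' v = 0 -> g (mklin lin v) = 0.
  by move=> h; apply: hZ; rewrite /= cb.
have cB u' : exists u, f u = mklin lin (f' u').
  by have [u hu] := hB u'; exists u; rewrite -hu /= /mklin_fun bc.
exists (hmap (mklin lin) cZ cB) => x; rewrite -(qreprK x) !hmapE; congr qpi;
  apply: val_inj => /=; [exact: bc | exact: cb].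
Qed.
End HomologyIso.

Section ProductHomology.
Variables (I : Type) (U V W : I -> lmodType rat).

Definition dmap_fun (X Y : I -> lmodType rat) (f : forall i, {linear X i -> Y i})
  (x : dprod X) : dprod Y := fun i => f i (x i).
Fact dmap_linear X Y f : linear (@dmap_fun X Y f).
Proof.
move=> c u v; apply: functional_extensionality_dep => i.
by rewrite /dmap_fun; apply: linearP.
Qed.
HB.instance Definition _ X Y f := GRing.isLinear.Build rat (dprod X) (dprod Y) _
  (@dmap_fun X Y f) (@dmap_linear X Y f).
Definition dmap X Y f : {linear dprod X -> dprod Y} := @dmap_fun X Y f.

Lemma dmapE X Y f x i : @dmap X Y f x i = f i (x i). Proof. by []. Qed.

Variables (f : forall i, {linear U i -> V i}) (g : forall i, {linear V i -> W i}).

Let cyc0 (z : cycles (dmap g)) i : g i ((val z : dprod V) i) = 0.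
Proof. exact: (congr1 (fun h : dprod W => h i) (cycleP z)). Qed.

Let pr (z : cycles (dmap g)) : dprod (fun i => homology (f i) (g i)) :=
  fun i => qpi _ (mkcycle (cyc0 z i)).
Let pr_linear : linear pr.
Proof.
move=> c u v; apply: functional_extensionality_dep => i.
rewrite [RHS](_ : _ = c *: pr u i + pr v i) // /pr -linearP; congr qpi.
exact: val_inj.
Qed.

Lemma homology_dprod : linear_iso (homology (dmap f) (dmap g))
  (dprod (fun i => homology (f i) (g i))).
Proof.
have [|||phi [bphi _]] := @span_iso _ _ _ (qpi (boundary_subspace (dmap f) (dmap g))) (mklin pr_linear).
- by move=> y; exists (qrepr y); apply: qreprK.
- move=> y; pose v : dprod V := fun i => val (qrepr (y i)).
  have gv : dmap g v = 0.
    by apply: functional_extensionality_dep => i; apply: (cycleP (qrepr (y i))).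
  exists (mkcycle gv); apply: functional_extensionality_dep => i.
  rewrite -[RHS]qreprK /= /mklin_fun /pr; congr qpi; exact: val_inj.
- move=> z; rewrite -[0 in X in X <-> _](linear0 (qpi (boundary_subspace (dmap f) (dmap g)))).
  split=> [/qpiP|].
    rewrite subr0 => -[u hu]; apply: functional_extensionality_dep => i.
    rewrite -[RHS](linear0 (qpi _)); apply/qpiP; rewrite subr0; exists (u i).
    by rewrite /= -hu.
  move=> h; apply/qpiP; rewrite subr0.
  have /choice_dep : forall i, exists u, f i u = (val z : dprod V) i.
    move=> i; have hi : pr z i = 0 := congr1 (fun h : dprod _ => h i) h.
    move: hi; rewrite /pr -[RHS](linear0 (qpi (boundary_subspace (f i) (g i)))).
    by move=> /qpiP; rewrite subr0 => -[u hu]; exists u.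
  move=> [u hu]; exists u; apply: functional_extensionality_dep => i; exact: hu.
by exists phi.
Qed.
End ProductHomology.

Lemma dprod_restrict (T : Type) (p : pred T) (X : {x | p x} -> lmodType rat)
    (Y : T -> lmodType rat) :
  (forall s, linear_iso (Y (val s)) (X s)) ->
  (forall x, ~~ p x -> forall y : Y x, y = 0) ->
  linear_iso (dprod Y) (dprod X).
Proof.
move=> isoXY triv.
have /choice_dep [phi hphi] := isoXY.
pose F (y : dprod Y) : dprod X := fun s => phi s (y (val s)).
have lin : linear F.
  move=> c u v; apply: functional_extensionality_dep => s.
  by rewrite /F; apply: linearP.
have /choice_dep [psi hpsi] : forall s, exists psi : X s -> Y (val s),
    cancel (phi s) psi /\ cancel psi (phi s).
  by move=> s; have [psi h1 h2] := hphi s; exists psi.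
pose G (x : dprod X) : dprod Y := fun t =>
  match pselect (p t) with
  | left h => psi (exist _ t h) (x (exist _ t h))
  | right _ => 0
  end.
exists (mklin lin); exists G => [y|x] /=; apply: functional_extensionality_dep => t.
  rewrite /G; case: (pselect (p t)) => [h|/negP h]; first exact: (hpsi (exist _ t h)).1.
  by rewrite [RHS]triv.
rewrite /mklin_fun /F /G; case: t => t h /=.
case: (pselect (p t)) => [h'|//].
rewrite (bool_irrelevance h' h); exact: (hpsi (exist _ t h)).2.
Qed.

Lemma qpi_eq0 (V : lmodType rat) (P : V -> Prop) (hP : subspace P) x :
  qpi hP x = 0 <-> P x.
Proof.
have E : qpi hP 0 = 0 := linear0 (qpi hP).
by split=> h; [have /qpiP : qpi hP x = qpi hP 0 by rewrite h E | rewrite -E; apply/qpiP];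
  rewrite subr0.
Qed.

Lemma kI_linear (A : comNzRingType) (M N : smod A) (iota : nat -> {linear N -> N})
    (top : {linear M -> N}) r c (u v : bitseq -> M) :
  kI iota top r (fun b => c *: u b + v b) = c *: kI iota top r u + kI iota top r v.
Proof.
elim: r u v => [|r IH] u v; first exact: linearP.
by rewrite !kIS !IH (linearP (iota r)) scalerDr addrACA.
Qed.

Lemma homology_eq (U V W : lmodType rat) (f : {linear U -> V}) (g : {linear V -> W})
    (z z' : cycles g) : (exists u, f u = val z - val z') ->
  qpi (boundary_subspace f g) z = qpi (boundary_subspace f g) z'.
Proof. by move=> [u hu]; apply/qpiP; exists u; rewrite hu raddfB. Qed.

(** * Hochschild cohomology of sums of copies of B *)

Section ExtBoundary.
Variables (n : nat) (X : gbimod n) (P : gresolution X) (M : gbimod n) (j : nat).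

Lemma ext_cocycleP (v : ghom (robj P j) M) : ext_cocycle v <-> ext_out P M j v = 0.
Proof.
split=> [h|h p]; first exact: ghom_eq.
by rewrite -[LHS]/(ghom_fun (ext_out P M j v : ghom _ _) p) h.
Qed.

Lemma ext_boundaryP (z : cycles (ext_out P M j)) :
  boundary (ext_in P M j) z <-> ext_coboundary (val z : ghom (robj P j) M).
Proof.
case: j z => [|k] z; split.
- by move=> [u <-] p.
- by move=> h; exists 0; apply: ghom_eq => p; rewrite h.
- by move=> [u <-]; exists u.
- by move=> [u hu]; exists u; apply: ghom_eq => p; rewrite hu.
Qed.

Lemma ext_class_eq (z z' : cycles (ext_out P M j)) :
  ext_coboundary ((val z : ghom (robj P j) M) - val z') ->
  qpi (boundary_subspace (ext_in P M j) (ext_out P M j)) z = qpi (boundary_subspace _ _) z'.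
Proof.
case: j z z' => [|k] z z' h; apply: homology_eq.
  by exists 0; apply: ghom_eq => p; rewrite h.
by have [u hu] := h; exists u; apply: ghom_eq => p; rewrite hu.
Qed.

Lemma ext_coboundaryB (v w : ghom (robj P j) M) :
  ext_coboundary v -> ext_coboundary w -> ext_coboundary (v - w).
Proof.
case: j v w => [|k] v w /=.
  by move=> hv hw p; rewrite -[LHS]/(v p - w p) hv hw subrr.
by move=> [a ha] [b hb]; exists (a - b) => p; rewrite -[LHS]/(v p - w p) ha hb.
Qed.
End ExtBoundary.

(** * Ext classes from families indexed by bit sequences *)

Section Generators.
Variable n : nat.
Local Notation Re := {mpoly rat[n + n]}.

Definition Bobj (M : gbimod n) : Prop := fin_gen M /\ sum_of_B M.
Lemma Bobj_sym M : Bobj M -> symmetric_bim M.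
Proof. by case=> _; apply: symmetric_sum_of_B. Qed.

Section Cochains.
Variables (M : gbimod n) (j i : int).

(** Sequences of every length are allowed as indices; only those of length [n] enter [sI]. *)
Definition bfam : lmodType rat := dprod (fun _ : bitseq => gcar M).

Definition homog_fam (z : bfam) : Prop := forall b, zproj j i z b = z b.

Lemma zproj_linear c (u v : bfam) b : zproj j i (c *: u + v) b =
  c *: zproj j i u b + zproj j i v b.
Proof.
rewrite /zproj; case: eqP => _; last by rewrite scaler0 addr0.
exact: gproj_linear.
Qed.
Lemma zprojK (z : bfam) b : zproj j i (zproj j i z) b = zproj j i z b.
Proof.
rewrite /zproj; case: eqP => // _; apply: gproj_id; exact: gproj_deg.
Qed.

Lemma homog_fam_subspace : subspace homog_fam.
Proof.
split=> [b|c u v hu hv b]; last by rewrite zproj_linear hu hv.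
by rewrite /zproj; case: eqP => // _; rewrite (linear_fun0 (gproj_linear _)).
Qed.

Definition hfam : lmodType rat := subsp homog_fam_subspace.
Lemma hfamP (x : hfam) : homog_fam (val x).
Proof. exact/(subspace_predP homog_fam_subspace)/(valP x). Qed.
Definition mkhfam z (hz : homog_fam z) : hfam :=
  exist _ z (introT (subspace_predP homog_fam_subspace z) hz).

Lemma sI_homog z : homog_fam z -> kproj M n j i (@sI n (gsmod M) z) = @sI n (gsmod M) z.
Proof. by move=> hz; rewrite kproj_kI //; apply: kI_eq => b _; apply: hz. Qed.
Lemma sI_linear c (u v : bfam) : @sI n (gsmod M) (c *: u + v) =
  c *: @sI n (gsmod M) u + @sI n (gsmod M) v.
Proof.
exact: kI_linear.
Qed.
End Cochains.

Section Class.
Variables (M : gbimod n) (i : int) (P : gresolution (gshift (polybim n) i)).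
Variable t : forall j, ghom (robj P j) (robj (kresolution n i) j).
Hypotheses (ht : is_chain_map t) (t0 : forall p, raug (kresolution n i) (t 0 p) = raug P p).
Hypothesis hM : Bobj M.
Let hs := Bobj_sym hM.

Definition kcochain (j : nat) (x : hfam M j%:Z i) : ghom (robj (kresolution n i) j) M :=
  kghom (sI_homog (hfamP x)).
Definition pcochain j (x : hfam M j%:Z i) : ghom (robj P j) M :=
  gcomp (kcochain x) (t j).

Lemma kcochainE j (x : hfam M j%:Z i) p : kcochain x p = @kpair n M n j (@sI n (gsmod M) (val x)) p.
Proof. by []. Qed.

Lemma kcochain_cocycle j (x : hfam M j%:Z i) : ext_cocycle (kcochain x).
Proof.
move=> p; rewrite kcochainE -[rdiff _ _ p]/(@kbd n n j p) -kpair_kd.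
by rewrite (sd_sI hs) kpair0l.
Qed.
Lemma pcochain_cocycle j (x : hfam M j%:Z i) : ext_cocycle (pcochain x).
Proof.
move=> p; rewrite -[LHS]/(kcochain x (t j (rdiff P j p))) -ht.
exact: kcochain_cocycle.
Qed.

Definition class_fun j (x : hfam M j%:Z i) : Ext P j M :=
  qpi (boundary_subspace (ext_in P M j) (ext_out P M j))
    (mkcycle ((ext_cocycleP (pcochain x)).1 (pcochain_cocycle x))).

Fact class_linear j : linear (@class_fun j).
Proof.
move=> c u v; rewrite /class_fun -linearP; congr qpi; apply: val_inj.
apply: ghom_eq => p; rewrite -[LHS]/(kpair (@sI n (gsmod M) (c *: val u + val v)) (t j p)).
rewrite sI_linear; exact: kpair_linear_l.
Qed.
HB.instance Definition _ j := GRing.isLinear.Build rat (hfam M j%:Z i) (Ext P j M) _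
  (@class_fun j) (@class_linear j).

Lemma coboundary_comp j (w : ghom (robj (kresolution n i) j) M) :
  ext_coboundary w -> ext_coboundary (gcomp w (t j)).
Proof.
case: j w => [|j] w /=; first by move=> h p; rewrite -[LHS]/(w (t 0 p)) h.
move=> [u hu]; exists (gcomp u (t j)) => p.
by rewrite -[LHS]/(w (t j.+1 p)) hu ht.
Qed.

(** The differential commutes with the projections, so a primitive may be replaced by its component
    of Koszul degree [j - 1], which is zero for [j = 0]. *)
Lemma graded_exact (j : nat) c u : kproj M n j%:Z i c = c -> c = sd (gsmod M) u ->
  forall E : kproj M n j%:Z i c = c, ext_coboundary (kghom E : ghom (robj (kresolution n i) j) M).
Proof.
move=> hc hu E; have Ec : c = sd (gsmod M) (kproj M n (j%:Z - 1) i u).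
  by rewrite -kproj_kd subrK -[kd _ _ _ _]/(sd _ u) -hu hc.
case: j hc E Ec => [|j] hc E Ec.
  move=> p; rewrite -[LHS]/(@kpair n M n 0 c p) Ec kproj_neg // linear0.
  exact: kpair0l.
have ej : j.+1%:Z - 1 = j%:Z by rewrite -addn1 PoszD addrK.
rewrite ej in Ec; exists (kghom (kprojK j%:Z i u)) => p.
by rewrite -[LHS]/(@kpair n M n j.+1 c p) Ec; apply: kpair_kd.
Qed.

(** A cocycle on [P] is moved to the Koszul resolution and read as a cochain [c] of bidegree
    [(j, i)]. [sd_cohomology] supplies a family, and its homogeneous part represents the same
    class. *)
Lemma class_surj j y : exists x, @class_fun j x = y.
Proof.
rewrite -(qreprK y); move: (qrepr y) => {}y.
have hy : ext_cocycle (val y : ghom _ _) by apply/ext_cocycleP/cycleP.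
have [w [hw hb]] := ext_comp_surj ht t0 hy.
have [Ec wE] := kev_ghom (w : ghom (gshift (kres n n j) i) M).
set c := kev _ in Ec wE.
have dc : sd (gsmod M) c = 0.
  have Ed : kproj M n j.+1%:Z i (sd (gsmod M) c) = sd (gsmod M) c.
    by rewrite -addn1 PoszD kproj_kd Ec.
  rewrite -(kev_kpair Ed) (_ : @kpair n M n j.+1 _ = fun=> 0).
    have := kev_kpair (_ : kproj M n j.+1%:Z i 0 = 0); rewrite linear0 => /(_ erefl) <-.
    by congr (kev _); apply/funext => p; rewrite kpair0l.
  by apply/funext => p; rewrite [LHS]kpair_kd wE; apply: hw.
have [z [u Ezu]] := (sd_cohomology hM.1 hM.2).1 c dc.
pose z' : bfam M := zproj j%:Z i z.
have hz' : homog_fam j%:Z i z' by move=> b; apply: zprojK.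
exists (mkhfam hz'); apply: ext_class_eq; rewrite [X in X - _]/=.
have -> : pcochain (mkhfam hz') - val y = (gcomp w (t j) - val y) -
    gcomp (w - kcochain (mkhfam hz')) (t j).
  apply: ghom_eq => p.
  rewrite -[LHS]/(kcochain (mkhfam hz') (t j p) - (val y : ghom _ _) p).
  rewrite -[RHS]/((w (t j p) - (val y : ghom _ _) p) - (w (t j p) - kcochain (mkhfam hz') (t j p))).
  by zmod.
apply: ext_coboundaryB => //; apply: coboundary_comp.
have Ed : kproj M n j%:Z i (c - @sI n (gsmod M) z') = c - @sI n (gsmod M) z'.
  by rewrite linearB /= Ec sI_homog.
have Eu : c - @sI n (gsmod M) z' = sd (gsmod M) (kproj M n (j%:Z - 1) i u).
  rewrite -kproj_kd subrK -[in LHS]Ec [in LHS]Ezu linearD /= kproj_kI //.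
  by rewrite -[kI _ _ _ _]/(@sI n (gsmod M) z') addrC addKr.
have := graded_exact Ed Eu Ed; congr ext_coboundary; apply: ghom_eq => p.
rewrite -[LHS]/(@kpair n M n j (c - @sI n (gsmod M) z') p) kpairBl wE.
by [].
Qed.

Lemma class0P j x : @class_fun j x = 0 <-> ext_coboundary (pcochain x).
Proof. exact: iff_trans (qpi_eq0 _ _) (ext_boundaryP _). Qed.

(** The criterion mentions neither the resolution nor the degrees, so kernels in different
    Hochschild degrees become comparable. *)
Lemma class_ker j x : @class_fun j x = 0 <->
  forall b, size b = n -> idspan (@sact Re (gsmod M)) (fdiff n) n ((val x : bfam M) b).
Proof.
split=> [/class0P|h].
  move=> /(ext_comp_inj ht t0 (kcochain_cocycle x)) hb.
  suff [u hu] : exists u, @sI n (gsmod M) (val x) = sd (gsmod M) u.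
    exact: (sd_cohomology hM.1 hM.2).2 hu.
  have Ex := sI_homog (hfamP x).
  case: j x hb Ex => [|j] x hb Ex.
    exists 0; rewrite linear0 -(kev_kpair Ex).
    have := kev_kpair (_ : kproj M n 0 i 0 = 0); rewrite linear0 => /(_ erefl) <-.
    by congr (kev _); apply/funext => p; rewrite kpair0l; apply: hb.
  have [u hu] := hb; have [Eu uE] := kev_ghom (u : ghom (gshift (kres n n j) i) M).
  exists (@kev n M n j u); rewrite -(kev_kpair Ex).
  have Ed : kproj M n j.+1%:Z i (sd (gsmod M) (kev u)) = sd (gsmod M) (kev u).
    by rewrite -addn1 PoszD kproj_kd Eu.
  rewrite -[RHS](kev_kpair Ed); congr (kev _); apply/funext => p.
  by rewrite [RHS]kpair_kd uE; apply: hu.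
have [u hu] := sI_exact hs h.
apply/class0P/coboundary_comp.
exact: (graded_exact (sI_homog (hfamP x)) hu).
Qed.
End Class.
End Generators.

(** * Splitting into pieces of Hochschild degree zero *)

Section Decomposition.
Variable n : nat.
Local Notation Re := {mpoly rat[n + n]}.

Definition degpart (M : gbimod n) (k : int) : lmodType rat :=
  subsp (gdeg_subspace (gbimodP M) k).
Lemma degpartP (M : gbimod n) k (m : degpart M k) : gdeg k (val m).
Proof. exact/(subspace_predP (gdeg_subspace (gbimodP M) k))/(valP m). Qed.
Definition mkdeg (M : gbimod n) k (m : M) (hm : gdeg k m) : degpart M k :=
  exist _ m (introT (subspace_predP (gdeg_subspace (gbimodP M) k) m) hm).

Local Notation trues := (nseq n true).

(** Equal to [- n (n - 1)] *)
Definition qshift : int := (2 * n)%:Z - (2 * bweight n trues)%:Z.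

Section TopClass.
Variables (M : gbimod n) (i : int).

(** In Hochschild degree 0 all [n] contractions are applied, so only the constant sequence carries
    an element. *)
Definition topfam_fun (m : degpart M (i + qshift)) : bfam M :=
  fun b => if b == trues then val m else 0.
Lemma topfam_homog m : homog_fam 0 i (topfam_fun m).
Proof.
move=> b; rewrite /zproj /topfam_fun; case: (eqVneq b trues) => [->|_]; last first.
  by case: eqP => // _; rewrite (linear_fun0 (gproj_linear _)).
rewrite count_nseq mul1n add0r eqxx gproj_id //.
have -> : i - (2 * bweight n trues)%:Z + (2 * n)%:Z = i + qshift by rewrite /qshift; zmod.
exact: degpartP.
Qed.
Definition topfam (m : degpart M (i + qshift)) : hfam M 0 i := mkhfam (topfam_homog m).
Fact topfam_linear : linear topfam.
Proof.
move=> c u v; apply: val_inj; apply: functional_extensionality_dep => b.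
rewrite [RHS](_ : _ = c *: topfam_fun u b + topfam_fun v b) //.
rewrite [LHS]/(topfam_fun _ b) /topfam_fun; case: eqP => _ //.
by rewrite scaler0 addr0.
Qed.
HB.instance Definition _ := GRing.isLinear.Build rat _ _ _ topfam topfam_linear.
End TopClass.

Variable P : forall i : int, gresolution (gshift (polybim n) i).

Definition ptok i : {t : forall j, ghom (robj (P i) j) (robj (kresolution n i) j) |
    (forall p, raug (kresolution n i) (t 0 p) = raug (P i) p) /\ is_chain_map t} :=
  cid (chain_map_ex (P i) (kresolution n i)).

Definition cls (M : gbimod n) (hM : Bobj M) (i : int) (j : nat) :
    {linear hfam M j%:Z i -> HH P i j M} :=
  @class_fun n M i (P i) (sval (ptok i)) (svalP (ptok i)).2 hM j.

Lemma cls_surj M (hM : Bobj M) i j y : exists x, cls hM i j x = y.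
Proof. exact: (class_surj (svalP (ptok i)).2 (svalP (ptok i)).1). Qed.

Lemma cls_ker M (hM : Bobj M) i j x : cls hM i j x = 0 <->
  forall b, size b = n -> idspan (@sact Re (gsmod M)) (fdiff n) n ((val x : bfam M) b).
Proof. exact: (class_ker (svalP (ptok i)).2 (svalP (ptok i)).1). Qed.

Section Naturality.
Variables (M N : gbimod n) (f : ghom M N).

Lemma fam_map_homog j i (x : hfam M j i) :
  homog_fam j i ((fun b => f ((val x : bfam M) b)) : bfam N).
Proof.
move=> b; rewrite -[in RHS]hfamP /zproj; case: eqP => _; last by rewrite linear0.
exact: gproj_ghom.
Qed.
Definition fam_map j i (x : hfam M j i) : hfam N j i := mkhfam (fam_map_homog x).

Lemma cls_nat (hM : Bobj M) (hN : Bobj N) i j x :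
  HH_map P i j f (cls hM i j x) = cls hN i j (fam_map x).
Proof.
have E z : Ext_map (P i) f j (qpi (boundary_subspace _ _) z) =
    qpi (boundary_subspace _ _) (cmap (@ext_map_cycle _ _ (P i) _ _ f j) z) by exact: hmapE.
apply: etrans (E _) _; congr qpi; apply: val_inj; apply: ghom_eq => p.
rewrite -[LHS]/(f (@kpair n M n j (@sI n (gsmod M) (val x)) (sval (ptok i) j p))).
rewrite -[RHS]/(@kpair n N n j (@sI n (gsmod N) (fun b => f ((val x : bfam M) b)))
  (sval (ptok i) j p)).
rewrite -kpair_kmap; congr kpair.
apply: kmap_kI; exact: ghom_gact.
Qed.

Lemma deg_map_homog k (m : degpart M k) : gdeg k (f (val m)).
Proof. by case: (ghomP f) => _ _ _; apply; apply: degpartP. Qed.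
Definition deg_map k (m : degpart M k) : degpart N k := mkdeg (deg_map_homog m).

Lemma topfam_nat i m : fam_map (@topfam M i m) = topfam (deg_map m).
Proof.
apply: val_inj; apply: functional_extensionality_dep => b.
rewrite -[LHS]/(f (topfam_fun m b)) -[RHS]/(topfam_fun (deg_map m) b) /topfam_fun.
by case: eqP => _ //; rewrite linear0.
Qed.
End Naturality.

Definition top_cls M (hM : Bobj M) i (m : degpart M (i + qshift)) : HH P i 0 M :=
  cls hM i 0 (topfam m).
Fact top_cls_linear M (hM : Bobj M) i : linear (@top_cls M hM i).
Proof. by move=> c u v; rewrite /top_cls topfam_linear linearP. Qed.
HB.instance Definition _ M hM i := GRing.isLinear.Build rat _ _ _
  (@top_cls M hM i) (@top_cls_linear M hM i).

Lemma hfam_out (M : gbimod n) j i (x : hfam M j i) b : j + (count id b)%:Z != n%:Z ->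
  (val x : bfam M) b = 0.
Proof. by rewrite -(hfamP x b) /zproj => /negbTE ->. Qed.

Lemma count_trues b : size b = n -> b != trues -> 0 + (count id b)%:Z != n%:Z.
Proof.
move=> sb; apply: contra; rewrite add0r eqz_nat -{1}sb -all_count => h.
rewrite -sb; apply/eqP/all_pred1P.
by apply: sub_all h => -[].
Qed.

Lemma top_cls_ker M (hM : Bobj M) i m : @top_cls M hM i m = 0 <->
  idspan (@sact Re (gsmod M)) (fdiff n) n (val m : M).
Proof.
apply: iff_trans (cls_ker _ _) _; split=> [h|h b sb].
  by have := h trues (size_nseq _ _); rewrite /= /topfam_fun eqxx.
by rewrite /= /topfam_fun; case: eqP => // _; apply: (@span0 Re (gsmod M)).
Qed.

Lemma top_cls_surj M (hM : Bobj M) i y : exists m, @top_cls M hM i m = y.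
Proof.
have [x <-] := cls_surj hM y.
have hx : gdeg (i + qshift) ((val x : bfam M) trues).
  rewrite -(hfamP x trues) /zproj count_nseq mul1n add0r eqxx.
  have -> : i + qshift = i - (2 * bweight n trues)%:Z + (2 * n)%:Z by rewrite /qshift; zmod.
  exact: gproj_deg.
exists (mkdeg hx); apply/eqP; rewrite -subr_eq0.
rewrite -[top_cls hM _]/(cls hM i 0 (topfam (mkdeg hx))) -(linearB (cls hM i 0)).
apply/eqP/cls_ker => b sb.
rewrite [X in idspan _ _ _ X](_ : _ = topfam_fun (mkdeg hx) b - (val x : bfam M) b) //.
rewrite /topfam_fun; case: (eqVneq b trues) => [->|nb].
  by rewrite subrr; apply: (@span0 Re (gsmod M)).
rewrite (hfam_out _ (count_trues sb nb)) subrr.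
exact: (@span0 Re (gsmod M)).
Qed.

Lemma top_cls_nat M N (f : ghom M N) (hM : Bobj M) (hN : Bobj N) i m :
  HH_map P i 0 f (@top_cls M hM i m) = top_cls hN (deg_map f m).
Proof. by rewrite /top_cls cls_nat topfam_nat. Qed.

(** The factor [xi_S] of the exterior algebra comes from the contractions
    indexed by the complement of [S]. *)
Definition bits (S : {set 'I_n}) : bitseq := [seq k \notin S | k <- enum 'I_n].
Definition sweight (S : {set 'I_n}) : int := \sum_(k in S) (2 * k.+1)%:Z.

Lemma size_bits S : size (bits S) = n.
Proof. by rewrite size_map size_enum_ord. Qed.
Lemma count_bits (S : {set 'I_n}) : (#|S| + count id (bits S) = n)%N.
Proof.
rewrite -[RHS](card_ord n) -(cardC (mem S)); congr (_ + _)%N.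
rewrite cardE /bits count_map -size_filter enumT /enum_mem.
by congr size; apply: eq_filter => k.
Qed.
(** Position [k] of a sequence of length [n] stands for the contraction of index [n - 1 - k], of
    q-degree [2 (k + 1)]; the positions in [S] therefore account for the degree of [xi_S]. *)
Lemma bweight_bits (S : {set 'I_n}) : (2 * bweight n trues)%:Z = sweight S + (2 * bweight n (bits S))%:Z.
Proof.
have E b : (size b <= n)%N -> bweight n b =
    (\sum_(k < size b) if nth false b k then n - ((size b).-1 - k) else 0)%N.
  elim: b => [|x b IH] sb; first by rewrite big_ord0.
  rewrite big_ord_recl /= subn0 IH ?(ltnW sb) //; congr (_ + _)%N.
  apply: eq_bigr => k _; case: ifP => // _; congr (_ - _)%N.
  by rewrite /bump /= add1n subnS -!subn1 subnAC.
have F b : size b = n -> bweight n b = (\sum_(k < n) if nth false b k then k.+1 else 0)%N.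
  move=> sb; rewrite E ?sb //; apply: eq_bigr => k _; case: ifP => // _.
  have G m l : (l < m)%N -> (m - (m.-1 - l) = l.+1)%N.
    by case: m => //= m; rewrite ltnS => lm; rewrite subSn ?leq_subr // subKn.
  exact: G (ltn_ord k).
have -> : sweight S = (2 * \sum_(k in S) k.+1)%N%:Z.
  by rewrite /sweight big_distrr /= (big_morph Posz PoszD (erefl _)).
rewrite !F ?size_bits ?size_nseq // -PoszD -mulnDr.
congr (Posz (_ * _)); rewrite [\sum_(k in S) _]big_mkcond -big_split; apply: eq_bigr => k _.
rewrite nth_nseq ltn_ord /bits (nth_map k) ?size_enum_ord // nth_ord_enum.
by case: (k \in S); rewrite /= ?addn0 ?add0n.
Qed.

Section Split.
Variables (i : int) (j : nat).
Definition subsets := {S : {set 'I_n} | #|S| == j}.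

Section Object.
Variables (M : gbimod n) (hM : Bobj M).

Lemma fam_deg (x : hfam M j%:Z i) (S : subsets) :
  gdeg (i + sweight (val S) + qshift) ((val x : bfam M) (bits (val S))).
Proof.
rewrite -(hfamP x) /zproj; case: eqP => _; last exact: gdeg0.
have -> : i + sweight (val S) + qshift =
    i - (2 * bweight n (bits (val S)))%:Z + (2 * n)%:Z.
  by rewrite /qshift (bweight_bits (val S)); zmod.
exact: gproj_deg.
Qed.

(** Reads the entry at [bits S] as a class to which all contractions have been applied; those in [S]
    are the added ones, and they raise the q-degree by [sweight S]. *)
Definition split_fun (x : hfam M j%:Z i) :
    dprod (fun S : subsets => HH P (i + sweight (val S)) 0 M) :=
  fun S => top_cls hM (mkdeg (fam_deg x S)).
Fact split_linear : linear split_fun.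
Proof.
move=> c u v; apply: functional_extensionality_dep => S.
rewrite [RHS](_ : _ = c *: split_fun u S + split_fun v S) // /split_fun -top_cls_linear.
by congr top_cls; apply: val_inj.
Qed.
Definition splitting := mklin split_linear.

Lemma bitsP (b : bitseq) : size b = n -> exists S, b = bits S.
Proof.
move=> sb; exists [set k : 'I_n | ~~ nth false b k].
apply: (@eq_from_nth _ false); first by rewrite size_bits.
move=> k; rewrite sb => kn; rewrite /bits (nth_map (Ordinal kn)) ?size_enum_ord //.
by rewrite (nth_ord_enum _ (Ordinal kn)) inE negbK.
Qed.
Lemma bits_inj : injective bits.
Proof.
move=> S T E; apply/setP => k; have bE U : nth false (bits U) k = (k \notin U).
  by rewrite /bits (nth_map k) ?size_enum_ord // nth_ord_enum.
by apply: negb_inj; rewrite -!bE E.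
Qed.

Lemma splitting_surj y : exists x, splitting x = y.
Proof.
have /choice_dep [m hm] : forall S : subsets, exists m, top_cls hM m = y S.
  by move=> S; apply: top_cls_surj.
pose z : bfam M := fun b =>
  match pselect (exists S : subsets, b = bits (val S)) with
  | left h => val (m (projT1 (cid h)))
  | right _ => 0
  end.
have zE S : z (bits (val S)) = val (m S).
  rewrite /z; case: pselect => [h|]; last by case; exists S.
  by case: (cid h) => T /= /bits_inj e; have -> : T = S by apply: val_inj.
have hz : homog_fam j%:Z i z.
  move=> b; rewrite /zproj /z; case: pselect => [h|_]; last first.
    by case: eqP => // _; rewrite (linear_fun0 (gproj_linear _)).
  case: (cid h) => T /= ->.
  have -> : j%:Z + (count id (bits (val T)))%:Z == n%:Z.
    by rewrite -PoszD -[X in (X + _)%N](eqP (valP T)) count_bits.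
  apply: gproj_id.
  have <- : i + sweight (val T) + qshift = i - (2 * bweight n (bits (val T)))%:Z + (2 * n)%:Z.
    by rewrite /qshift (bweight_bits (val T)); zmod.
  exact: degpartP.
exists (mkhfam hz); apply: functional_extensionality_dep => S.
rewrite -hm; congr top_cls; apply: val_inj; exact: zE.
Qed.

(** Both conditions say that the entries at the [bits S] lie in the span of [fdiff]; those with
    [#|S|] different from [j] vanish by homogeneity. *)
Lemma splitting_ker x : cls hM i j x = 0 <-> splitting x = 0.
Proof.
apply: iff_trans (cls_ker _ _) _; split=> [h|h b sb].
  apply: functional_extensionality_dep => S; apply/top_cls_ker.
  exact/h/size_bits.
have [S ->] := bitsP sb.
have [hS|hS] := boolP (#|S| == j).
  apply/(top_cls_ker hM (mkdeg (fam_deg x (exist _ S hS)))).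
  exact: (congr1 (fun h : dprod _ => h (exist _ S hS)) h).
rewrite hfam_out; first exact: (@span0 Re (gsmod M)).
apply: contra hS; rewrite -PoszD eqz_nat => /eqP e.
by rewrite -(eqn_add2r (count id (bits S))) count_bits e.
Qed.

Lemma HH_split : exists phi : {linear HH P i j M ->
    dprod (fun S : subsets => HH P (i + sweight (val S)) 0 M)},
  bijective phi /\ forall x, phi (cls hM i j x) = splitting x.
Proof.
apply: span_iso; [exact: cls_surj | exact: splitting_surj | exact: splitting_ker].
Qed.
End Object.

Lemma splitting_nat M N (f : ghom M N) (hM : Bobj M) (hN : Bobj N) x :
  dmap (fun S : subsets => HH_map P (i + sweight (val S)) 0 f) (splitting hM x) =
  splitting hN (fam_map f x).
Proof.
apply: functional_extensionality_dep => S; rewrite dmapE.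
apply: etrans (top_cls_nat _ _ _ _) _; congr top_cls; exact: val_inj.
Qed.

(** On representing families the splitting visibly commutes with bimodule maps, so it is an
    isomorphism of complexes; homology then commutes with the product. *)
Lemma HHH_split (C : gcomplex n) k : Bcomplex C ->
  linear_iso (HHH_at P C i j k)
    (dprod (fun S : subsets => HHH_at P C (i + sweight (val S)) 0 k)).
Proof.
move=> hC; have hB l : Bobj (cobj C l) := hC l.
have /choice_dep [phi hphi] := fun l => HH_split (hB l).
have nat l l' y : dmap (fun S : subsets => HH_map P (i + sweight (val S)) 0 (cdiff C l l')) (phi l y) =
    phi l' (HH_map P i j (cdiff C l l') y).
  have [x <-] := cls_surj (hB l) y.
  by rewrite (hphi l).2 (splitting_nat _ _ (hB l')) (cls_nat _ _ (hB l')) (hphi l').2.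
apply: linear_iso_trans (homology_dprod _ _).
have bZ v : HH_map P i j (cdiff C k (k + 1)) v = 0 ->
    dmap (fun S : subsets => HH_map P (i + sweight (val S)) 0 (cdiff C k (k + 1))) (phi k v) = 0.
  by move=> h; rewrite nat h linear0.
have bB u : exists u', dmap (fun S : subsets => HH_map P (i + sweight (val S)) 0 (cdiff C (k - 1) k)) u' =
    phi k (HH_map P i j (cdiff C (k - 1) k) u).
  by exists (phi (k - 1) u); apply: nat.
exists (hmap (phi k) bZ bB); apply: hmap_bij => [|v|u'].
- exact: (hphi k).1.
- by rewrite nat => h; apply: (bij_inj (hphi (k + 1)).1); rewrite h linear0.
- have [psi h1 h2] := (hphi (k - 1)).1; exists (psi u').
  by rewrite -nat h2.
Qed.
End Split.
End Decomposition.

Section TensorWithR.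
Variable n : nat.
Local Notation Re := {mpoly rat[n + n]}.

(** * Hochschild degree zero *)

Lemma gactB (M : gbimod n) p q (m : M) : gact (p - q) m = gact p m - gact q m.
Proof. by apply: (addIr (gact q m)); rewrite subrK -gactDl subrK. Qed.

Lemma gactZr (M : gbimod n) c p (m : M) : gact p (c *: m) = c *: gact p m.
Proof. by have := @gact_linear n M p c m 0; rewrite addr0 gact0r addr0. Qed.

Lemma bact_bal (M : gbimod n) (m : M) : symmetric_bim M ->
  balanced (@symr n) (@syml n) (fun f g => lact f (ract m g)).
Proof.
move=> hM; have HM := gbimodP M; split=> [g|f c g g'|f [s hs] g].
- exact: (lact_linear_l HM).
- by rewrite (ract_linear_r HM) (lact_linear_r HM).
- rewrite /symr /syml /= [s * g]mulrC (lactM HM) (ractM HM).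
  by congr lact; apply: hM.
Qed.

Lemma bactE (M : gbimod n) (m : M) f g : symmetric_bim M ->
  bact (tens (@symr n) (@syml n) f g : Bbim n) m = lact f (ract m g).
Proof. by move=> hM; apply: (tliftE (bact_bal m hM) f g). Qed.

Lemma bact_linear (M : gbimod n) (m : M) : symmetric_bim M ->
  linear (fun b : Bbim n => bact b m).
Proof. by move=> hM; apply: (tlift_linear (bact_bal m hM)). Qed.

Lemma symmetric_polybim : symmetric_bim (polybim n).
Proof. by move=> s m _; apply: mulrC. Qed.

Section Object.
Variables (M : gbimod n) (hM : symmetric_bim M).
Let HM := gbimodP M.

Lemma rbt_lact r (m : M) : rbt (r : polybim n) m = rbt (1 : polybim n) (lact r m).
Proof.
have := tens_bal (@ractB n) (@bact n M) (1 : polybim n) (tens (@symr n) (@syml n) r 1 : Bbim n) m.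
rewrite /ractB (bactE _ _ _ symmetric_polybim) (bactE _ _ _ hM) (ract1 HM).
by rewrite /= !mulr1.
Qed.
Lemma rbt_ract r (m : M) : rbt (r : polybim n) m = rbt (1 : polybim n) (ract m r).
Proof.
have := tens_bal (@ractB n) (@bact n M) (1 : polybim n) (tens (@symr n) (@syml n) 1 r : Bbim n) m.
rewrite /ractB (bactE _ _ _ symmetric_polybim) (bactE _ _ _ hM) (lact1 HM).
by rewrite /= !mul1r.
Qed.

Lemma rbt_linear r : linear (fun m : M => rbt (r : polybim n) m).
Proof. by move=> c u v; apply: tensPr. Qed.

Lemma fspan_subspace : subspace (V := gcar M) (idspan (@sact Re (gsmod M)) (fdiff n) n).
Proof.
split; first exact: (@span0 Re (gsmod M)).
move=> c u v hu hv; apply: (@spanD Re (gsmod M)) => //; move: hu => [w ->].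
exists (fun k => c *: w k); rewrite scaler_sumr; apply: eq_bigr => k _.
exact/esym/gactZr.
Qed.

Lemma fspan_gact p (m : M) : codiag n p = 0 ->
  idspan (@sact Re (gsmod M)) (fdiff n) n (gact p m).
Proof.
move=> /codiag_ker [w ->]; exists (fun k => gact (w k) m).
rewrite -[LHS]/(@sact Re (gsmod M) _ m) sact_suml; apply: eq_bigr => k _.
by rewrite sactM.
Qed.

Local Notation pr := (qpi fspan_subspace).

Lemma coinv_bal : balanced (@ractB n) (@bact n M) (fun (r : polybim n) m => pr (lact r m)).
Proof.
split=> [m c r r'|r c m m'|r b m].
- by rewrite (lact_linear_l HM) linearP.
- by rewrite (lact_linear_r HM) linearP.
move: b; apply: tensor_eq => [c u v|c u v|f g].
- by rewrite /ractB (bact_linear _ symmetric_polybim) (lact_linear_l HM) linearP.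
- by rewrite (bact_linear _ hM) (lact_linear_r HM) linearP.
rewrite /ractB (bactE _ _ _ symmetric_polybim) (bactE _ _ _ hM); apply/qpiP => /=.
(* Moving [g] from the right to the left changes the value by a multiple of [g(x) - g(y)], which
   dies on the diagonal. *)
have -> : lact (f * (r * g)) m - lact r (lact f (ract m g)) =
    gact (lemb n (r * f) * (lemb n g - remb n g)) m.
  rewrite gactM gactB !gact_lemb gact_remb [lact (r * f) _](linearB (mklin (lact_linear_r HM (r * f)))) /=.
  by rewrite /mklin_fun mulrA [f * r]mulrC !(lactM HM).
apply: fspan_gact; rewrite rmorphM rmorphB rembK.
by rewrite [codiag n (lemb n g)](lembK g) subrr mulr0.
Qed.

(** In one direction [r ⊗ m |-> r m] maps back to [M / (f) M]; in the other, [x_k m] and [m x_k]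
    have the same image in the tensor product. *)
Lemma rbt_fspan (m : M) : rbt (1 : polybim n) m = 0 <->
  idspan (@sact Re (gsmod M)) (fdiff n) n m.
Proof.
split=> [h|[w ->]].
  have : tensor_lift coinv_bal (rbt (1 : polybim n) m) = 0 by rewrite h linear0.
  by rewrite [LHS](tliftE coinv_bal) (lact1 HM) => /qpi_eq0.
rewrite [LHS](linear_sum (mklin (rbt_linear 1))) big1 //= => k _.
rewrite /mklin_fun /fdiff gactB gact_lemb gact_remb.
rewrite [LHS](linearB (mklin (rbt_linear 1))) /= /mklin_fun.
by rewrite -rbt_lact -rbt_ract subrr.
Qed.

Section Degree.
Variable k : int.

Lemma rbt_deg (m : degpart M k) : tens_deg (xa := @ractB n) (ay := @bact n M)
  (@gdeg n (polybim n)) (@gdeg n M) k (rbt (1 : polybim n) (val m : M)).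
Proof.
rewrite -[k in tens_deg _ _ k _]add0r; apply: tens_deg_tens; last exact: degpartP.
by move=> e; rewrite msupp1 inE => /eqP ->; rewrite mdeg0 muln0.
Qed.
Definition rbtop_fun (m : degpart M k) : RB_deg M k :=
  exist _ (rbt (1 : polybim n) (val m : M)) (introT (subspace_predP _ _) (rbt_deg m)).
Fact rbtop_linear : linear rbtop_fun.
Proof. by move=> c u v; apply: val_inj; apply: rbt_linear. Qed.
Definition rbtop : {linear degpart M k -> RB_deg M k} := mklin rbtop_linear.

Lemma rbtop_ker m : rbtop m = 0 <-> idspan (@sact Re (gsmod M)) (fdiff n) n (val m : M).
Proof.
apply: iff_trans (rbt_fspan _); split=> [h|h]; last exact: val_inj.
have h' := congr1 (fun t : RB_deg M k => val t : RB M) h; exact: (etrans h' (linear0 _)).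
Qed.

Lemma rbtop_surj t : exists m, rbtop m = t.
Proof.
suff [m hm] : exists m : degpart M k, rbt (1 : polybim n) (val m : M) = val t.
  by exists m; apply: val_inj.
have := elimT (subspace_predP _ _) (valP t); move: (val t) => {}t.
move: t; apply: tens_degP.
  split=> [|c _ _ [u <-] [v <-]]; last first.
    by exists (c *: u + v); apply: rbt_linear.
  by exists 0; apply: linear_fun0 (rbt_linear 1).
move=> a b r m <- hr hm; exists (mkdeg (lact_deg HM hr hm)).
exact/esym/rbt_lact.
Qed.
End Degree.
End Object.

Lemma rbtop_nat (M N : gbimod n) (f : ghom M N) k (m : degpart M k) :
  RB_deg_map f k (rbtop M k m) = rbtop N k (deg_map f m).
Proof. apply: val_inj; exact: RB_mapE. Qed.
End TensorWithR.

Lemma hmap_square (U V W U1 V1 W1 U2 V2 W2 U3 V3 W3 : lmodType rat)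
    (f : {linear U -> V}) (g : {linear V -> W}) (f1 : {linear U1 -> V1}) (g1 : {linear V1 -> W1})
    (f2 : {linear U2 -> V2}) (g2 : {linear V2 -> W2}) (f3 : {linear U3 -> V3}) (g3 : {linear V3 -> W3})
    (a1 : {linear V -> V1}) (b1 : {linear V1 -> V3}) (a2 : {linear V -> V2}) (b2 : {linear V2 -> V3})
    a1Z a1B b1Z b1B a2Z a2B b2Z b2B :
  (forall v, b1 (a1 v) = b2 (a2 v)) ->
  forall x, @hmap _ _ _ f1 g1 _ _ _ f3 g3 b1 b1Z b1B (@hmap _ _ _ f g _ _ _ f1 g1 a1 a1Z a1B x) =
    @hmap _ _ _ f2 g2 _ _ _ f3 g3 b2 b2Z b2B (@hmap _ _ _ f g _ _ _ f2 g2 a2 a2Z a2B x).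
Proof.
move=> h x; rewrite -(qreprK x) !hmapE; congr qpi; apply: val_inj; exact: h.
Qed.

Section HochschildZero.
Variable n : nat.
Variable P : forall i : int, gresolution (gshift (polybim n) i).

(** Both sides are quotients of the part of [M] of degree [i + qshift n] by its elements in the span
    of [fdiff]. *)
Lemma coinv_ex (M : gbimod n) (hM : Bobj M) i :
  exists psi : {linear HH P i 0 M -> RB_deg M (i + qshift n)},
    bijective psi /\ forall m, psi (top_cls P hM m) = rbtop M (i + qshift n) m.
Proof.
apply: (@span_iso _ _ _ (@top_cls n P M hM i) (rbtop M (i + qshift n))).
- exact: top_cls_surj.
- exact: (rbtop_surj (Bobj_sym hM)).
- move=> m; apply: iff_trans (top_cls_ker _ _ _) _.
  exact: iff_sym (rbtop_ker (Bobj_sym hM) _).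
Qed.

Definition coinv_iso (M : gbimod n) (hM : Bobj M) i : {linear HH P i 0 M -> RB_deg M (i + qshift n)} :=
  sval (cid (coinv_ex hM i)).
Lemma coinv_iso_bij (M : gbimod n) (hM : Bobj M) i : bijective (coinv_iso hM i).
Proof. exact: (svalP (cid (coinv_ex hM i))).1. Qed.
Lemma coinv_isoE (M : gbimod n) (hM : Bobj M) i m :
  coinv_iso hM i (top_cls P hM m) = rbtop M (i + qshift n) m.
Proof. exact: (svalP (cid (coinv_ex hM i))).2. Qed.

Lemma coinv_iso_nat (M N : gbimod n) (f : ghom M N) (hM : Bobj M) (hN : Bobj N) i x :
  coinv_iso hN i (HH_map P i 0 f x) = RB_deg_map f _ (coinv_iso hM i x).
Proof.
have [m <-] := top_cls_surj hM x.
by rewrite (top_cls_nat P f hM hN) !coinv_isoE rbtop_nat.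
Qed.

Section Complex.
Variables (C : gcomplex n) (hC : Bcomplex C) (i k : int).

Let psi l := coinv_iso (hC l : Bobj (cobj C l)) i.

Lemma coinv_cycle v : HH_map P i 0 (cdiff C k (k + 1)) v = 0 ->
  RB_deg_map (cdiff C k (k + 1)) _ (psi k v) = 0.
Proof. by move=> h; rewrite -(coinv_iso_nat _ _ (hC (k + 1))) h linear0. Qed.
Lemma coinv_boundary u : exists u',
  RB_deg_map (cdiff C (k - 1) k) _ u' = psi k (HH_map P i 0 (cdiff C (k - 1) k) u).
Proof. by exists (psi (k - 1) u); rewrite -(coinv_iso_nat _ _ (hC k)). Qed.

Definition HHH0_coinv : {linear HHH0_at P C i k -> HRB C (i + qshift n) k} :=
  hmap (psi k) coinv_cycle coinv_boundary.

Lemma HHH0_coinv_bij : bijective HHH0_coinv.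
Proof.
apply: hmap_bij => [|v|u'].
- exact: coinv_iso_bij.
- rewrite -(coinv_iso_nat _ _ (hC (k + 1))) => h.
  by apply: (bij_inj (coinv_iso_bij (hC (k + 1)) i)); rewrite h linear0.
- have [chi h1 h2] := coinv_iso_bij (hC (k - 1)) i; exists (chi u').
  by rewrite [LHS](coinv_iso_nat _ (hC (k - 1))) h2.
Qed.
End Complex.

Lemma HHH0_coinv_nat (C D : gcomplex n) (hC : Bcomplex C) (hD : Bcomplex D)
    (f : gcmap C D) (i k : int) (x : HHH0_at P C i k) :
  HHH0_coinv hD i k (HHH_map P f i 0 k x) = HRB_map f (i + qshift n) k (HHH0_coinv hC i k x).
Proof.
apply: hmap_square => v; exact: coinv_iso_nat.
Qed.
End HochschildZero.

(** * The exterior algebra factor *)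

Section FreeFactor.
Variables (I : finType) (T : eqType) (deg : I -> T) (Y : T -> lmodType rat).

Definition findex (e : T) : Type := {S : I | deg S == e}.
(** [Lambda] for an arbitrary degree function on a finite basis. *)
Definition ffree (e : T) : lmodType rat := {ffun {S : I | deg S == e} -> rat^o}.
Local Notation tq e := (tens (fun (l : ffree e) c => c *: l) (fun c (y : Y e) => c *: y)).

Lemma fcoord_bal e (s : findex e) : balanced (fun (l : ffree e) (c : rat) => c *: l)
  (fun c (y : Y e) => c *: y) (fun l y => l s *: y).
Proof.
split=> [y c l l'|l c y y'|l c y].
- by rewrite !ffunE scalerDl scalerA.
- by rewrite scalerDr !scalerA mulrC.
- by rewrite ffunE scalerA mulrC.
Qed.
Definition fcoord e (s : findex e) : {linear tensorQ (ffree e) (Y e) -> Y e} :=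
  tensor_lift (fcoord_bal s).
Lemma fcoordE e (s : findex e) l y : fcoord s (tq e l y) = l s *: y.
Proof. exact: (tliftE (fcoord_bal s)). Qed.

Definition fdelta e (s : findex e) : ffree e := [ffun s' => (s' == s)%:R].

Lemma fcoord_sum e (t : tensorQ (ffree e) (Y e)) :
  \sum_(s : {S : I | deg S == e}) tq e (fdelta s) (fcoord s t) = t.
Proof.
move: t; apply: tensor_eq => [c u v|c u v|l y] //.
  rewrite scaler_sumr -big_split; apply: eq_bigr => s _.
  by rewrite linearP; apply: tensPr.
have lin : linear (fun l : ffree e => tq e l y) by move=> c u v; apply: tensP.
have lE : l = \sum_(s : {S : I | deg S == e}) l s *: fdelta s.
  apply/ffunP => s; rewrite sum_ffunE (bigD1 s) //= !ffunE eqxx big1 ?addr0 => [|s' ns].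
    exact/esym/mulr1.
  by rewrite !ffunE eq_sym (negbTE ns); apply: mulr0.
rewrite -[RHS]/(mklin lin l) [in RHS]lE linear_sum; apply: eq_bigr => s _.
have linr : linear (fun y => tq e (fdelta s) y) by move=> c u v; apply: tensPr.
rewrite fcoordE [RHS](linearZ_LR (mklin lin)).
exact: (linearZ_LR (mklin linr)).
Qed.

(** A basis element in the fibre over [e] has degree [e] only up to a proof of equality, along which
    its component must be transported. *)
Definition fcast a b (q : a = b) (y : Y a) : Y b := eq_rect a (fun e => Y e : Type) y b q.
Lemma fcast_id a (q : a = a) y : fcast q y = y.
Proof. by rewrite (eq_irrelevance q (erefl a)). Qed.

Local Notation D := (dsum (fun e => tensorQ (ffree e) (Y e))).

Definition fcoords (t : D) : dprod (fun S => Y (deg S)) :=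
  fun S => fcoord (exist _ S (eqxx (deg S))) ((val t : dprod _) (deg S)).
Fact fcoords_linear : linear fcoords.
Proof.
move=> c u v; apply: functional_extensionality_dep => S.
by rewrite /fcoords; apply: linearP.
Qed.

Definition fglue_fun (y : dprod (fun S => Y (deg S))) :
    dprod (fun e => tensorQ (ffree e) (Y e)) :=
  fun e => \sum_(s : {S : I | deg S == e}) tq e (fdelta s) (fcast (eqP (valP s)) (y (val s))).
Lemma fglue_supp y : finsupport (fglue_fun y).
Proof.
exists (map deg (enum I)) => e he; apply: big1 => s _.
by case/negP: he; rewrite -(eqP (valP s)); apply/map_f; rewrite mem_enum.
Qed.
Definition fglue y : D := exist _ (fglue_fun y) (introT (subspace_predP _ _) (fglue_supp y)).

(** Tensoring with a free space yields one copy of [Y e] per basis element of degree [e]; finiteness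
    of [I] makes the glued families finitely supported. *)
Lemma dsum_ffree : linear_iso D (dprod (fun S => Y (deg S))).
Proof.
exists (mklin fcoords_linear); exists fglue => [t|y].
  apply: val_inj; apply: functional_extensionality_dep => e.
  rewrite -[RHS]fcoord_sum; apply: eq_bigr => -[x p] _; congr tens.
  rewrite /= /mklin_fun /fcoords; move: (eqP _) => /= q.
  case: e / q p => p; rewrite fcast_id; congr (fcoord _ _); exact: val_inj.
apply: functional_extensionality_dep => S; rewrite /= /mklin_fun /fcoords /= /fglue_fun.
set s0 := exist _ _ _; rewrite linear_sum (bigD1 s0) //= big1 ?addr0 => [|s ns].
  by rewrite fcoordE ffunE eqxx scale1r fcast_id.
by rewrite fcoordE ffunE eq_sym (negbTE ns) scale0r.
Qed.
End FreeFactor.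

Lemma sum_triple (U V W : nmodType) (I : Type) (s : seq I) (p : pred I)
    (F : I -> U) (G : I -> V) (H : I -> W) :
  \sum_(i <- s | p i) ((F i, G i, H i) : U * V * W) =
  (\sum_(i <- s | p i) F i, \sum_(i <- s | p i) G i, \sum_(i <- s | p i) H i).
Proof. by elim: s => [|i s IH]; rewrite ?big_nil // !big_cons IH; case: (p i). Qed.

Lemma ext_degreeE n (S : {set 'I_n}) : ext_degree S = (- sweight S, #|S|%:Z, 0).
Proof.
transitivity (\sum_(k in S) - (2 * k.+1)%:Z, \sum_(k in S) (1 : int), \sum_(k in S) (0 : int)).
  exact: (@sum_triple int int int _ (index_enum _) (fun k => k \in S) (fun k : 'I_n => - (2 * k.+1)%:Z : int) (fun=> 1 : int) (fun=> 0 : int)).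
rewrite big1_eq sumr_const natz; congr (_, _, _).
exact: sumrN.
Qed.

Lemma linear_iso_trivial (V W : lmodType rat) :
  (forall v : V, v = 0) -> (forall w : W, w = 0) -> linear_iso V W.
Proof.
move=> hV hW; have lin : linear (fun _ : V => 0 : W).
  by move=> c u v; rewrite scaler0 addr0.
by exists (mklin lin); exists (fun=> 0) => x; [rewrite [RHS]hV | rewrite [RHS]hW].
Qed.

Lemma HHH_Lambda n (P : forall i : int, gresolution (gshift (polybim n) i)) (C : gcomplex n) :
  Bcomplex C -> trigraded_iso (HHH P C) (trigraded_tensor (Lambda n) (HHH0 P C)).
Proof.
move=> hC [[i j] k]; apply: linear_iso_trans (linear_iso_sym
  (dsum_ffree (@ext_degree n) (fun e => HHH0 P C ((i, j, k) - e)))).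
have dE (S : {set 'I_n}) : (i, j, k) - ext_degree S = (i + sweight S, j - #|S|%:Z, k).
  by rewrite ext_degreeE; congr (_, _, _); rewrite /= ?opprK ?subr0.
(* [HHH0] lives in Hochschild degree 0, so [xi_S] contributes only if [#|S| = j]. *)
have triv (S : {set 'I_n}) : j != #|S|%:Z -> forall y : HHH0 P C ((i, j, k) - ext_degree S), y = 0.
  rewrite dE /= -subr_eq0; case: (j - _) => [[|m]|m] //= _ y; exact: zerosp_eq.
(* In negative Hochschild degrees both sides vanish. *)
case: j triv dE => j triv dE; last first.
  apply: linear_iso_trivial => [v|w]; first exact: zerosp_eq.
  by apply: functional_extensionality_dep => S; apply: triv.
apply: linear_iso_trans (HHH_split P i j k hC) _; apply: linear_iso_sym.
apply: dprod_restrict => [[S hS]|S hS].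
  rewrite dE /= (eqP hS) subrr; exact: linear_iso_refl.
by apply: triv; rewrite eqz_nat eq_sym.
Qed.

Theorem proposition1p7 (n : nat) (n_gt0 : (0 < n)%N) :
  (forall (P : forall i : int, gresolution (gshift (polybim n) i))
      (C : gcomplex n), Bcomplex C ->
    trigraded_iso (HHH P C) (trigraded_tensor (Lambda n) (HHH0 P C))) /\
  (exists s : int,
    forall P : (forall i : int, gresolution (gshift (polybim n) i)),
    exists Phi : (forall C : gcomplex n, Bcomplex C -> forall i k : int,
                    {linear HHH0_at P C i k -> HRB C (i + s) k}),
      (forall (C : gcomplex n) (hC : Bcomplex C) (i k : int),
         bijective (Phi C hC i k)) /\
      (forall (C D : gcomplex n) (hC : Bcomplex C) (hD : Bcomplex D)
          (f : gcmap C D) (i k : int) (x : HHH0_at P C i k),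
         Phi D hD i k (HHH_map P f i 0 k x) =
         HRB_map f (i + s) k (Phi C hC i k x))).
Proof.
split; first exact: HHH_Lambda.
exists (qshift n) => P; exists (@HHH0_coinv n P); split; first exact: HHH0_coinv_bij.
exact: HHH0_coinv_nat.
Qed.
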